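(* Let $a\in\mathbb{R}$, $a\neq0$. Let $U\subset\mathbb{R}^2$ be open with coordinates $(x,y)$, let $h,H:U\to\mathbb{R}$ be positive smooth functions such that $\Delta\ln H=2a^2h^2-4a^2H^2$ on $U$, where $\Delta=\partial_x^2+\partial_y^2$. Let $M=U\times N$ with $N=\{(z,t)\in\mathbb{R}^2: 0<|z|<\frac{\pi}{2|a|}\}$, and let $g=\theta_1^2+\theta_2^2+\theta_3^2+\theta_4^2$, i.e. $g(X,Y)=\sum_{i=1}^4\theta_i(X)\theta_i(Y)$, where $$\theta_1=\cos(az)\,h\,dx,\qquad \theta_2=\cos(az)\,h\,dy,$$ $$\theta_3=\sin(2az)\,dt-\big(\cos(2at)\cos(2az)H+\sin(2az)\,l_2\big)dx-\big(-\sin(2at)\cos(2az)H+\sin(2az)\,n_2\big)dy,$$ $$\theta_4=dz-\sin(2at)\,H\,dx-\cos(2at)\,H\,dy,$$ with $l_2=-\frac1{2a}(\ln H)_y$, $n_2=\frac1{2a}(\ln H)_x$ (here $h,H,l_2,n_2$ are evaluated at $(x,y)$). Let $\{E_1,E_2,E_3,E_4\}$ be the $g$-orthonormal frame dual to $\{\theta_1,\theta_2,\theta_3,\theta_4\}$, let $\mathcal{D}=\mathrm{span}\{E_3,E_4\}$ and $\mathcal{D}^\perp=\mathrm{span}\{E_1,E_2\}$, let $\bar J$ be the Kähler structure with Kähler form $\bar\Omega=\theta_1\wedge\theta_2+\theta_4\wedge\theta_3$ and $J$ the Hermitian structure with Kähler form $\Omega=\theta_1\wedge\theta_2+\theta_3\wedge\theta_4$,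 with Lee form $\theta=-\alpha\theta_4$, $\alpha=2a\tan(az)$. Then: (i) $\Delta\ln H=2a^2h^2-4a^2H^2$ on $U$. (ii) $\Gamma^2_{11}=\dfrac{a\sin(az)\cos(2at)H}{\cos^2(az)\,h}-\dfrac{h_y}{\cos(az)\,h^2}$ and $\Gamma^1_{22}=\dfrac{a\sin(az)\sin(2at)H}{\cos^2(az)\,h}-\dfrac{h_x}{\cos(az)\,h^2}$. (iii) In the frame $\{E_1,E_2,E_3,E_4\}$ the Ricci tensor of $(M,g)$ is $Ric=\mathrm{diag}(\lambda,\lambda,6a^2,6a^2)$ with $$\lambda=\frac{-4a^2h^2+2a^2H^2-\Delta\ln h}{h^2\cos^2(az)}+6a^2.$$ (iv) The scalar curvature of $(M,g)$ is $\tau=\dfrac{-8a^2h^2+4a^2H^2-2\Delta\ln h}{h^2\cos^2(az)}+24a^2$. (v) The conformal scalar curvature is $\kappa=\dfrac{-8a^2h^2+4a^2H^2-2\Delta\ln h}{h^2\cos^2(az)}$. (vi) In the frame $\{\Omega,\phi,\psi\}$, where $\{\phi,\psi\}$ is any (local) orthonormal basis of $LM$, the Weyl tensor $W^-$ is $$W^-=\mathrm{diag}\Big(\tfrac{-4a^2h^2+2a^2H^2-\Delta\ln h}{3h^2\cos^2(az)},\ \tfrac{4a^2h^2-2a^2H^2+\Delta\ln h}{6h^2\cos^2(az)},\ \tfrac{4a^2h^2-2a^2H^2+\Delta\ln h}{6h^2\cos^2(az)}\Big).$$ (vii) The sectional curvature of $(M,g)$ on $\mathcal{D}^\perp$ is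 $K(E_1,E_2)=\dfrac{2a^2H^2-\Delta\ln h}{\cos^2(az)\,h^2}-4a^2\tan^2(az)$ and on $\mathcal{D}$ is $K(E_3,E_4)=4a^2$. (viii) $(M,g)$ is a space form if and only if $\Delta\ln h=-4a^2h^2+2a^2H^2$ on $U$; in that case it is locally isometric to $\mathbb{CP}^2$ with the Fubini-Study metric of constant holomorphic sectional curvature $4a^2$.
   Context: It is known from earlier work that, for this metric, $\bar J$ is a Kähler structure and $J$ is an integrable orthogonal complex structure (inducing the opposite orientation) which is not locally conformally Kähler. Conventions. The Kähler form of an almost Hermitian structure $J$ is $\Omega(X,Y)=g(JX,Y)$; thus here $\bar JE_1=E_2$, $\bar JE_3=-E_4$, $JE_1=E_2$, $JE_3=E_4$. $M$ is oriented so that $\bar\Omega$ is self-dual; then $\Omega$ is anti-self-dual. $LM$ denotes the rank-2 bundle of anti-self-dual 2-forms orthogonal to $\Omega$. The Lee form $\theta$ of $(M,g,J)$ is defined by $d\Omega=2\theta\wedge\Omega$. $\Gamma^k_{ij}=g(\nabla_{E_i}E_j,E_k)$, with $\nabla$ the Levi-Civita connection. The curvature tensor is $R(X,Y)Z=([\nabla_X,\nabla_Y]-\nabla_{[X,Y]})Z$, $R(X,Y,Z,W)=g(R(X,Y)Z,W)$, and $K(X,Y)=R(X,Y,Y,X)$ for orthonormal $X,Y$. $Ric(X,Y)=\sum_i g(R(E_i,X)Y,E_i)$, and $\tau=\mathrm{tr}_g Ric$. The conformal scalar curvature (of $(M,g,J)$) is $\kappa=\tau-6(|\theta|^2+\delta\theta)$,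 where $\delta\theta=-\sum_i(\nabla_{E_i}\theta)(E_i)$. $W^-$ is the anti-self-dual part of the Weyl tensor, viewed as a symmetric endomorphism of the bundle of anti-self-dual 2-forms, normalized so that the curvature operator of a space of constant sectional curvature $1$ is the identity on 2-forms. ''Space form'' means that the Kähler surface $(M,g,\bar J)$ has constant holomorphic sectional curvature $R(X,\bar JX,\bar JX,X)$, $|X|=1$. *)

(* Defs.v *)
From HB Require Import structures.
From mathcomp Require Import all_boot all_order all_algebra.
From mathcomp Require Import all_classical all_reals all_analysis.
Set Implicit Arguments.
Unset Strict Implicit.
Unset Printing Implicit Defensive.
Import Order.TTheory GRing.Theory Num.Theory.
Import numFieldNormedType.Exports.
Local Open Scope classical_set_scope.
Local Open Scope ring_scope.

Section Smooth.
Variables (R : realType) (V W : normedModType R).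

Fixpoint Ck (k : nat) (U : set V) (f : V -> W) : Prop :=
  if k is k'.+1 then
    (forall p, U p -> differentiable f p) /\
    (forall v : V, Ck k' U (fun p => 'D_v f p))
  else forall p, U p -> {for p, continuous f}.

Definition smooth (U : set V) (f : V -> W) := forall k, Ck k U f.

End Smooth.

Definition o1 : 'I_4 := @Ordinal 4 0 isT.
Definition o2 : 'I_4 := @Ordinal 4 1 isT.
Definition o3 : 'I_4 := @Ordinal 4 2 isT.
Definition o4 : 'I_4 := @Ordinal 4 3 isT.

(* Riemannian geometry on open subsets of R^4, in the global coordinates:
   tangent vectors and covectors are row vectors, and a bilinear form on the
   tangent space (a metric, a 2-form) is given by its 4x4 matrix. *)
Section Riemann.
Variable R : realType.
Notation vec := 'rV[R]_4.

Definition pair1 (w u : vec) : R := (w *m u^T) 0 0.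
Definition bil (A : 'M[R]_4) (u v : vec) : R := (u *m A *m v^T) 0 0.

Definition coord_vec (i : 'I_4) : vec := delta_mx 0 i.

Definition lie_bracket (X Y : vec -> vec) (p : vec) : vec :=
  'D_(X p) Y p - 'D_(Y p) X p.

Section Metric.
Variable g : vec -> 'M[R]_4.

(* The coefficient of the k-th coordinate field in the covariant derivative of
   the j-th coordinate field along the i-th one. *)
Definition christoffel (k i j : 'I_4) (p : vec) : R :=
  2^-1 * \sum_(l < 4) invmx (g p) k l *
    ('D_(coord_vec i) (fun q => g q j l) p
     + 'D_(coord_vec j) (fun q => g q i l) p
     - 'D_(coord_vec l) (fun q => g q i j) p).

Definition nabla (X Y : vec -> vec) (p : vec) : vec :=
  'D_(X p) Y p +
  \row_(k < 4) \sum_(i < 4) \sum_(j < 4) X p 0 i * Y p 0 j * christoffel k i j p.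

Definition curvature (X Y Z : vec -> vec) (p : vec) : vec :=
  nabla X (nabla Y Z) p - nabla Y (nabla X Z) p - nabla (lie_bracket X Y) Z p.

(* The curvature is tensorial, so that tangent vectors at p may be extended to
   constant vector fields. *)
Definition Rm (p u v w x : vec) : R :=
  bil (g p) (curvature (fun=> u) (fun=> v) (fun=> w) p) x.

Definition sectional (p u v : vec) : R := Rm p u v v u.

Definition kahler_form (J : vec -> 'M[R]_4) (p : vec) : 'M[R]_4 := J p *m g p.

(* The vector u is mapped to u *m J p by the endomorphism J p. *)
Lemma kahler_formE (J : vec -> 'M[R]_4) (p u v : vec) :
  bil (kahler_form J p) u v = bil (g p) (u *m J p) v.
Proof. by rewrite /bil /kahler_form !mulmxA. Qed.

Definition space_form (M : set vec) (J : vec -> 'M[R]_4) : Prop :=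
  exists c : R, forall p u : vec, M p -> bil (g p) u u = 1 ->
    Rm p u (u *m J p) (u *m J p) u = c.

Definition nabla_form1 (w : vec -> vec) (X Y : vec -> vec) (p : vec) : R :=
  'D_(X p) (fun q => pair1 (w q) (Y q)) p - pair1 (w p) (nabla X Y p).

(* In this subsection E is meant to be a g-orthonormal frame. *)
Section Frame.
Variable E : 'I_4 -> vec -> vec.

Definition Gamma (k i j : 'I_4) (p : vec) : R :=
  bil (g p) (nabla (E i) (E j) p) (E k p).

Definition ricci (p u v : vec) : R := \sum_(i < 4) Rm p (E i p) u v (E i p).

Definition scalar_curv (p : vec) : R := \sum_(i < 4) ricci p (E i p) (E i p).

Definition codiff (w : vec -> vec) (p : vec) : R :=
  - \sum_(i < 4) nabla_form1 w (E i) (E i) p.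

Definition normsq1 (w : vec -> vec) (p : vec) : R :=
  \sum_(i < 4) pair1 (w p) (E i p) ^+ 2.

Definition conformal_scalar_curv (lee : vec -> vec) (p : vec) : R :=
  scalar_curv p - 6 * (normsq1 lee p + codiff lee p).

Definition weyl (p u v w x : vec) : R :=
  Rm p u v w x
  - 2^-1 * (bil (g p) u x * ricci p v w + bil (g p) v w * ricci p u x
            - bil (g p) u w * ricci p v x - bil (g p) v x * ricci p u w)
  + scalar_curv p / 6 *
      (bil (g p) u x * bil (g p) v w - bil (g p) u w * bil (g p) v x).

(* The argument order (v, u) at the end makes this, with Rm in place of weyl,
   the identity on 2-forms for a space of constant sectional curvature 1. *)
Definition weyl_op (p : vec) (w : 'M[R]_4) : 'M[R]_4 :=
  \matrix_(k < 4, l < 4)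
    (2^-1 * \sum_(i < 4) \sum_(j < 4) bil w (E i p) (E j p) *
       weyl p (E i p) (E j p) (coord_vec l) (coord_vec k)).

Definition ip2 (p : vec) (w1 w2 : 'M[R]_4) : R :=
  2^-1 * \sum_(i < 4) \sum_(j < 4)
           bil w1 (E i p) (E j p) * bil w2 (E i p) (E j p).

End Frame.

Definition wedge11 (a b : vec) : 'M[R]_4 := a^T *m b - b^T *m a.

Definition levi_civita (i j k l : 'I_4) : R :=
  \det (\matrix_(r < 4, s < 4) (nth i [:: i; j; k; l] r == s)%:R).

(* Here f is a positively oriented g-orthonormal frame; the covector f k p *m g p
   is metrically dual to f k p. *)
Definition hodge (f : 'I_4 -> vec -> vec) (p : vec) (w : 'M[R]_4) : 'M[R]_4 :=
  4^-1 *: \sum_(i < 4) \sum_(j < 4) \sum_(k < 4) \sum_(l < 4)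
    (levi_civita i j k l * bil w (f i p) (f j p)) *:
      wedge11 (f k p *m g p) (f l p *m g p).

Definition is_asd (f : 'I_4 -> vec -> vec) (p : vec) (w : 'M[R]_4) : Prop :=
  w^T = - w /\ hodge f p w = - w.

Definition weyl_minus (f : 'I_4 -> vec -> vec) (p : vec) (w : 'M[R]_4) :
    'M[R]_4 :=
  2^-1 *: (weyl_op f p w - hodge f p (weyl_op f p w)).

(* The fibre at p of the bundle of anti-self-dual 2-forms orthogonal to Om. *)
Definition in_LM (f : 'I_4 -> vec -> vec) (Om : vec -> 'M[R]_4) (p : vec)
    (w : 'M[R]_4) : Prop :=
  is_asd f p w /\ ip2 f p w (Om p) = 0.

End Metric.

Definition ext_deriv2 (Om : vec -> 'M[R]_4) (p u v w : vec) : R :=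
  'D_u (fun q => bil (Om q) v w) p + 'D_v (fun q => bil (Om q) w u) p
  + 'D_w (fun q => bil (Om q) u v) p.

Definition wedge12 (a : vec) (Om : 'M[R]_4) (u v w : vec) : R :=
  pair1 a u * bil Om v w + pair1 a v * bil Om w u + pair1 a w * bil Om u v.

(* In dimension 4 the form lee is determined by Om, since the wedge product
   with a nondegenerate 2-form is injective on 1-forms. *)
Definition is_lee_form (M : set vec) (Om : vec -> 'M[R]_4) (lee : vec -> vec) :
    Prop :=
  forall p u v w, M p -> ext_deriv2 Om p u v w = 2 * wedge12 (lee p) (Om p) u v w.

Definition metric_of_coframe (th : 'I_4 -> vec -> vec) (p : vec) : 'M[R]_4 :=
  \sum_(i < 4) (th i p)^T *m th i p.

Definition dual_frame (M : set vec) (th E : 'I_4 -> vec -> vec) : Prop :=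
  forall p i j, M p -> pair1 (th i p) (E j p) = (i == j)%:R.

(* Every point of (M, g) has an open neighbourhood isometric to an open subset
   of (R^4, g'). *)
Definition locally_isometric (M : set vec) (g g' : vec -> 'M[R]_4) : Prop :=
  forall p, M p -> exists (V : set vec) (F G : vec -> vec),
    [/\ [/\ open V, V p & V `<=` M],
        smooth V F,
        open (F @` V) /\ smooth (F @` V) G,
        forall q, V q -> G (F q) = q &
        forall q u v, V q -> bil (g' (F q)) ('D_u F q) ('D_v F q) = bil (g q) u v].

(* Multiplication by i on C^2 = R^4, with (w1, w2) = (x1 + i y1, x2 + i y2)
   encoded by the row vector (x1, y1, x2, y2). *)
Definition mul_i (w : vec) : vec :=
  \row_(j < 4) [:: - w 0 o2; w 0 o1; - w 0 o4; w 0 o3]`_j.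

(* The Fubini-Study metric of constant holomorphic sectional curvature c, in the
   affine chart w |-> [1 : w1 : w2] of CP^2, namely
     (4 / c) ((1 + |w|^2) |dw|^2 - |<w, dw>|^2) / (1 + |w|^2)^2,
   where <,> is the Hermitian product, with real part w.dw and imaginary part
   (i w).dw up to sign. It has the same expression in the other two standard
   charts, so that a Riemannian manifold is locally isometric to CP^2 if and only
   if it is locally isometric to this chart. *)
Definition fubini_study (c : R) (w : vec) : 'M[R]_4 :=
  let s := 1 + pair1 w w in
  (4 / c / s ^+ 2) *:
    (s%:M - w^T *m w - (mul_i w)^T *m mul_i w).

End Riemann.

Section Setup.
Variable R : realType.

Definition ux : 'rV[R]_2 := delta_mx 0 0.
Definition uy : 'rV[R]_2 := delta_mx 0 1.

Definition laplacian (f : 'rV[R]_2 -> R) (q : 'rV[R]_2) : R :=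
  'D_ux ('D_ux f) q + 'D_uy ('D_uy f) q.

(* Coordinates (x, y, z, t) on R^4. *)
Definition xy (p : 'rV[R]_4) : 'rV[R]_2 := @lsubmx R 1 2 2 p.
Definition zc (p : 'rV[R]_4) : R := p 0 o3.
Definition tc (p : 'rV[R]_4) : R := p 0 o4.
Definition dx : 'rV[R]_4 := coord_vec R o1.
Definition dy : 'rV[R]_4 := coord_vec R o2.
Definition dz : 'rV[R]_4 := coord_vec R o3.
Definition dt : 'rV[R]_4 := coord_vec R o4.

Variable a : R.

Definition domM (U : set 'rV[R]_2) : set 'rV[R]_4 :=
  [set p | U (xy p) /\ 0 < `|zc p| < pi / (2 * `|a|)].

Variables h H : 'rV[R]_2 -> R.

Definition l2 (q : 'rV[R]_2) : R := - (2 * a)^-1 * 'D_uy (@ln R \o H) q.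
Definition n2 (q : 'rV[R]_2) : R := (2 * a)^-1 * 'D_ux (@ln R \o H) q.

Definition theta1 (p : 'rV[R]_4) : 'rV[R]_4 := (cos (a * zc p) * h (xy p)) *: dx.

Definition theta2 (p : 'rV[R]_4) : 'rV[R]_4 := (cos (a * zc p) * h (xy p)) *: dy.

Definition theta3 (p : 'rV[R]_4) : 'rV[R]_4 :=
  let z := zc p in let t := tc p in
  sin (2 * a * z) *: dt
  - (cos (2 * a * t) * cos (2 * a * z) * H (xy p)
     + sin (2 * a * z) * l2 (xy p)) *: dx
  - (- sin (2 * a * t) * cos (2 * a * z) * H (xy p)
     + sin (2 * a * z) * n2 (xy p)) *: dy.

Definition theta4 (p : 'rV[R]_4) : 'rV[R]_4 :=
  dz - (sin (2 * a * tc p) * H (xy p)) *: dx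
     - (cos (2 * a * tc p) * H (xy p)) *: dy.

Definition theta (i : 'I_4) : 'rV[R]_4 -> 'rV[R]_4 :=
  nth theta1 [:: theta1; theta2; theta3; theta4] i.

Definition gmet : 'rV[R]_4 -> 'M[R]_4 := metric_of_coframe theta.

Definition Omega_bar (p : 'rV[R]_4) : 'M[R]_4 :=
  wedge11 (theta1 p) (theta2 p) + wedge11 (theta4 p) (theta3 p).

Definition Omega (p : 'rV[R]_4) : 'M[R]_4 :=
  wedge11 (theta1 p) (theta2 p) + wedge11 (theta3 p) (theta4 p).

Definition lee_theta (p : 'rV[R]_4) : 'rV[R]_4 :=
  - (2 * a * tan (a * zc p)) *: theta4 p.

(* Omega_bar is self-dual for the orientation in which (E1, E2, E4, E3) is
   positive. *)
Definition oriented (E : 'I_4 -> 'rV[R]_4 -> 'rV[R]_4) (i : 'I_4) :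
    'rV[R]_4 -> 'rV[R]_4 :=
  nth (E o1) [:: E o1; E o2; E o4; E o3] i.

End Setup.

(* Main.v *)
(* In the coframe theta the metric is g = C C^T, and Cartan's first structure
   equation with a skew matrix A determines the Levi-Civita connection; the
   Toda equation makes its curvature equal to that of CP^2 plus a multiple K of
   (theta1 /\ theta2)^2, with K = B / D.  All the curvature statements are linear
   algebra in this orthonormal frame.  The holomorphic sectional curvature of u is
   4 a^2 |u|^4 + K (u_1^2 + u_2^2)^2, so M is a space form iff K = 0.  In that case the
   coframe and its connection assemble into an su(3)-valued 1-form omega with
   d omega + omega /\ omega = 0.  Hence dF = F omega has local solutions in SU(3); the
   line spanned by the column F e_1 is a map to CP^2 pulling back the Fubini-Study
   metric to g, and the inverse function theorem makes it a local isometry. *)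

Require Import Defs.
From HB Require Import structures.
From mathcomp Require Import all_boot all_order all_algebra.
From mathcomp Require Import all_classical all_reals all_analysis.
From mathcomp Require Import perm ring lra.
Set Implicit Arguments.
Unset Strict Implicit.
Unset Printing Implicit Defensive.
Import Order.TTheory GRing.Theory Num.Theory.
Import numFieldNormedType.Exports.
Local Open Scope classical_set_scope.
Local Open Scope ring_scope.

(** * Derivatives and maps of class C^k *)

(** A 1-form is a function of a point and a constant vector, so its exterior derivative at u, v is a
    difference of two directional derivatives, and the structure equations are identities between
    such derivatives. The coframe is built from forms [tau], [bet], [gam] with explicit derivatives;
    each structure equation then becomes a polynomial identity modulo cos^2 + sin^2 = 1.

    The analytic obstacle is the frame F. Solving dF = F omega along the rays from the base point is
    a linear equation, but F must also be differentiable across the rays. Flatness provides the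
    candidate for the transversal derivative, and a Gronwall estimate bounds the error by a multiple
    of |h|^2. On rays so short that n K <= 1/2, factors 2 and 1/2 take the place of exponentials.

    Complex matrices are carried as real 6 x 6 matrices commuting with [Jmx]. The vector e_1 is the
    middle one of three because omega e_1, modulo the complex line of e_1, is a times the unitary
    coframe (theta1 + i theta2, theta4 + i theta3) of [Jbar]; so for Z = F e_1 the part of |dZ|^2
    orthogonal to that line is a^2 g, and the normalisation gives the constant 4 a^2. *)

Section DeriveComp.
Variables (R : realType) (V W X : normedModType R).
Implicit Types (f : V -> W) (g : W -> X) (p u v : V).

Lemma derive_comp f g p v : differentiable f p -> differentiable g (f p) ->
  'D_v (g \o f) p = 'D_('D_v f p) g (f p).
Proof.
move=> df dg; rewrite deriveE; last exact: differentiable_comp.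
by rewrite diff_comp//= deriveE// deriveE.
Qed.

Lemma derive_dirP f p k u v : differentiable f p ->
  'D_(k *: u + v) f p = k *: 'D_u f p + 'D_v f p.
Proof. by move=> df; rewrite !deriveE// linearP. Qed.

End DeriveComp.

Section DeriveDir.
Variables (R : realType) (V W : normedModType R).
Implicit Types (f : V -> W) (p u v : V).

Lemma derive_dirD f p u v : differentiable f p ->
  'D_(u + v) f p = 'D_u f p + 'D_v f p.
Proof. by move=> df; rewrite -{1}[u]scale1r derive_dirP// scale1r. Qed.

Lemma derive_dirZ f p k u : differentiable f p -> 'D_(k *: u) f p = k *: 'D_u f p.
Proof. by move=> df; rewrite -[k *: u]addr0 derive_dirP// derive0 addr0. Qed.

Lemma derive_dir_sum f p n (u : 'I_n -> V) : differentiable f p ->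
  'D_(\sum_i u i) f p = \sum_i 'D_(u i) f p.
Proof.
by move=> df; elim/big_ind2: _ => [|_ x _ y <- <-|//]; rewrite ?derive0 ?derive_dirD.
Qed.

Lemma near_open (U : set V) (P : V -> Prop) p : open U -> U p ->
  (forall q, U q -> P q) -> \near p, P p.
Proof. by move=> oU Up h; apply: filterS h _; exact: open_nbhs_nbhs. Qed.

End DeriveDir.

Section DiffIntro.
Variables (R : realType) (V W : normedModType R).
Implicit Types (f g : V -> W) (p u v : V).

Lemma diff_epsP f p (L : {linear V -> W}) : continuous L ->
  (forall e, 0 < e -> \forall h \near 0, `|f (h + p) - f p - L h| <= e * `|h|) ->
  f \o shift p = cst (f p) + L +o_ 0 id.
Proof.
move=> cL H; apply: eqaddoE; apply/eqaddoP => e e0.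
by near=> h; rewrite /= !fctE opprD addrA; near: h; exact: H.
Unshelve. all: by end_near. Qed.

(** Differentials of maps that are not given by formulas (the local inverse, the frame of a flat
    connection) are obtained from such an estimate; uniqueness of the differential then yields all
    directional derivatives at once. *)
Lemma diff_intro f p (L : {linear V -> W}) : continuous L ->
  (forall e, 0 < e -> \forall h \near 0, `|f (h + p) - f p - L h| <= e * `|h|) ->
  differentiable f p /\ (forall v, 'D_v f p = L v).
Proof.
move=> cL H; have E := diff_epsP cL H; have E' := diff_unique cL E.
have df : differentiable f p.
  apply/diff_locallyP; rewrite E'; split; first by [].
  exact: E.
by split => // v; rewrite deriveE// E'.
Qed.

Lemma diff_eps f p e : differentiable f p -> 0 < e ->
  \forall h \near 0, `|f (h + p) - f p - 'd f p h| <= e * `|h|.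
Proof.
move=> /diff_locallyP[cL E] e0; move/eqaddoP: E => /(_ e e0).
by apply: filterS => h; rewrite /= !fctE opprD addrA.
Qed.

Lemma near_eq_differentiable f g p : (\near p, f p = g p) ->
  differentiable f p -> differentiable g p.
Proof.
move=> fg df; have fgp : f p = g p by exact: nbhs_singleton fg.
have [] // := @diff_intro g p ('d f p) _ _; first exact: diff_continuous.
move=> e e0; have H1 := diff_eps df e0.
have H2 : \forall h \near 0, f (h + p) = g (h + p).
  by move: fg; rewrite (near_shift 0) /= subr0.
by apply: filterS2 H1 H2 => h leh eqh; rewrite -eqh -fgp.
Qed.

End DiffIntro.

Section DiffMx.
Variables (R : realType) (V : normedModType R).

Lemma differentiable_mx m n (f : V -> 'M[R]_(m, n)) p :
  (forall i j, differentiable (fun q => f q i j) p) -> differentiable f p.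
Proof.
move=> df; rewrite (_ : f =
    \sum_(i < m) \sum_(j < n) (fun q => f q i j *: delta_mx i j)); last first.
  apply/funext => q; rewrite fct_sumE {1}[f q]matrix_sum_delta.
  by apply: eq_bigr => i _; rewrite fct_sumE.
apply: differentiable_sum => i; apply: differentiable_sum => j.
exact: differentiableZl.
Qed.

Lemma differentiable_entry m n (f : V -> 'M[R]_(m, n)) p i j :
  differentiable f p -> differentiable (fun q => f q i j) p.
Proof.
move=> df; apply: (@differentiable_comp _ _ _ _ f (fun M : 'M[R]_(m, n) => M i j)) => //.
exact: differentiable_coord.
Qed.

Lemma derive_entry m n (f : V -> 'M[R]_(m, n)) p v i j : differentiable f p ->
  'D_v f p i j = 'D_v (fun q => f q i j) p.
Proof. by move=> df; rewrite derive_mx ?mxE//; exact: diff_derivable. Qed.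

End DiffMx.

Section CkTheory.
Variables (R : realType).
Implicit Types (V W X : normedModType R).

Lemma CkW V W k U (f : V -> W) : Ck k.+1 U f -> Ck k U f.
Proof.
elim: k f => [|k IH] f [df Df]; first by move=> p Up; apply: differentiable_continuous; exact: df.
by split => // v; apply: IH; exact: Df.
Qed.

Lemma Ck_sub V W k (U U' : set V) (f : V -> W) : U' `<=` U -> Ck k U f -> Ck k U' f.
Proof.
move=> sU; elim: k f => [|k IH] f /=; first by move=> cf p /sU; exact: cf.
by move=> [df Df]; split => [p /sU|v]; [exact: df|apply: IH; exact: Df].
Qed.

(** A derivative at a point depends on the germ only, so openness of [U] carries equality on [U]
    through every order. Most closure lemmas below compute derivatives on [U] alone and conclude
    with this. *)
Lemma Ck_ext V W k U (f g : V -> W) : open U -> (forall p, U p -> f p = g p) ->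
  Ck k U f -> Ck k U g.
Proof.
move=> oU; elim: k f g => [|k IH] f g fg /=.
  move=> cf p Up; have : f @ p --> f p := cf p Up.
  rewrite (fg p Up); apply: cvg_trans; apply: near_eq_cvg.
  exact: (@near_open _ _ U).
move=> [df Df]; split => [p Up|v].
  by apply: near_eq_differentiable (df p Up); exact: (@near_open _ _ U).
apply: IH (Df v) => p Up; apply: near_eq_derive; exact: (@near_open _ _ U).
Qed.

Lemma Ck_cst V W k U (c : W) : Ck k U (fun _ : V => c).
Proof.
elim: k c => [|k IH] c; first by move=> p _; exact: cst_continuous.
split => [p _|v]; first exact: differentiable_cst.
have -> : (fun p : V => 'D_v (fun=> c) p) = (fun=> 0); last exact: IH.
by apply/funext => p; exact: derive_cst.
Qed.

Lemma Ck_add V W k U (f g : V -> W) : open U ->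
  Ck k U f -> Ck k U g -> Ck k U (fun p => f p + g p).
Proof.
move=> oU; elim: k f g => [|k IH] f g /=.
  by move=> cf cg p Up; apply: continuousD; [exact: cf|exact: cg].
move=> [df Df] [dg Dg]; split => [p Up|v].
  by apply: differentiableD; [exact: df|exact: dg].
apply: (Ck_ext oU _ (IH _ _ (Df v) (Dg v))) => p Up /=.
by rewrite (_ : (fun p => f p + g p) = f + g)// deriveD//; apply: diff_derivable; auto.
Qed.

Lemma Ck_id V k U : open U -> Ck k U (fun p : V => p).
Proof.
move=> oU; case: k => [|k] /=; first by move=> p _; exact: cvg_id.
split => [p _|v]; first exact: ex_diff.
by apply: (Ck_ext oU _ (Ck_cst k U v)) => p _; rewrite derive_id.
Qed.

Lemma Ck_scale V W k U (f : V -> R) (w : W) : open U ->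
  Ck k U f -> Ck k U (fun p => f p *: w).
Proof.
move=> oU; elim: k f => [|k IH] f /=.
  by move=> cf p Up; apply: cvgZ; [exact: cf|exact: cvg_cst].
move=> [df Df]; split => [p Up|v]; first by apply: differentiableZl; exact: df.
apply: (Ck_ext oU _ (IH _ (Df v))) => p Up /=.
have dfw := differentiableZl w (df p Up).
by rewrite !deriveE ?diffZl//; exact: df.
Qed.

(** The product rule brings back the undifferentiated factors, which the induction hypothesis
    accepts at level [k] thanks to [CkW]. *)
Lemma Ck_mul V k U (f g : V -> R) : open U ->
  Ck k U f -> Ck k U g -> Ck k U (fun p => f p * g p).
Proof.
move=> oU; elim: k f g => [|k IH] f g.
  by move=> cf cg p Up; apply: continuousM; [exact: cf|exact: cg].
move=> Cf Cg; have [df Df] := Cf; have [dg Dg] := Cg; split => [p Up|v].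
  by apply: differentiableM; [exact: df|exact: dg].
have := Ck_add oU (IH _ _ (CkW Cf) (Dg v)) (IH _ _ (CkW Cg) (Df v)).
apply: Ck_ext => // p Up /=.
by rewrite (_ : (fun p => f p * g p) = f * g)// deriveM//; apply: diff_derivable; auto.
Qed.

Lemma Ck_opp V W k U (f : V -> W) : open U -> Ck k U f -> Ck k U (fun p => - f p).
Proof.
move=> oU; elim: k f => [|k IH] f /=.
  by move=> cf p Up; apply: continuousN; exact: cf.
move=> [df Df]; split => [p Up|v]; first by apply: differentiableN; exact: df.
apply: (Ck_ext oU _ (IH _ (Df v))) => p Up /=.
by rewrite (_ : (fun p => - f p) = - f)// deriveN//; apply: diff_derivable; auto.
Qed.

Lemma Ck_inv V k U (f : V -> R) : open U -> (forall p, U p -> f p != 0) ->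
  Ck k U f -> Ck k U (fun p => (f p)^-1).
Proof.
move=> oU f0; elim: k => [|k IH].
  by move=> cf p Up; apply: continuousV; [exact: f0|exact: cf].
move=> Cf; have [df Df] := Cf; have Ci := IH (CkW Cf); split => [p Up|v].
  by apply: differentiableV; [exact: df|exact: f0].
have := Ck_opp oU (Ck_mul oU (Ck_mul oU Ci Ci) (Df v)).
apply: Ck_ext => // p Up /=.
rewrite deriveV ?f0//; last by apply: diff_derivable; exact: df.
by rewrite scaleNr -mulNr -exprVn expr2 mulNr.
Qed.

Lemma Ck_sum V W k U n (f : 'I_n -> V -> W) : open U ->
  (forall i, Ck k U (f i)) -> Ck k U (fun p => \sum_i f i p).
Proof.
move=> oU Cf.
suff H (s : seq 'I_n) : Ck k U (fun p => \sum_(i <- s) f i p) by exact: H.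
elim: s => [|i s IH].
  by apply: (Ck_ext oU _ (Ck_cst k U 0)) => p _; rewrite big_nil.
by apply: (Ck_ext oU _ (Ck_add oU (Cf i) IH)) => p _; rewrite big_cons.
Qed.

Lemma Ck_prod V k U (T : finType) (P : pred T) (f : T -> V -> R) : open U ->
  (forall i, Ck k U (f i)) -> Ck k U (fun p => \prod_(i | P i) f i p).
Proof.
move=> oU Cf.
suff H (s : seq T) : Ck k U (fun p => \prod_(i <- s | P i) f i p) by exact: H.
elim: s => [|i s IH].
  by apply: (Ck_ext oU _ (@Ck_cst V R k U 1)) => p _; rewrite big_nil.
case Pi : (P i).
  by apply: (Ck_ext oU _ (Ck_mul oU (Cf i) IH)) => p _; rewrite big_cons Pi.
by apply: (Ck_ext oU _ IH) => p _; rewrite big_cons Pi.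
Qed.

Lemma Ck_mx V k U m n (f : V -> 'M[R]_(m, n)) : open U ->
  (forall i j, Ck k U (fun q => f q i j)) -> Ck k U f.
Proof.
move=> oU Cf.
have H := Ck_sum oU (fun i => Ck_sum oU (fun j => Ck_scale (delta_mx i j : 'M[R]_(m, n)) oU (Cf i j))).
by apply: (Ck_ext oU _ H) => p _; rewrite -matrix_sum_delta.
Qed.

Lemma coord_mx_continuous m n i j : continuous (fun M : 'M[R]_(m, n) => M i j : R).
Proof. by move=> M; apply: differentiable_continuous; exact: differentiable_coord. Qed.

Lemma Ck_entry V k U m n (f : V -> 'M[R]_(m, n)) i j : open U ->
  Ck k U f -> Ck k U (fun q => f q i j).
Proof.
move=> oU; elim: k f => [|k IH] f /=.
  move=> cf p Up; apply: (@continuous_comp _ _ _ f (fun M : 'M[R]_(m, n) => M i j)).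
    exact: cf.
  exact: coord_mx_continuous.
move=> [df Df]; split => [p Up|v]; first by apply: differentiable_entry; exact: df.
by apply: (Ck_ext oU _ (IH _ (Df v))) => p Up; rewrite derive_entry//; exact: df.
Qed.

Lemma Ck_comp_real V k U (A : set R) (f : V -> R) (g : R -> R) : open U ->
  (forall p, U p -> A (f p)) -> Ck k U f -> Ck k A g -> Ck k U (g \o f).
Proof.
move=> oU UA; elim: k g => [|k IH] g.
  by move=> cf cg p Up; apply: continuous_comp; [exact: cf|apply: cg; exact: UA].
move=> Cf [dg Dg]; have [df Df] := Cf; split => [p Up|v].
  by apply: differentiable_comp; [exact: df|apply: dg; exact: UA].
apply: (Ck_ext oU _ (Ck_mul oU (Df v) (IH _ (CkW Cf) (Dg 1)))) => p Up /=.
rewrite [RHS]derive_comp; [|exact: df|by apply: dg; exact: UA].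
by rewrite -['D_v f p]mulr1 derive_dirZ ?mulr1//; apply: dg; exact: UA.
Qed.

(** [Ck] only speaks of derivatives in constant directions, whereas the chain rule differentiates
    [g] in the moving direction ['D_v f]. Expanding that direction in the standard basis leaves
    constant directions with variable coefficients. *)
Lemma derive_comp_rV V m (f : V -> 'rV[R]_m) (g : 'rV[R]_m -> R) p v :
  differentiable f p -> differentiable g (f p) ->
  'D_v (g \o f) p = \sum_i 'D_v (fun q => f q 0 i) p * 'D_(delta_mx 0 i) g (f p).
Proof.
move=> df dg; rewrite derive_comp// [X in 'D_X g _]row_sum_delta derive_dir_sum//.
by apply: eq_bigr => i _; rewrite derive_dirZ// derive_entry.
Qed.

Lemma Ck_comp_rV V k m U (A : set 'rV[R]_m) (f : V -> 'rV[R]_m) (g : 'rV[R]_m -> R) :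
  open U -> (forall p, U p -> A (f p)) -> Ck k U f -> Ck k A g -> Ck k U (g \o f).
Proof.
move=> oU UA; elim: k g => [|k IH] g.
  by move=> cf cg p Up; apply: continuous_comp; [exact: cf|apply: cg; exact: UA].
move=> Cf [dg Dg]; have [df Df] := Cf; split => [p Up|v].
  by apply: differentiable_comp; [exact: df|apply: dg; exact: UA].
have := Ck_sum oU (fun i => Ck_mul oU (Ck_entry 0 i oU (Df v)) (IH _ (CkW Cf) (Dg (delta_mx 0 i)))).
apply: Ck_ext => // p Up /=.
rewrite [RHS]derive_comp_rV; [|exact: df|by apply: dg; exact: UA].
by apply: eq_bigr => i _; rewrite derive_entry//; exact: df.
Qed.

Lemma Ck_mulmx V k U m n l (f : V -> 'M[R]_(m, n)) (g : V -> 'M[R]_(n, l)) : open U ->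
  Ck k U f -> Ck k U g -> Ck k U (fun p => f p *m g p).
Proof.
move=> oU Cf Cg; apply: Ck_mx => // i j.
have := Ck_sum oU (fun s => Ck_mul oU (Ck_entry i s oU Cf) (Ck_entry s j oU Cg)).
by apply: Ck_ext => // p Up; rewrite mxE.
Qed.

Lemma Ck_det V k U n (f : V -> 'M[R]_n) : open U -> Ck k U f ->
  Ck k U (fun p => \det (f p)).
Proof.
move=> oU Cf; rewrite /determinant.
pose F (s : 'S_n) p := (-1) ^+ s * \prod_i f p i (s i).
have CF s : Ck k U (F s).
  apply: Ck_mul => //; first exact: Ck_cst.
  by apply: Ck_prod => // i; exact: Ck_entry.
apply: (Ck_ext oU _ (Ck_sum oU (fun i => CF (enum_val (i : 'I_#|'S_n|))))) => p _.
by rewrite (reindex (@enum_val _ 'S_n))//=; exact: onW_bij (enum_val_bij _).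
Qed.

(** By Cramer's formula the entries of the inverse are cofactors divided by the determinant. *)
Lemma Ck_invmx V k U n (f : V -> 'M[R]_n) : open U ->
  (forall p, U p -> f p \in unitmx) -> Ck k U f -> Ck k U (fun p => invmx (f p)).
Proof.
move=> oU fu Cf; apply: Ck_mx => // i j.
have Cc : Ck k U (fun p => cofactor (f p) j i).
  apply: Ck_mul => //; first exact: Ck_cst.
  apply: Ck_det => //; apply: Ck_mx => // i' j'.
  by apply: (Ck_ext oU _ (Ck_entry (lift j i') (lift i j') oU Cf)) => p _; rewrite !mxE.
have Ci : Ck k U (fun p => (\det (f p))^-1).
  by apply: Ck_inv => // [p /fu|]; [rewrite unitmxE unitfE|exact: Ck_det].
apply: (Ck_ext oU _ (Ck_mul oU Ci Cc)) => p Up.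
by rewrite /invmx fu// !mxE.
Qed.

(** Each function is the derivative of the other up to sign, so the induction has to carry both. *)
Lemma Ck_sin_cos k : Ck k setT (@sin R) /\ Ck k setT (@cos R).
Proof.
have ds x : differentiable (@sin R) x by apply/derivable1_diffP; exact: derivable_sin.
have dc x : differentiable (@cos R) x by apply/derivable1_diffP; exact: derivable_cos.
elim: k => [|k [IHs IHc]]; first by split => p _; apply: differentiable_continuous.
have oT : open [set: R] by exact: openT.
split; split => // v.
  apply: (Ck_ext oT _ (Ck_scale v oT IHc)) => p _.
  rewrite -[v in 'D_v _ _]mulr1 derive_dirZ// derive_val.
  by rewrite [LHS]mulrC.
apply: (Ck_ext oT _ (Ck_scale (- v) oT IHs)) => p _.
rewrite -[v in 'D_v _ _]mulr1 derive_dirZ// derive_val.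
by rewrite -[RHS]/(v * - sin p) -[LHS]/(sin p * - v); ring.
Qed.

Lemma Ck_ln k : Ck k [set x : R | 0 < x] (@ln R).
Proof.
have oA : open [set x : R | 0 < x] by exact: open_gt.
have dl (x : R) : 0 < x -> differentiable (@ln R) x.
  by move=> x0; apply/derivable1_diffP; have [] := is_derive1_ln x0.
case: k => [|k]; first by move=> p /= p0; apply: differentiable_continuous; exact: dl.
split => // v.
have Ci : Ck k [set x : R | 0 < x] (fun x : R => x^-1).
  by apply: Ck_inv => // [p /= /gt_eqF -> //|]; exact: Ck_id.
apply: (Ck_ext oA _ (Ck_scale v oA Ci)) => p p0.
rewrite -[v in 'D_v _ _]mulr1 derive_dirZ; last exact: dl.
by have [_ ->] := is_derive1_ln p0; rewrite [LHS]mulrC.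
Qed.

End CkTheory.

(** * The mean value theorem along a segment *)

Section Segment.
Variables (R : realType) (V W : normedModType R).

Lemma differentiable_line (p v : V) (t : R) : differentiable (fun s : R => p + s *: v) t.
Proof.
apply: (@differentiableD _ _ _ (cst p) (fun s : R => s *: v)) => //.
Qed.

Lemma derive_line (p v : V) (t : R) : 'D_1 (fun s : R => p + s *: v) t = v.
Proof.
have dz : differentiable (fun s : R => s *: v) t by apply: differentiableZl; exact: ex_diff.
rewrite (@deriveD _ _ _ (cst p) (fun s : R => s *: v)); [|exact: diff_derivable|exact: diff_derivable].
rewrite derive_cst add0r deriveE// diffZl; last exact: ex_diff.
by rewrite diff_val scale1r.
Qed.

Lemma is_derive_line (f : V -> W) (p v : V) (t : R) : differentiable f (p + t *: v) ->
  is_derive t (1 : R) (fun s : R => f (p + s *: v)) ('D_v f (p + t *: v)).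
Proof.
move=> df; have dl := differentiable_line p v t; split.
  by apply: diff_derivable; exact: (@differentiable_comp _ _ _ _ (fun s : R => p + s *: v) f).
by rewrite (@derive_comp _ _ _ _ (fun s : R => p + s *: v) f)// derive_line.
Qed.

End Segment.

Section MVTLine.
Variables (R : realType) (V : normedModType R).

Lemma mvt_line (f : V -> R) (p v : V) :
  (forall t : R, 0 <= t <= 1 -> differentiable f (p + t *: v)) ->
  exists2 t : R, 0 <= t <= 1 & f (p + v) - f p = 'D_v f (p + t *: v).
Proof.
move=> df.
have [|||t] := @MVT_segment R (fun s => f (p + s *: v)) (fun s => 'D_v f (p + s *: v)) 0 1.
- exact: ler01.
- by move=> x x01; apply: is_derive_line; apply: df; rewrite !ltW ?(itvP x01).
- apply: derivable_within_continuous => x x01.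
  by have [] := is_derive_line (df x _) => //; rewrite !(itvP x01).
by rewrite in_itv /= scale1r scale0r addr0 subr0 mulr1; exists t.
Qed.

Lemma open_ball_sub (U : set V) (p : V) : open U -> U p ->
  exists2 r : R, 0 < r & ball p r `<=` U.
Proof. by move=> oU Up; have /nbhs_ballP[r r0 rU] := open_nbhs_nbhs (conj oU Up); exists r. Qed.

End MVTLine.

Lemma dist_halves (R : realType) (x y z e : R) :
  `|x - z| < e / 2 -> `|y - z| < e / 2 -> `|x - y| <= e.
Proof.
move=> xz yz; have -> : x - y = x - z - (y - z) by rewrite opprB addrA subrK.
by rewrite (le_trans (ler_normB _ _))// [e]splitr lerD// ltW.
Qed.

Lemma mulf_cancel (R : realType) (s x y : R) : s != 0 -> s * x = s * y -> x = y.
Proof. by move=> s0; apply: mulfI. Qed.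

Lemma subr_swap (R : zmodType) (x y z w : R) : x - y - (z - w) = x - z - (y - w).
Proof. by rewrite !opprB !addrA addrAC [RHS]addrAC; congr (_ + _); exact: addrAC. Qed.

(** * Symmetry of second derivatives *)

Section Schwarz.
Variables (R : realType) (V : normedModType R).

(** The mean value theorem is applied twice: to the increment of [f] by [v] along [u], then to
    ['D_u f] along [v]. The difference on the left is symmetric in [u] and [v], which is the source
    of Schwarz's theorem. *)
Lemma second_difference (U : set V) (f : V -> R) (p u v : V) (r : R) :
  ball p r `<=` U -> Ck 2 U f -> `|u| + `|v| < r ->
  exists2 c, ball p r c &
    f (p + u + v) - f (p + u) - (f (p + v) - f p) = 'D_v ('D_u f) c.
Proof.
move=> rU [df Df] uvr.
have inb s t : 0 <= s <= 1 -> 0 <= t <= 1 -> ball p r (p + s *: u + t *: v).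
  move=> s01 t01; rewrite -ball_normE /= -addrA opprD addNKr normrN.
  apply: le_lt_trans uvr; rewrite (le_trans (ler_normD _ _))// !normrZ.
  move: s01 t01 => /andP[s0 s1] /andP[t0 t1].
  by rewrite lerD// ger0_norm// ler_piMl.
pose g := (f \o shift v) - f.
have dfs s : 0 <= s <= 1 -> differentiable f (p + s *: u + v).
  by move=> s01; apply/df/rU; rewrite -[v]scale1r; apply: inb => //; rewrite ler01 lexx.
have dfs0 s : 0 <= s <= 1 -> differentiable f (p + s *: u).
  by move=> s01; apply/df/rU; rewrite -[p + _]addr0 -(scale0r v); apply: inb => //; rewrite ler01 lexx.
have dsh q : differentiable (shift v : V -> V) q.
  by apply: (@differentiableD _ _ _ id (cst v)); [exact: ex_diff|].
have Dsh q w : 'D_w (shift v : V -> V) q = w.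
  rewrite (@deriveD _ _ _ id (cst v)); [|exact: derivable_id|exact: derivable_cst].
  by rewrite derive_id derive_cst addr0.
have [t t01] : exists2 t : R, 0 <= t <= 1 & g (p + u) - g p = 'D_u g (p + t *: u).
  apply: mvt_line => t t01; apply: differentiableB; last exact: dfs0.
  by apply: differentiable_comp => //; exact: dfs.
rewrite deriveB; [|apply: diff_derivable|by apply: diff_derivable; exact: dfs0]; last first.
  by apply: differentiable_comp => //; exact: dfs.
rewrite derive_comp//; last exact: dfs.
rewrite Dsh /= => E.
have [s s01 E2] : exists2 s : R, 0 <= s <= 1 & 'D_u f (p + t *: u + v) - 'D_u f (p + t *: u) = 'D_v ('D_u f) (p + t *: u + s *: v).
  apply: (@mvt_line R V ('D_u f) (p + t *: u) v) => s s01; have [d2 _] := Df u.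
  by apply/d2/rU; exact: inb.
exists (p + t *: u + s *: v); first exact: inb.
by rewrite -E2 -E /g !fctE.
Qed.

Lemma schwarz (U : set V) (f : V -> R) (p u v : V) : open U -> Ck 2 U f -> U p ->
  'D_v ('D_u f) p = 'D_u ('D_v f) p.
Proof.
move=> oU Cf Up; have [df Df] := Cf.
have c2 (x y : V) : {for p, continuous ('D_x ('D_y f))}.
  by have [_ D2] := Df y; apply: D2.
apply/eqP; rewrite -subr_eq0 -normr_le0; apply/ler_addgt0Pl => e e0; rewrite addr0.
have e20 : 0 < e / 2 by rewrite divr_gt0.
have /cvgrPdist_lt/(_ _ e20)/nbhs_ballP[r1 r10 B1] := c2 v u.
have /cvgrPdist_lt/(_ _ e20)/nbhs_ballP[r2 r20 B2] := c2 u v.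
have [r3 r30 B3] := open_ball_sub oU Up.
pose r := Num.min r1 (Num.min r2 r3).
have r0 : 0 < r by rewrite !lt_min r10 r20.
have rr1 : r <= r1 by rewrite !ge_min lexx.
have rr2 : r <= r2 by rewrite !ge_min lexx orbT.
have rr3 : r <= r3 by rewrite !ge_min lexx !orbT.
have rU : ball p r `<=` U by apply: subset_trans B3; exact: le_ball.
have n0 : 0 < `|u| + `|v| + 1 by rewrite ltr_wpDl// addr_ge0.
(* The scale [s] shrinks [u] and [v] into the ball; the summand 1 keeps the divisor positive when
   both vanish. *)
have [s s0 rE] : exists2 s, 0 < s & r = s * (2 * (`|u| + `|v| + 1)).
  exists (r / (2 * (`|u| + `|v| + 1))); first by rewrite divr_gt0// mulr_gt0.
  by rewrite divfK// gt_eqF// mulr_gt0.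
have sn (x y : V) : `|x| + `|y| = `|u| + `|v| -> `|s *: x| + `|s *: y| < r.
  move=> xy; rewrite 2!normrZ ger0_norm ?ltW// -mulrDr xy rE.
  by rewrite ltr_pM2l//; have : 0 <= `|u| + `|v| by [rewrite addr_ge0]; move=> ?; lra.
have [c cr E1] := second_difference rU Cf (sn u v erefl).
have [c' cr' E2] := second_difference rU Cf (sn v u (addrC _ _)).
have [dfu _] := Df u; have [dfv _] := Df v.
have scl (x y q : V) : U q -> 'D_(s *: x) ('D_(s *: y) f) q = s ^+ 2 * 'D_x ('D_y f) q.
  move=> Uq; have [dy _] := Df y.
  have E : 'D_(s *: y) f q = s *: 'D_y f q by rewrite derive_dirZ//; exact: df.
  rewrite (@near_eq_derive _ _ _ _ (s *: 'D_y f)).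
    rewrite deriveZ; last by apply: diff_derivable; exact: dy.
    rewrite derive_dirZ; last exact: dy.
    by rewrite !scalerA -expr2.
  by apply: (@near_open _ _ U) => // q' Uq'; rewrite derive_dirZ//; exact: df.
rewrite scl in E1; last exact: rU.
rewrite scl in E2; last exact: rU.
have E0 : f (p + s *: u + s *: v) - f (p + s *: u) - (f (p + s *: v) - f p) =
    f (p + s *: v + s *: u) - f (p + s *: v) - (f (p + s *: u) - f p).
  by rewrite [p + s *: v + _]addrAC subr_swap.
(* After division by s^2 the two mixed derivatives agree at two possibly different points of the
   small ball; continuity puts each within e / 2 of its value at [p]. *)
have E := mulf_cancel (lt0r_neq0 (exprn_gt0 2 s0)) (etrans (esym E1) (etrans E0 E2)).
have := B1 c (le_ball rr1 cr); rewrite /= E => H1.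
exact: dist_halves H1 (B2 c' (le_ball rr2 cr')).
Qed.

End Schwarz.

Section Norms.
Variable R : realType.

Lemma ler_entry_norm m n (A : 'M[R]_(m, n)) i j : `|A i j| <= `|A|.
Proof.
rewrite [leRHS]/Num.Def.normr/= mx_normrE.
exact: (le_bigmax _ (fun ij : 'I_m * 'I_n => `|A ij.1 ij.2|) (i, j)).
Qed.

Lemma norm_le_entry m n (A : 'M[R]_(m, n)) (b : R) : 0 <= b ->
  (forall i j, `|A i j| <= b) -> `|A| <= b.
Proof.
by move=> b0 Ab; rewrite [leLHS]/Num.Def.normr/= mx_normrE bigmax_le// => -[i j] _; exact: Ab.
Qed.

Lemma norm_mulmx m n l (A : 'M[R]_(m, n)) (B : 'M[R]_(n, l)) :
  `|A *m B| <= n%:R * `|A| * `|B|.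
Proof.
apply: norm_le_entry => [|i j]; first by rewrite !mulr_ge0.
rewrite mxE (le_trans (ler_norm_sum _ _ _))//.
apply: (@le_trans _ _ (\sum_(k < n) `|A| * `|B|)).
  by apply: ler_sum => k _; rewrite normrM ler_pM// ler_entry_norm.
by rewrite sumr_const card_ord -[leLHS]mulr_natl mulrA.
Qed.

(** Local estimates for the entries of a matrix or the partial derivatives of a map come with
    separate radii and constants. As the property survives a smaller radius and a larger constant,
    the minimum of the radii and the maximum of the constants serve all indices. *)
Lemma common_bounds (I : finType) (P : I -> R -> R -> Prop) :
  (forall i r r' K K', P i r K -> 0 < r' <= r -> K <= K' -> P i r' K') ->
  (forall i, exists r K, [/\ 0 < r, 0 <= K & P i r K]) ->
  exists r K, [/\ 0 < r, 0 <= K & forall i, P i r K].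
Proof.
move=> mono H.
suff [r [K [r0 K0 HrK]]] : exists r K, [/\ 0 < r, 0 <= K & forall i, i \in enum I -> P i r K].
  by exists r, K; split => // i; apply: HrK; rewrite mem_enum.
elim: (enum I) => [|i s [r [K [r0 K0 HrK]]]]; first by exists 1, 0; split.
have [r' [K' [r'0 K'0 H']]] := H i.
exists (Num.min r r'), (Num.max K K'); split; [by rewrite lt_min r0|by rewrite le_max K0|].
move=> j; rewrite in_cons => /predU1P[->|js].
  by apply: mono H' _ _; rewrite ?lt_min ?r0 ?r'0 ?ge_min ?le_max ?lexx ?orbT.
by apply: mono (HrK j js) _ _; rewrite ?lt_min ?r0 ?r'0 ?ge_min ?le_max ?lexx ?orbT.
Qed.

End Norms.

(** * Local estimates for functions of class C^1 and C^2 *)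

Section LocalEstimates.
Variables (R : realType).

Lemma convexZ_norm (V : normedModType R) (x y : V) (r t : R) :
  `|x| < r -> `|y| < r -> 0 <= t <= 1 -> `|(1 - t) *: x + t *: y| < r.
Proof.
move=> xr yr /andP[t0 t1].
rewrite (le_lt_trans (ler_normD _ _))// 2!normrZ !ger0_norm ?subr_ge0//.
move: t0; rewrite le_eqVlt => /predU1P[<-|t0]; first by rewrite subr0 mul1r mul0r addr0.
apply: (@lt_le_trans _ _ ((1 - t) * r + t * r)); last by rewrite -mulrDl subrK mul1r.
by rewrite ler_ltD ?ltr_pM2l// ler_wpM2l ?subr_ge0// ltW.
Qed.

Lemma ball_convex (V : normedModType R) (p x y : V) (r t : R) :
  ball p r x -> ball p r y -> 0 <= t <= 1 -> ball p r (x + t *: (y - x)).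
Proof.
rewrite -ball_normE /= => xr yr t01.
have -> : p - (x + t *: (y - x)) = (1 - t) *: (p - x) + t *: (p - y).
  rewrite scalerBl scale1r opprD addrA -[RHS]addrA; congr (_ + _).
  by rewrite addrC -scalerBr -scalerN !opprB [in RHS]addrC subrKA.
exact: convexZ_norm.
Qed.

(** Strict differentiability: both endpoints move while the derivative stays at [p]. It follows from
    the mean value theorem and the continuity of the partial derivatives at [p], and it is what
    makes the map in the inverse function theorem contracting. *)
Lemma strict_derivative m (U : set 'rV[R]_m) (f : 'rV[R]_m -> R) p (e : R) :
  open U -> Ck 1 U f -> U p -> 0 < e ->
  exists2 r : R, 0 < r & ball p r `<=` U /\ forall x y, ball p r x -> ball p r y ->
    `|f y - f x - 'D_(y - x) f p| <= e * `|y - x|.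
Proof.
move=> oU [df Df] Up e0.
(* One share for each of the [m] coordinates; the successor avoids a division by zero when [m] is
   0. *)
pose e' := e / m.+1%:R; have e'0 : 0 < e' by rewrite divr_gt0.
have [r1 r10 B1] := open_ball_sub oU Up.
have : \forall q \near p, forall i : 'I_m, `|'D_(delta_mx 0 i) f p - 'D_(delta_mx 0 i) f q| < e'.
  apply: (@filter_forall _ _ (fun (i : 'I_m) q =>
    `|'D_(delta_mx 0 i) f p - 'D_(delta_mx 0 i) f q| < e') (nbhs p)) => i.
  by have /cvgrPdist_lt := Df (delta_mx 0 i) p Up; apply.
move=> /nbhs_ballP[r2 r20 B2].
exists (Num.min r1 r2); first by rewrite lt_min r10.
have rU : ball p (Num.min r1 r2) `<=` U.
  by apply: subset_trans B1; apply: le_ball; rewrite ge_min lexx.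
split=> // x y xr yr.
have inb t := ball_convex xr yr (t:=t).
have [t t01] : exists2 t : R, 0 <= t <= 1 & f (x + (y - x)) - f x = 'D_(y - x) f (x + t *: (y - x)).
  by apply: mvt_line => t t01; apply/df/rU; exact: inb.
rewrite [x + (y - x)]addrC subrK => ->.
have cr := inb t t01; move: (x + t *: (y - x)) cr => c cr.
have dc := df c (rU _ cr); have dp := df p Up.
rewrite [X in 'D_X f c]row_sum_delta [X in 'D_X f p]row_sum_delta !derive_dir_sum//.
rewrite -sumrB (le_trans (ler_norm_sum _ _ _))//.
apply: (@le_trans _ _ (\sum_(i < m) `|y - x| * e')).
  apply: ler_sum => i _; rewrite !derive_dirZ// -mulrBr normrM ler_pM// ?ler_entry_norm//.
  rewrite distrC ltW//; apply: B2; move: cr; apply: le_ball.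
  by rewrite ge_min lexx orbT.
rewrite sumr_const card_ord -[leLHS]mulr_natl mulrCA mulrC ler_wpM2r//.
by rewrite mulrA ler_pdivrMr// mulrC ler_pM2l// ler_nat.
Qed.

Lemma derive_dir_bound m (f : 'rV[R]_m -> R) p : differentiable f p ->
  exists2 K : R, 0 <= K & forall v, `|'D_v f p| <= K * `|v|.
Proof.
move=> df; exists (\sum_(i < m) `|'D_(delta_mx 0 i) f p|); first exact: sumr_ge0.
move=> v; rewrite [X in 'D_X f p]row_sum_delta derive_dir_sum// (le_trans (ler_norm_sum _ _ _))//.
rewrite mulr_suml; apply: ler_sum => i _.
by rewrite derive_dirZ// normrM mulrC ler_wpM2l// ler_entry_norm.
Qed.

Lemma local_lipschitz m (U : set 'rV[R]_m) (f : 'rV[R]_m -> R) p :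
  open U -> Ck 1 U f -> U p ->
  exists r K : R, [/\ 0 < r, 0 <= K & ball p r `<=` U /\
    forall x y, ball p r x -> ball p r y -> `|f y - f x| <= K * `|y - x|].
Proof.
move=> oU Cf Up; have [df _] := Cf.
have [r r0 [rU H]] := strict_derivative oU Cf Up ltr01.
have [K K0 HK] := derive_dir_bound (df p Up).
exists r, (1 + K); split; [by []|by rewrite addr_ge0|split => // x y xr yr].
rewrite -(subrK ('D_(y - x) f p) (f y - f x)) (le_trans (ler_normD _ _))//.
by rewrite mulrDl lerD// H.
Qed.

(** Here the derivative is taken at the moving point [x], and the quadratic error comes from the
    Lipschitz continuity of the partial derivatives. The three bounds share one constant because the
    comparison of neighbouring rays uses them together. *)
Lemma local_taylor m (U : set 'rV[R]_m) (f : 'rV[R]_m -> R) p :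
  open U -> Ck 2 U f -> U p ->
  exists r K : R, [/\ 0 < r, 0 <= K & ball p r `<=` U /\
    forall x y, ball p r x -> ball p r y ->
      [/\ `|f x| <= K, `|f y - f x| <= K * `|y - x| &
        `|f y - f x - 'D_(y - x) f x| <= K * `|y - x| ^+ 2]].
Proof.
move=> oU Cf Up; have [df Df] := Cf.
have [r1 [K1 [r10 K10 [rU1 L1]]]] := local_lipschitz oU (CkW Cf) Up.
have [|i|r2 [K2 [r20 K20 L2]]] := @common_bounds R 'I_m (fun i r K => ball p r `<=` U /\
    forall x y, ball p r x -> ball p r y ->
    `|'D_(delta_mx 0 i) f y - 'D_(delta_mx 0 i) f x| <= K * `|y - x|).
- move=> i r r' K K' [rU H] /andP[r'0 r'r] KK'; split=> [|x y xr yr].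
    by apply: subset_trans rU; exact: le_ball.
  rewrite (le_trans (H _ _ (le_ball r'r xr) (le_ball r'r yr)))//.
  by rewrite ler_wpM2r.
- exact: local_lipschitz oU (Df (delta_mx 0 i)) Up.
pose r := Num.min r1 r2.
have r0 : 0 < r by rewrite lt_min r10.
have rr1 : r <= r1 by rewrite ge_min lexx.
have rr2 : r <= r2 by rewrite ge_min lexx orbT.
(* The first term bounds |f x| through the Lipschitz estimate from [p]; in the last one [m%:R]
   counts the coordinates in the remainder. *)
pose K := Num.max (`|f p| + K1 * r1) (Num.max K1 (m%:R * K2)).
have KK1 : K1 <= K by rewrite !le_max lexx !orbT.
have K0 : 0 <= K by rewrite (le_trans K10).
have rU : ball p r `<=` U by apply: subset_trans rU1; exact: le_ball.
exists r, K; split=> //; split=> // x y xr yr.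
have xr1 := le_ball rr1 xr; have yr1 := le_ball rr1 yr.
split; last 2 first.
- by rewrite (le_trans (L1 _ _ xr1 yr1))// ler_wpM2r.
- have inb t := ball_convex xr yr (t:=t).
  have [t t01] : exists2 t : R, 0 <= t <= 1 & f (x + (y - x)) - f x = 'D_(y - x) f (x + t *: (y - x)).
    by apply: mvt_line => t t01; apply/df/rU; exact: inb.
  rewrite [x + (y - x)]addrC subrK => ->.
  have cr := inb t t01; have cE : `|x + t *: (y - x) - x| <= `|y - x|.
    rewrite [x + _]addrC addrK normrZ; move: t01 => /andP[t0 t1].
    by rewrite ger0_norm// ler_piMl.
  move: (x + t *: (y - x)) cr cE => c cr cE.
  have dc := df c (rU _ cr); have dx := df x (rU _ xr).
  rewrite [X in 'D_X f c]row_sum_delta [X in 'D_X f x]row_sum_delta !derive_dir_sum//.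
  rewrite -sumrB (le_trans (ler_norm_sum _ _ _))//.
  apply: (@le_trans _ _ (\sum_(i < m) `|y - x| * (K2 * `|y - x|))).
    apply: ler_sum => i _; rewrite !derive_dirZ// -mulrBr normrM ler_pM// ?ler_entry_norm//.
    have [_ /(_ x c (le_ball rr2 xr) (le_ball rr2 cr))] := L2 i.
    by move=> /le_trans; apply; rewrite ler_wpM2l.
  rewrite sumr_const card_ord -[leLHS]mulr_natl [X in _ * X]mulrCA -expr2 mulrA.
  by rewrite ler_wpM2r ?sqr_ge0// !le_max lexx !orbT.
have pr1 : ball p r1 p by exact: ballxx.
rewrite -(subrK (f p) (f x)) (le_trans (ler_normD _ _))//.
rewrite /K le_max; apply/orP; left; rewrite addrC lerD//.
rewrite (le_trans (L1 _ _ pr1 xr1))// ler_wpM2l// distrC ltW//.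
by move: xr1; rewrite -ball_normE.
Qed.

End LocalEstimates.

(** * The inverse function theorem *)

(** Completeness of matrix spaces is what Banach's fixed point theorem and the limit of the Picard
    iterates rest on. *)
HB.instance Definition _ (R : realType) (m n : nat) :=
  Uniform_isComplete.Build 'M[R]_(m, n) (@cauchy_cvg 'M[R]_(m, n)).

Section InverseFunction.
Variables (R : realType) (n : nat).
Notation rV := 'rV[R]_n.

Lemma contraction_fixed_point (p : rV) (r : R) (Phi : rV -> rV) : 0 < r ->
  (forall x, `|x - p| <= r -> `|Phi x - p| <= r) ->
  (forall x y, `|x - p| <= r -> `|y - p| <= r -> `|Phi x - Phi y| <= 2^-1 * `|x - y|) ->
  exists2 x, `|x - p| <= r & x = Phi x.
Proof.
move=> r0 PhiB PhiC.
pose B : set rV := [set x | `|x - p| <= r].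
have BB : {homo Phi : x / B x >-> B x} by move=> x; exact: PhiB.
have h0 : (0 : R) <= 2^-1 by [].
have ctr : is_contraction (mkfun_fun BB).
  exists (NngNum h0); split => /=; first by rewrite invf_lt1// ltr1n.
  by move=> [x y] /= [Bx By]; exact: PhiC.
have clB : closed B.
  have -> : B = closed_ball_ (@Num.norm _ _) p r by apply/seteqP; split => x; rewrite /B /closed_ball_ /= distrC.
  exact: closed_closed_ball_.
have [|x Bx xE] := banach_fixed_point ctr clB; last by exists x.
by exists p; rewrite /B /= subrr normr0 ltW.
Qed.

Lemma mulmxr_continuous (M : 'M[R]_n) : continuous (mulmxr M : rV -> rV).
Proof.
have oT : open [set: rV] by exact: openT.
have H : Ck 0 setT (fun v : rV => v *m M).
  by apply: Ck_mulmx; [exact: oT|exact: Ck_id|exact: Ck_cst].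
by move=> v; exact: (H v I).
Qed.

Lemma jacobianE (F : rV -> rV) p i j : differentiable F p ->
  jacobian F p i j = 'D_(delta_mx 0 i) (fun q => F q 0 j) p.
Proof. by move=> dF; rewrite -(derive_entry _ 0 j dF) derivemxE// -rowE [RHS]mxE. Qed.

Lemma strict_jacobian (U : set rV) (F : rV -> rV) p (e : R) :
  open U -> Ck 1 U F -> U p -> 0 < e ->
  exists2 r : R, 0 < r & ball p r `<=` U /\ forall x y, ball p r x -> ball p r y ->
    `|F y - F x - (y - x) *m jacobian F p| <= e * `|y - x|.
Proof.
move=> oU CF Up e0; have [dF _] := CF.
have [i r r' K K' [rU H] /andP[r'0 r'r] _|i|r [_ [r0 _ H]]] := @common_bounds R 'I_n (fun i r K =>
  ball p r `<=` U /\ forall x y, ball p r x -> ball p r y ->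
    `|F y 0 i - F x 0 i - 'D_(y - x) (fun q => F q 0 i) p| <= e * `|y - x|).
- split=> [|x y xr yr]; first by apply: subset_trans rU; exact: le_ball.
  exact: H (le_ball r'r xr) (le_ball r'r yr).
- have [r r0 H] := strict_derivative oU (Ck_entry 0 i oU CF) Up e0.
  by exists r, 0; split.
exists (Num.min r 1); first by rewrite lt_min r0 ltr01.
have rr : Num.min r 1 <= r by rewrite ge_min lexx.
(* The inclusion of the ball in [U] is read off from some coordinate. For [n] = 0 there is none, but
   then the space is a single point. *)
case: (pselect (exists i : 'I_n, True)) => [[i0 _]|none].
  split=> [|x y xr yr].
    by have [rU _] := H i0; apply: subset_trans rU; exact: le_ball.
  apply: norm_le_entry => [|i j]; first by rewrite mulr_ge0// ltW.
  rewrite (ord1 i) -derivemxE; last exact: dF.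
  rewrite 2!mxE [(- 'D_(y - x) F p) _ _]mxE [(- F x) _ _]mxE (derive_entry _ 0 j (dF p Up)).
  have [_ Hj] := H j; exact: Hj (le_ball rr xr) (le_ball rr yr).
have z (x : rV) : x = 0 by apply/rowP => i; case: none; exists i.
by split=> [x _|x y _ _]; [rewrite (z x) -(z p)|rewrite (z (_ - _)) normr0 mulr_ge0// ltW].
Qed.

(** Newton's map with the derivative frozen at [p], x - (F x - y) A^-1, contracts by 1/2 near [p],
    and its fixed point solves F x = y. The same estimate makes [F] injective with Lipschitz
    inverse, from which the derivative of [G] and then its smoothness are deduced. *)
Theorem inverse_function (V0 : set rV) (F : rV -> rV) p : open V0 -> smooth V0 F -> V0 p ->
  (forall q, V0 q -> jacobian F q \in unitmx) ->
  exists (V : set rV) (G : rV -> rV),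
    [/\ open V, V p & V `<=` V0] /\
    [/\ open (F @` V), smooth (F @` V) G & forall q, V q -> G (F q) = q].
Proof.
move=> oV0 sF V0p uF.
have [dF _] := sF 1%N.
pose A := jacobian F p; pose Ai := invmx A.
have uA : A \in unitmx by exact: uF.
have [c c0 cE] : exists2 c, 0 < c & n%:R * `|Ai| <= c.
  by exists (n%:R * `|Ai| + 1); rewrite ?lerDl// ltr_wpDl// mulr_ge0.
have c20 : 0 < 2 * c by rewrite mulr_gt0.
have Aile (x : rV) : `|x *m Ai| <= c * `|x|.
  by rewrite (le_trans (norm_mulmx _ _))// mulrAC ler_wpM2r.
have [|r1 r10 [r1V0 H1]] := @strict_jacobian V0 F p (2 * c)^-1 oV0 (sF 1%N) V0p.
  by rewrite invr_gt0.
have half (x y : rV) : ball p r1 x -> ball p r1 y ->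
    `|(F y - F x) *m Ai - (y - x)| <= 2^-1 * `|y - x|.
  move=> xr yr; rewrite -[X in _ - X](mulmxK uA) -mulmxBl.
  rewrite (le_trans (Aile _))// (le_trans (ler_wpM2l (ltW c0) (H1 x y xr yr)))//.
  by rewrite mulrA invfM mulrCA mulfV ?gt_eqF// mulr1.
have lip (x y : rV) : ball p r1 x -> ball p r1 y -> `|y - x| <= 2 * c * `|F y - F x|.
  move=> xr yr; have E1 := half x y xr yr; have E2 := Aile (F y - F x).
  have E3 : `|y - x| <= `|(F y - F x) *m Ai| + `|(F y - F x) *m Ai - (y - x)|.
    by rewrite (le_trans _ (ler_normB _ _))// opprB addrCA subrr addr0.
  have {}E3 := le_trans E3 (lerD E2 E1).
  by rewrite -mulrA -ler_pdivrMl//; move: E3; lra.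
have [r r0 rr1] : exists2 r, 0 < r & r < r1.
  by exists (r1 / 2); [rewrite divr_gt0|rewrite ltr_pdivrMr// ltr_pMr// ltr1n].
have inr1 x : `|x - p| <= r -> ball p r1 x.
  by move=> xr; rewrite -ball_normE /= distrC (le_lt_trans xr).
have pr1 : ball p r1 p by exact: ballxx.
(* With this [d], the bound r / 2 + c d found below for |Phi x - p| is exactly [r]. *)
have [d d0 dE] : exists2 d, 0 < d & r = 2 * c * d.
  by exists (r / (2 * c)); [rewrite divr_gt0|rewrite mulrCA mulfV ?mulr1// gt_eqF].
pose W := ball (F p) d.
have oW : open W by exact: ball_open.
have WE y : W y = (`|y - F p| < d) :> Prop by rewrite /W -ball_normE /= distrC.
have surj y : W y -> exists2 x, `|x - p| < r & F x = y.
  rewrite WE => yd.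
  pose Phi x := x - (F x - y) *m Ai.
  have PhiB x x' z : x - (F x - z) *m Ai - (x' - (F x' - z) *m Ai) =
      - ((F x - F x') *m Ai - (x - x')).
    have -> : (F x - F x') *m Ai = (F x - z) *m Ai - (F x' - z) *m Ai.
      by rewrite -mulmxBl opprB addrA subrK.
    by rewrite [RHS]opprB subr_swap.
  have [x xp|x x' xp x'p|x xp xE] := @contraction_fixed_point p r Phi r0.
  - have -> : Phi x - p = - ((F x - F p) *m Ai - (x - p)) + (y - F p) *m Ai.
      have -> : (y - F p) *m Ai = (F x - F p) *m Ai - (F x - y) *m Ai.
        by rewrite -mulmxBl opprB [in RHS]addrC addrA subrK.
      by rewrite /Phi opprB addrAC addrA subrK.
    rewrite (le_trans (ler_normD _ _))// normrN.
    have E1 := half p x pr1 (inr1 x xp).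
    have E2 := Aile (y - F p).
    have E3 : c * `|y - F p| <= c * d by rewrite ler_wpM2l ?ltW.
    by move: E1 E2 E3 xp; rewrite dE; lra.
  - rewrite PhiB normrN.
    exact: half (inr1 _ x'p) (inr1 _ xp).
  have Fx : F x = y.
    apply/eqP; rewrite -subr_eq0; apply/eqP.
    rewrite -[LHS](mulmxKV uA) -/Ai.
    have -> : (F x - y) *m Ai = 0.
      by apply/eqP; rewrite -oppr_eq0 -(inj_eq (addrI x)) addr0; apply/eqP; rewrite -[LHS]/(Phi x) -xE.
    by rewrite mul0mx.
  exists x => //; rewrite (le_lt_trans (lip _ _ pr1 (inr1 x xp)))// Fx.
  by rewrite dE ltr_pM2l.
(* Cutting the ball by the preimage of [W] makes the image of [V] under [F] the ball [W] itself,
   which is open. *)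
pose V := [set x | `|x - p| < r /\ W (F x)].
have Vr1 x : V x -> ball p r1 x by case=> /ltW /inr1.
have VV0 : V `<=` V0 by move=> x /Vr1 /r1V0.
have oV : open V.
  rewrite openE => x [xr WFx]; apply: filterI.
    have : nbhs x (ball p r) by apply: open_nbhs_nbhs; split; [exact: ball_open|rewrite -ball_normE /= distrC].
    by apply: filterS => z; rewrite -ball_normE /= distrC.
  have cF : {for x, continuous F} by apply/differentiable_continuous/dF/VV0.
  by apply: cF; apply: open_nbhs_nbhs.
pose G y := xget p [set x | V x /\ F x = y].
have GW y : W y -> V (G y) /\ F (G y) = y.
  move=> Wy; have [x xr xy] := surj y Wy.
  by apply: (@xgetPex _ p [set x | V x /\ F x = y]); exists x; split => //; split => //; rewrite xy.
have FV : F @` V = W.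
  apply/seteqP; split => [_ [x [_ WFx] <-]//|y Wy].
  by have [VG FG] := GW y Wy; exists (G y).
have lipG y y' : W y -> W y' -> `|G y' - G y| <= 2 * c * `|y' - y|.
  move=> Wy Wy'; have [V1 E1] := GW y Wy; have [V2 E2] := GW y' Wy'.
  by rewrite -{2}E1 -{2}E2; apply: lip; exact: Vr1.
exists V, G; rewrite FV; split; split => //.
- by split; rewrite ?subrr ?normr0// WE subrr normr0.
- have dG y : W y -> differentiable G y /\
      (forall v, 'D_v G y = v *m invmx (jacobian F (G y))).
    move=> Wy; have [VGy FGy] := GW y Wy.
    set J := jacobian F (G y).
    have uJ : J \in unitmx by apply/uF/VV0.
    apply: (@diff_intro _ _ _ G y (mulmxr (invmx J))) => [|e e0]; first exact: mulmxr_continuous.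
    have [C C0 CE] : exists2 C, 0 < C & n%:R * `|invmx J| <= C.
      by exists (n%:R * `|invmx J| + 1); rewrite ?lerDl// ltr_wpDl// mulr_ge0.
    have [e' e'0 e'E] : exists2 e', 0 < e' & C * (e' * (2 * c)) = e.
      exists (e / C / (2 * c)); first by rewrite divr_gt0// divr_gt0.
      by rewrite divfK ?(gt_eqF c20)// mulrC divfK// gt_eqF.
    have := diff_eps (dF _ (VV0 _ VGy)) e'0.
    move=> /nbhs_ballP[s s0 Hs].
    have nW : \forall h \near (0 : rV), W (h + y).
      have : \forall z \near y, W z by exact: open_nbhs_nbhs.
      by rewrite (near_shift 0) /= subr0.
    have ns : \forall h \near (0 : rV), 2 * c * `|h| < s.
      apply/nbhs_ballP; exists (s / (2 * c)); first by rewrite /= divr_gt0.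
      move=> h; rewrite -ball_normE /= sub0r normrN ltr_pdivlMr//.
      by rewrite mulrC.
    apply: filterS2 nW ns => h Wh hs.
    have [VGh FGh] := GW _ Wh.
    have Gh := lipG _ _ Wy Wh; rewrite addrK in Gh.
    have : ball 0 s (G (h + y) - G y).
      by rewrite -ball_normE /= sub0r normrN (le_lt_trans Gh).
    move=> /Hs; rewrite subrK FGh FGy addrK -deriveE; [|exact/dF/VV0]; rewrite derivemxE; [|exact/dF/VV0].
    rewrite -/J => E1.
    have -> : G (h + y) - G y - mulmxr (invmx J) h = - ((h - (G (h + y) - G y) *m J) *m invmx J).
      by rewrite /= mulmxBl mulmxK// opprB.
    rewrite normrN (le_trans (norm_mulmx _ _))// mulrAC.
    have E2 : e' * `|G (h + y) - G y| <= e' * (2 * c * `|h|) by rewrite ler_wpM2l// ltW.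
    have {}E2 := le_trans E1 E2.
    apply: (@le_trans _ _ (C * (e' * (2 * c * `|h|)))).
      by apply: ler_pM => //; rewrite mulr_ge0.
    by rewrite -e'E !mulrA.
  (* Bootstrap: the derivative of [G] is the inverse of the Jacobian of [F] at [G], so each order of
     regularity of [G] gives the next one. *)
  elim=> [|k IH]; first by move=> y /dG[? _]; exact: differentiable_continuous.
  split=> [y /dG[]//|v].
  have CJ : Ck k W (fun y => jacobian F (G y)).
    apply: Ck_mx => // i j.
    have [_ DF] := sF k.+1.
    have := @Ck_comp_rV R _ k n W V0 G (fun q => 'D_(delta_mx 0 i) F q 0 j) oW.
    move=> /(_ (fun y Wy => VV0 _ (GW y Wy).1) IH (Ck_entry 0 j oV0 (DF _))).
    apply: Ck_ext => // y Wy /=; rewrite jacobianE ?derive_entry//; exact/dF/VV0/(GW y Wy).1.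
  have := Ck_mulmx oW (@Ck_cst _ _ _ k W v) (Ck_invmx oW (fun y Wy => uF _ (VV0 _ (GW y Wy).1)) CJ).
  by apply: Ck_ext => // y Wy; rewrite (dG y Wy).2.
- by move=> q Vq; have [V1 E1] := GW (F q) Vq.2; apply/eqP; rewrite -subr_eq0 -normr_le0;
    rewrite (le_trans (lip _ _ (Vr1 _ Vq) (Vr1 _ V1)))// E1 subrr normr0 mulr0.
Qed.

End InverseFunction.

(** * Linear differential equations and flat connections *)

Section MatrixCalculus.
Variables (R : realType) (V : normedModType R).

Lemma differentiable_mulmx m n l (f : V -> 'M[R]_(m, n)) (g : V -> 'M[R]_(n, l)) p :
  differentiable f p -> differentiable g p -> differentiable (fun q => f q *m g q) p.
Proof.
move=> df dg; apply: differentiable_mx => i j.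
rewrite (_ : (fun q => _) = \sum_(k < n) (fun q => f q i k) * (fun q => g q k j)); last first.
  by apply/funext => q; rewrite mxE fct_sumE.
by apply: differentiable_sum => k; apply: differentiableM; exact: differentiable_entry.
Qed.

Lemma derive_mulmx m n l (f : V -> 'M[R]_(m, n)) (g : V -> 'M[R]_(n, l)) p v :
  differentiable f p -> differentiable g p ->
  'D_v (fun q => f q *m g q) p = 'D_v f p *m g p + f p *m 'D_v g p.
Proof.
move=> df dg; apply/matrixP => i j; rewrite derive_entry; last exact: differentiable_mulmx.
have dfe k := differentiable_entry i k df; have dge k := differentiable_entry k j dg.
rewrite (_ : (fun q => _) = \sum_(k < n) (fun q => f q i k) * (fun q => g q k j)); last first.
  by apply/funext => q; rewrite mxE fct_sumE.
rewrite derive_sum; last by move=> k; apply: diff_derivable; exact: differentiableM.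
rewrite !mxE -big_split /=; apply: eq_bigr => k _.
rewrite deriveM; [|exact: diff_derivable|exact: diff_derivable].
by rewrite (derive_entry v i k df) (derive_entry v k j dg) addrC; congr (_ + _); exact: mulrC.
Qed.

End MatrixCalculus.

(** * Linear differential equations on [-1, 1] *)

Section Clamp.
Variable R : realType.

(** The retraction of the line onto [-1, 1], written with absolute values so that continuity is
    immediate. Composition with it turns a function continuous for |x| < 2 into one continuous
    everywhere, with the same values on [-1, 1], ready to be integrated. *)
Definition clamp (x : R) : R := 2^-1 * (`|x + 1| - `|x - 1|).

Lemma clamp_id (x : R) : `|x| <= 1 -> clamp x = x.
Proof.
rewrite ler_norml => /andP[x0 x1].
by rewrite /clamp ger0_norm ?ler0_norm; lra.
Qed.

Lemma clamp_norm (x : R) : `|clamp x| <= 1.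
Proof.
rewrite /clamp normrM gtr0_norm ?invr_gt0// ler_pdivrMl// mulr1.
by rewrite (le_trans (ler_dist_dist _ _))// opprB addrC addrA subrK ger0_norm.
Qed.

Lemma clamp_continuous : continuous clamp.
Proof.
move=> x; apply: cvgM; first exact: cvg_cst.
apply: cvgB; apply: cvg_norm; last by apply: cvgB; [exact: cvg_id|exact: cvg_cst].
by apply: cvgD; [exact: cvg_id|exact: cvg_cst].
Qed.

Lemma clamp_comp_continuous (W : topologicalType) (f : R -> W) :
  (forall x, `|x| < 2 -> {for x, continuous f}) -> continuous (f \o clamp).
Proof.
move=> cf x; apply: continuous_comp; first exact: clamp_continuous.
by apply: cf; rewrite (le_lt_trans (clamp_norm x))// ltr1n.
Qed.

Lemma is_derive_subc (F : R -> R) (x c d : R) : derivable F x 1 /\ derive1 F x = d ->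
  is_derive x (1 : R) (fun y => F y - c) d.
Proof.
move=> [dF FE]; have H : is_derive x (1 : R) (F - cst c) (d - 0).
  by apply: is_deriveB; split => //; rewrite -derive1E.
by rewrite subr0 in H.
Qed.

Lemma antiderivative_real (f : R -> R) : continuous f ->
  exists2 F : R -> R, F 0 = 0 & forall x, `|x| < 2 -> is_derive x (1 : R) F (f x).
Proof.
move=> cf.
have fi : lebesgue_measure.-integrable `[(-2)%R, 2%R]%classic (EFin \o f).
  apply: continuous_compact_integrable; first exact: segment_compact.
  exact: continuous_subspaceT.
exists (fun x => (\int[lebesgue_measure]_(t in `[(-2)%R, x]) f t)%R
  - (\int[lebesgue_measure]_(t in `[(-2)%R, 0%R]) f t)%R) => [|x]; first by rewrite subrr.
rewrite ltr_norml => /andP[x2 x2'].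
exact: is_derive_subc (continuous_FTC1_closed x2' fi x2 (cf x)).
Qed.

Lemma is_derive_diff (W : normedModType R) (f : R -> W) x d :
  is_derive x (1 : R) f d -> differentiable f x /\ 'D_1 f x = d.
Proof. by case=> df <-; split => //; exact/derivable1_diffP. Qed.

Lemma antiderivative m n (f : R -> 'M[R]_(m, n)) : continuous f ->
  exists2 F : R -> 'M[R]_(m, n), F 0 = 0 &
    forall x, `|x| < 2 -> differentiable F x /\ 'D_1 F x = f x.
Proof.
move=> cf.
have H i j : exists F : R -> R, F 0 = 0 /\ forall x, `|x| < 2 -> is_derive x (1 : R) F (f x i j).
  have [|F F0 dF] := @antiderivative_real (fun x => f x i j); last by exists F.
  move=> x; apply: (@continuous_comp _ _ _ f (fun M : 'M[R]_(m, n) => M i j)); first exact: cf.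
  exact: coord_mx_continuous.
pose F i j := sval (cid (H i j)).
have F0 i j : F i j 0 = 0 by have [] := svalP (cid (H i j)).
have dF i j x : `|x| < 2 -> differentiable (F i j) x /\ 'D_1 (F i j) x = f x i j.
  by move=> x2; apply: is_derive_diff; have [_] := svalP (cid (H i j)); exact.
exists (fun x => \matrix_(i, j) F i j x) => [|x x2].
  by apply/matrixP => i j; rewrite !mxE.
have Fij i j : (fun y => (\matrix_(i, j) F i j y) i j) = F i j.
  by apply/funext => y; rewrite mxE.
have dFx : differentiable (fun x => \matrix_(i, j) F i j x) x.
  by apply: differentiable_mx => i j; rewrite Fij; have [] := dF i j x x2.
split => //; apply/matrixP => i j; rewrite derive_entry// Fij.
by have [] := dF i j x x2.
Qed.

(** The norm of a matrix is its largest entry in absolute value, so the scalar mean value theorem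
    applied entry by entry loses no constant. *)
Lemma mean_value_bound m n (F f : R -> 'M[R]_(m, n)) (M : R) : 0 <= M -> F 0 = 0 ->
  (forall t, `|t| <= 1 -> differentiable F t /\ 'D_1 F t = f t) ->
  (forall t, `|t| <= 1 -> `|f t| <= M) ->
  forall s, `|s| <= 1 -> `|F s| <= M.
Proof.
move=> M0 F0 dF fM s s1; apply: norm_le_entry => // i j.
have ts (t : R) : 0 <= t <= 1 -> `|0 + t *: s| <= 1.
  move=> /andP[t0 t1]; rewrite add0r normrZ (ger0_norm t0).
  by rewrite (le_trans _ s1)// ler_piMl.
have [t t01|t t01] := @mvt_line R R (fun x => F x i j) 0 s.
  by apply: differentiable_entry; have [] := dF _ (ts t t01).
rewrite add0r F0 mxE subr0 => ->.
have [dFt FE] := dF _ (ts t t01).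
rewrite -derive_entry// -[s in 'D_s _ _]mulr1 derive_dirZ// FE mxE normrM.
have := ler_entry_norm (f (0 + t *: s)) i j; have := fM _ (ts t t01).
move=> fM1 fij; rewrite -[leRHS]mul1r ler_pM// (le_trans fij)//.
Qed.

(** On so short an interval the inequality closes on itself: at a point where |W| is largest, the
    mean value bound gives |W| <= |W| / 2 + e. *)
Lemma gronwall m n (W E : R -> 'M[R]_(m, n)) (B : R -> 'M[R]_n) (e K : R) : 0 <= e -> 0 <= K ->
  n%:R * K <= 2^-1 -> W 0 = 0 ->
  (forall t, `|t| <= 1 -> differentiable W t /\ 'D_1 W t = W t *m B t + E t) ->
  (forall t, `|t| <= 1 -> `|B t| <= K) -> (forall t, `|t| <= 1 -> `|E t| <= e) ->
  forall s, `|s| <= 1 -> `|W s| <= 2 * e.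
Proof.
move=> e0 K0 nK W0 dW BK Ee.
have in1 (t : R) : (t \in `[(-1)%R, 1%R]) = (`|t| <= 1) by rewrite in_itv /= ler_norml.
have [|c /[!in1] c1 cmax] := @EVT_max R (fun t => `|W t|) (-1) 1 (ltW (gtrN ltr01)).
  apply: continuous_in_subspaceT => t /set_mem /=; rewrite in1 => t1.
  by apply: cvg_norm; apply: differentiable_continuous; have [] := dW t t1.
have bound t : `|t| <= 1 -> `|W t *m B t + E t| <= 2^-1 * `|W c| + e.
  move=> t1; rewrite (le_trans (ler_normD _ _))// lerD ?Ee//.
  rewrite (le_trans (norm_mulmx _ _))// mulrAC.
  have Wt : `|W t| <= `|W c| by apply: cmax; rewrite in1.
  apply: ler_pM => //.
  by rewrite (le_trans _ nK)// ler_wpM2l// BK.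
have b0 : 0 <= 2^-1 * `|W c| + e by rewrite addr_ge0// mulr_ge0.
have := mean_value_bound b0 W0 dW bound c1 => Wc s s1.
have Ws : `|W s| <= `|W c| by apply: cmax; rewrite in1.
by move: Wc Ws; move: (`|W c|) (`|W s|) => x y; lra.
Qed.

Lemma continuous_mulmx m n l (f : R -> 'M[R]_(m, n)) (g : R -> 'M[R]_(n, l)) :
  (forall t, `|t| < 2 -> {for t, continuous f}) ->
  (forall t, `|t| < 2 -> {for t, continuous g}) ->
  forall t, `|t| < 2 -> {for t, continuous (fun s => f s *m g s)}.
Proof.
move=> cf cg; have oD : open [set t : R | `|t| < 2].
  have -> : [set t : R | `|t| < 2] = ball (0 : R) 2.
    by apply/seteqP; split => t; rewrite -ball_normE /= sub0r normrN.
  exact: ball_open.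
by apply: (@Ck_mulmx R R 0 [set t : R | `|t| < 2]).
Qed.

Lemma geometric_cvg0 (M : R) : (fun k => M / 2 ^+ k) @ \oo --> (0 : R).
Proof.
have -> : (fun k => M / 2 ^+ k) = (fun k => geometric M 2^-1 k).
  by apply/funext => k; rewrite /geometric /= exprVn.
by apply: cvg_geometric; rewrite gtr0_norm ?invr_gt0// invf_lt1// ltr1n.
Qed.

Lemma geometric_le0 (x M : R) : (forall k, x <= M / 2 ^+ k) -> x <= 0.
Proof.
move=> xM; rewrite leNgt; apply/negP => x0.
have /cvgrPdist_lt/(_ _ x0)[N _ HN] := geometric_cvg0 M.
have := HN N (leqnn N); rewrite /= sub0r normrN.
by move=> /(le_lt_trans (ler_norm _)); rewrite ltNge xM.
Qed.

Lemma geometric_limit (W : completeNormedModType R) (u : nat -> W) (M : R) :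
  (forall k, `|u k.+1 - u k| <= M / 2 ^+ k) ->
  exists l, forall k, `|u k - l| <= 2 * M / 2 ^+ k.
Proof.
move=> du.
have M0 : 0 <= M by have := du 0%N; rewrite expr0 divr1; exact: le_trans.
have dist k j : `|u (k + j)%N - u k| <= 2 * M / 2 ^+ k - 2 * M / 2 ^+ (k + j).
  elim: j => [|j IH]; first by rewrite addn0 !subrr normr0.
  rewrite -(subrK (u (k + j)%N) (u (k + j.+1)%N)) -addrA (le_trans (ler_normD _ _))//.
  rewrite addnS; apply: le_trans (lerD (du _) IH) _.
  rewrite exprS invfM; set x := (2 ^+ (k + j))^-1; set y := (2 ^+ k)^-1.
  by rewrite le_eqVlt; apply/orP; left; apply/eqP; field.
have geo0 := geometric_cvg0 (2 * M).
have uc : cvg (u @ \oo).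
  apply/cauchy_cvgP/cauchy_exP => e e0.
  have /cvgrPdist_lt/(_ _ e0)[N _ HN] := geo0.
  exists (u N); exists N => // k /= Nk; rewrite -ball_normE /= distrC -(subnKC Nk).
  rewrite (le_lt_trans (dist _ _))// (le_lt_trans _ (HN N (leqnn N)))//.
  rewrite sub0r normrN ger0_norm ?divr_ge0 ?mulr_ge0 ?exprn_ge0//.
  by rewrite gerBl divr_ge0 ?mulr_ge0 ?exprn_ge0.
exists (lim (u @ \oo)) => k; rewrite distrC.
have cn : (fun j => `|u (k + j)%N - u k|) @ \oo --> `|lim (u @ \oo) - u k|.
  apply: cvg_norm; apply: cvgB; last exact: cvg_cst.
  exact: (@cvg_comp _ _ _ (addn k) u _ _ _ (cvg_addnl k) uc).
have c0 : cvg ((fun j => `|u (k + j)%N - u k|) @ \oo) by apply/cvg_ex; eexists; exact: cn.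
rewrite -(cvg_lim _ cn)//; apply: limr_le => //; near=> j.
rewrite (le_trans (dist _ _))// gerBl divr_ge0 ?mulr_ge0 ?exprn_ge0//.
Unshelve. all: by end_near. Qed.

(** Picard iteration: one step sends f to 1 plus the integral of f B, and n K <= 1/2 makes it
    contract the supremum over [-1, 1] by 1/2. *)
Theorem linear_ode n (B : R -> 'M[R]_n) (K : R) : 0 <= K -> n%:R * K <= 2^-1 ->
  (forall t, `|t| < 2 -> {for t, continuous B}) -> (forall t, `|t| <= 1 -> `|B t| <= K) ->
  exists2 phi : R -> 'M[R]_n, phi 0 = 1%:M &
    forall t, `|t| <= 1 -> differentiable phi t /\ 'D_1 phi t = phi t *m B t.
Proof.
move=> K0 nK cB BK.
have next_ex (f : R -> 'M[R]_n) : exists F : R -> 'M[R]_n, 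
  (forall t, `|t| < 2 -> {for t, continuous f}) ->
  [/\ F 0 = 1%:M, forall t, `|t| < 2 -> {for t, continuous F} & 
    forall t, `|t| <= 1 -> differentiable F t /\ 'D_1 F t = f t *m B t].
  (* The step must be a total function; off the functions continuous for |t| < 2 the specification
     is vacuous and [f] itself serves. *)
  have [cf|ncf] := pselect (forall t, `|t| < 2 -> {for t, continuous f}); last by exists f.
  have cfB : continuous ((fun t => f t *m B t) \o clamp).
    by apply: clamp_comp_continuous; exact: continuous_mulmx.
  have [F F0 dF] := antiderivative cfB.
  have dF1 t : `|t| < 2 -> differentiable (fun t => F t + 1%:M) t /\ 
      'D_1 (fun t => F t + 1%:M) t = 'D_1 F t.
    move=> t2; have [dFt _] := dF t t2; split.
      exact: (@differentiableD _ _ _ F (cst 1%:M)).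
    rewrite (@deriveD _ _ _ F (cst 1%:M)); [|exact: diff_derivable|exact: derivable_cst].
    by rewrite derive_cst addr0.
  exists (fun t => F t + 1%:M) => _; split => [|t t2|t t1]; first by rewrite F0 add0r.
    by apply: differentiable_continuous; have [] := dF1 t t2.
  have t2 : `|t| < 2 by rewrite (le_lt_trans t1)// ltr1n.
  have [d1 ->] := dF1 t t2; have [d2 ->] := dF t t2; split => //.
  by rewrite /= clamp_id.
pose next f := sval (cid (next_ex f)).
pose S k := iter k next (cst 1%:M).
have cS k : forall t, `|t| < 2 -> {for t, continuous (S k)}.
  elim: k => [t _|k IH t t2]; first exact: cst_continuous.
  by have [_ + _] := svalP (cid (next_ex (S k))) IH; apply.
have nextP f : (forall t, `|t| < 2 -> {for t, continuous f}) -> 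
   [/\ next f 0 = 1%:M, forall t, `|t| < 2 -> {for t, continuous (next f)} & 
    forall t, `|t| <= 1 -> differentiable (next f) t /\ 'D_1 (next f) t = f t *m B t].
  by move=> cf; exact: svalP (cid (next_ex f)) cf.
have contr f g M : 0 <= M -> (forall t, `|t| < 2 -> {for t, continuous f}) ->
   (forall t, `|t| < 2 -> {for t, continuous g}) ->
   (forall t, `|t| <= 1 -> `|f t - g t| <= M) ->
   forall t, `|t| <= 1 -> `|next f t - next g t| <= 2^-1 * M.
  move=> M0 cf cg fg.
  have [f0 _ df] := nextP _ cf; have [g0 _ dg] := nextP _ cg.
  apply: (@mean_value_bound _ _ (next f - next g) (fun t => (f t - g t) *m B t)).
  - by rewrite mulr_ge0.
  - by rewrite !fctE f0 g0 subrr.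
  - move=> t t1; have [d1 E1] := df t t1; have [d2 E2] := dg t t1.
    split; first exact: differentiableB.
    rewrite deriveB; [|exact: diff_derivable|exact: diff_derivable].
    by rewrite E1 E2 mulmxBl.
  - move=> t t1; rewrite (le_trans (norm_mulmx _ _))// mulrAC.
    by apply: ler_pM => //; [rewrite (le_trans _ nK)// ler_wpM2l// BK|exact: fg].
have S1 t : `|t| <= 1 -> `|S 1%N t - 1%:M| <= K.
  move: t; have := nextP _ (cS 0%N); rewrite -[next _]/(S 1%N); move: (S 1%N) => f [f0 _ df].
  apply: (@mean_value_bound _ _ (f - cst 1%:M) (fun t => 1%:M *m B t) K K0).
  - by rewrite !fctE f0 subrr.
  - move=> s s1; have [d1 E1] := df s s1; split; first exact: differentiableB.
    rewrite deriveB; [|exact: diff_derivable|exact: derivable_cst].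
    by rewrite derive_cst subr0 E1.
  - by move=> s s1; rewrite mul1mx; exact: BK.
have dS k t : `|t| <= 1 -> `|S k.+1 t - S k t| <= K / 2 ^+ k.
  elim: k t => [|k IH] t t1; first by rewrite expr0 divr1; exact: (S1 t t1).
  have -> : K / 2 ^+ k.+1 = 2^-1 * (K / 2 ^+ k) by rewrite exprS invfM mulrCA.
  have Kk0 : 0 <= K / 2 ^+ k by rewrite divr_ge0// exprn_ge0.
  exact: (contr _ _ _ Kk0 (cS k.+1) (cS k) IH t t1).
have lim_ex t : exists l, forall k, `|S k (clamp t) - l| <= 2 * K / 2 ^+ k.
  by apply: geometric_limit => k; apply: dS; exact: clamp_norm.
pose phi t := sval (cid (lim_ex t)).
have phiP t k : `|S k (clamp t) - phi t| <= 2 * K / 2 ^+ k by exact: svalP (cid (lim_ex t)) k.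
have cphi t : `|t| < 2 -> {for t, continuous phi}.
  move=> _; apply/cvgrPdist_lt => e e0.
  have e30 : 0 < e / 3 by rewrite divr_gt0.
  have /cvgrPdist_lt/(_ _ e30)[N _ HN] := geometric_cvg0 (2 * K).
  have {HN} := HN N (leqnn N); rewrite /= sub0r normrN => /(le_lt_trans (ler_norm _)) HN.
  have cT : {for t, continuous (S N \o clamp)} by exact: clamp_comp_continuous (cS N) t.
  have /cvgrPdist_lt/(_ _ e30) := cT; apply: filterS => s /= sT.
  have -> : phi t - phi s = - (S N (clamp t) - phi t) + (S N (clamp t) - S N (clamp s)) +
     (S N (clamp s) - phi s).
    by rewrite opprB !subrKA.
  rewrite (le_lt_trans (ler_normD _ _))// (le_lt_trans (lerD (ler_normD _ _) (lexx _)))//.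
  rewrite normrN; have H1 := le_lt_trans (phiP t N) HN; have H2 := le_lt_trans (phiP s N) HN.
  by rewrite [e](_ : _ = e / 3 + e / 3 + e / 3); [rewrite ltrD// ltrD|field].
(* The solution is [next phi], differentiable as an integral. It coincides with [phi] on [-1, 1]
   because both lie within a multiple of 2^-k of the iterates. *)
have [X0 _ dX] := nextP _ cphi.
exists (next phi) => // t t1; have [dXt XE] := dX t t1; split => //.
rewrite XE; congr (_ *m _); apply/eqP; rewrite -subr_eq0 -normr_le0.
apply: (@geometric_le0 _ (2 * K)) => k.
have phiS s : `|s| <= 1 -> `|S k s - phi s| <= 2 * K / 2 ^+ k.
  by move=> s1; have := phiP s k; rewrite clamp_id.
have K20 : 0 <= 2 * K / 2 ^+ k by rewrite divr_ge0 ?mulr_ge0// exprn_ge0.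
have H1 := contr _ _ _ K20 (cS k) cphi phiS t t1.
have := phiP t k.+1; rewrite clamp_id// -[next (S k)]/(S k.+1) in H1 *.
have -> : 2 * K / 2 ^+ k.+1 = 2^-1 * (2 * K / 2 ^+ k) by rewrite exprS invfM mulrCA.
move=> H2; have -> : phi t - next phi t = (S k.+1 t - next phi t) - (S k.+1 t - phi t).
  by rewrite opprB [RHS]addrC addrA subrK.
rewrite (le_trans (ler_normB _ _))// (le_trans (lerD H1 H2))//.
by move: (2 * K / 2 ^+ k) => x; lra.
Qed.

End Clamp.

(** * Frames of a flat connection *)

Section Frobenius.
Variables (R : realType) (m n : nat).
Notation rV := 'rV[R]_m.
Implicit Types (om : rV -> rV -> 'M[R]_n) (U : set rV).

Lemma connection_bounds U om (q0 : rV) : open U -> U q0 ->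
  (forall q k u v, om q (k *: u + v) = k *: om q u + om q v) ->
  (forall v, smooth U (om ^~ v)) ->
  exists r K : R, [/\ 0 < r, 0 <= K & ball q0 r `<=` U /\
    forall x y v, ball q0 r x -> ball q0 r y ->
      [/\ `|om x v| <= K * `|v|, `|om y v - om x v| <= K * `|y - x| * `|v| &
        `|om y v - om x v - 'D_(y - x) (om ^~ v) x| <= K * `|y - x| ^+ 2 * `|v| ]].
Proof.
move=> oU Uq0 omP Com.
have omD q u v : om q (u + v) = om q u + om q v by rewrite -{1}[u]scale1r omP scale1r.
have om0 q : om q 0 = 0 by apply: (addIr (om q 0)); rewrite -omD !add0r.
have omZ q k v : om q (k *: v) = k *: om q v by rewrite -[k *: v]addr0 omP om0 addr0.
have omS q v : om q v = \sum_i v 0 i *: om q (delta_mx 0 i).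
  rewrite {1}[v]row_sum_delta; elim/big_ind2: _ => [|? x ? y <- <-|i _]; by rewrite ?om0 ?omD ?omZ.
have [r1 r10 r1U] := open_ball_sub oU Uq0.
have [i r r' K K' [rU H] /andP[r'0 r'r] KK'|i|r2 [K2 [r20 K20 H2]]] :=
  @common_bounds R ('I_m * 'I_n * 'I_n)%type (fun i r K => ball q0 r `<=` U /\
    forall x y, ball q0 r x -> ball q0 r y ->
      let f q := om q (delta_mx 0 i.1.1) i.1.2 i.2 in
      [/\ `|f x| <= K, `|f y - f x| <= K * `|y - x| &
        `|f y - f x - 'D_(y - x) f x| <= K * `|y - x| ^+ 2]).
- split=> [|x y xr yr /=]; first by apply: subset_trans rU; exact: le_ball.
  have [h1 h2 h3] := H x y (le_ball r'r xr) (le_ball r'r yr).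
  split; first exact: le_trans h1 KK'.
    by rewrite (le_trans h2)// ler_wpM2r.
  by rewrite (le_trans h3)// ler_wpM2r// sqr_ge0.
- apply: (@local_taylor _ _ U) => //.
  by apply: Ck_entry => //; exact: Com.
pose r := Num.min r1 r2.
have r0 : 0 < r by rewrite lt_min r10.
have rr1 : r <= r1 by rewrite ge_min lexx.
have rr2 : r <= r2 by rewrite ge_min lexx orbT.
have rU : ball q0 r `<=` U by apply: subset_trans r1U; exact: le_ball.
exists r, (m%:R * K2); split => //; first by rewrite mulr_ge0.
split => // x y v /[dup] xr /(le_ball rr2) xr2 /[dup] yr /(le_ball rr2) yr2.
have dom i : differentiable (om ^~ (delta_mx 0 i)) x.
  by have [d _] := Com (delta_mx 0 i) 1%N; apply/d/rU.
have entry_le (A : 'I_m -> 'M[R]_n) (b : R) : 0 <= b ->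
    (forall i j k, `|A i j k| <= b) -> `|\sum_i v 0 i *: A i| <= m%:R * b * `|v|.
  move=> b0 Ab; rewrite (le_trans (ler_norm_sum _ _ _))//.
  apply: (@le_trans _ _ (\sum_(i < m) `|v| * b)).
    apply: ler_sum => i _; rewrite normrZ ler_pM// ?ler_entry_norm//.
    by apply: norm_le_entry.
  by rewrite sumr_const card_ord -[leLHS]mulr_natl -mulrA [b * _]mulrC.
have Hi i j k := (H2 (i, j, k)).2 x y xr2 yr2.
split.
- by rewrite omS; apply: entry_le => // i j k; have [] := Hi i j k.
- rewrite !(omS _ v) -sumrB; under eq_bigr do rewrite -scalerBr.
  rewrite -[m%:R * K2 * _]mulrA; apply: entry_le => [|i j k]; first by rewrite mulr_ge0.
  by rewrite !mxE; have [] := Hi i j k.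
- have -> : 'D_(y - x) (om^~ v) x = \sum_i v 0 i *: 'D_(y - x) (om ^~ (delta_mx 0 i)) x.
    have -> : om ^~ v = \sum_i (v 0 i *: om ^~ (delta_mx 0 i)).
      by apply/funext => q; rewrite omS fct_sumE.
    rewrite derive_sum; last by move=> i; apply/derivableZ/diff_derivable.
    by apply: eq_bigr => i _; rewrite deriveZ//; exact: diff_derivable.
  rewrite !(omS _ v) -!sumrB; under eq_bigr do rewrite -!scalerBr.
  rewrite -[m%:R * K2 * _]mulrA; apply: entry_le => [|i j k]; first by rewrite mulr_ge0// sqr_ge0.
  have [_ _] := Hi i j k; rewrite -(derive_entry _ _ _ (dom i)).
  by rewrite !mxE.
Qed.

Lemma norm1mx_le1 : `|1%:M : 'M[R]_n| <= 1.
Proof.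
apply: norm_le_entry => // i j; rewrite mxE; case: (i == j) => /=; first by rewrite normr1.
by rewrite normr0.
Qed.

Lemma derive_path_scale (phi c : R -> 'M[R]_n) (t : R) (dphi dc : 'M[R]_n) :
  differentiable phi t /\ 'D_1 phi t = dphi -> differentiable c t /\ 'D_1 c t = dc ->
  differentiable (fun s : R => s *: (phi s *m c s)) t /\
  'D_1 (fun s : R => s *: (phi s *m c s)) t = phi t *m c t + t *: (dphi *m c t + phi t *m dc).
Proof.
move=> [d1 E1] [d2 E2].
have -> : (fun s : R => s *: (phi s *m c s)) = (fun s : R => (s *: 1%:M) *m (phi s *m c s)).
  by apply/funext => s; rewrite -scalemxAl mul1mx.
have ds : differentiable (fun s : R => s *: (1%:M : 'M[R]_n)) t.
  by apply: differentiableZl; exact: ex_diff.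
have dp := differentiable_mulmx d1 d2.
split; first exact: differentiable_mulmx.
rewrite derive_mulmx// derive_mulmx// E1 E2 -scalemxAl mul1mx; congr (_ + _).
rewrite deriveE// diffZl; last exact: ex_diff.
by rewrite diff_val scale1r mul1mx.
Qed.

Lemma derive_subP (V W : normedModType R) (f g : V -> W) p v df dg :
  differentiable f p /\ 'D_v f p = df -> differentiable g p /\ 'D_v g p = dg ->
  differentiable (f - g) p /\ 'D_v (f - g) p = df - dg.
Proof.
move=> [d1 <-] [d2 <-]; split; first exact: differentiableB.
by rewrite deriveB//; exact: diff_derivable.
Qed.

Lemma mulmx_bound (A B : 'M[R]_n) (x y : R) : `|A| <= x -> `|B| <= y ->
  `|A *m B| <= n%:R * x * y.
Proof.
by move=> Ax By; rewrite (le_trans (norm_mulmx _ _))// ler_pM// ?mulr_ge0// ler_wpM2l.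
Qed.

(** [phi] and [psi] solve the equation along two neighbouring segments, and [c] is the connection
    form in the direction separating them. By flatness t phi c solves the linearised equation up to
    the prescribed source, so psi - phi - t phi c satisfies the equation of [phi] with a
    second-order source term, and Gronwall's inequality concludes. *)
Lemma flat_path_estimate (phi psi b b' c dv dh : R -> 'M[R]_n) (k e1 e2 : R) :
  0 <= k -> 0 <= e1 -> 0 <= e2 -> n%:R * k <= 2^-1 -> k <= 2^-1 ->
  phi 0 = 1%:M -> psi 0 = 1%:M ->
  (forall t, `|t| <= 1 -> differentiable phi t /\ 'D_1 phi t = phi t *m b t) ->
  (forall t, `|t| <= 1 -> differentiable psi t /\ 'D_1 psi t = psi t *m b' t) ->
  (forall t, `|t| <= 1 -> differentiable c t /\ 'D_1 c t = dv t) ->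
  (forall t, `|t| <= 1 -> dv t - dh t + (b t *m c t - c t *m b t) = 0) ->
  (forall t, `|t| <= 1 -> `|b t| <= k) -> (forall t, `|t| <= 1 -> `|b' t| <= k) ->
  (forall t, `|t| <= 1 -> `|b' t - b t| <= e1) ->
  (forall t, `|t| <= 1 -> `|b' t - b t - c t - t *: dh t| <= e2) ->
  `|psi 1 - phi 1 - phi 1 *m c 1| <=
    2 * (n%:R * (2 * (n%:R * 2 * e1)) * e1 + n%:R * 2 * e2).
Proof.
move=> k0 e10 e20 nk k2 phi0 psi0 dphi dpsi dc flat bk b'k be1 be2.
have dcst (t : R) : differentiable (cst (1%:M : 'M[R]_n)) t /\
    'D_(1 : R) (cst (1%:M : 'M[R]_n)) t = 0.
  by split => //; exact: derive_cst.
(* Gronwall's inequality for phi - 1, with source term [b], gives |phi - 1| <= 2 k <= 1. *)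
have phi2 t : `|t| <= 1 -> `|phi t| <= 2.
  move=> t1; have : `|(phi - cst 1%:M) t| <= 2 * k.
    apply: (gronwall k0 k0 nk _ _ bk bk t1) => [|s s1]; first by rewrite !fctE phi0 subrr.
    have [d E] := derive_subP (dphi s s1) (dcst s); split => //.
    by rewrite E subr0 mulmxBl mul1mx subrK.
  rewrite !fctE => H; rewrite -(subrK 1%:M (phi t)) (le_trans (ler_normD _ _))//.
  by have := norm1mx_le1; move: H k2; lra.
have nb0 : 0 <= n%:R * 2 * e1 by rewrite !mulr_ge0.
have Delta t : `|t| <= 1 -> `|(psi - phi) t| <= 2 * (n%:R * 2 * e1).
  move=> t1; apply: (@gronwall _ n n (psi - phi) (fun t => phi t *m (b' t - b t)) b' _ k
    nb0 k0 nk _ _ b'k _ t t1).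
  - by rewrite !fctE phi0 psi0 subrr.
  - move=> s s1; have [d E] := derive_subP (dpsi s s1) (dphi s s1); split; first exact: d.
    by rewrite E mulmxBl mulmxBr addrA subrK.
  - by move=> s s1; apply: mulmx_bound; [exact: phi2|exact: be1].
have E0 : 0 <= n%:R * (2 * (n%:R * 2 * e1)) * e1 + n%:R * 2 * e2.
  by rewrite addr_ge0// mulr_ge0// mulr_ge0// mulr_ge0.
have one1 : `|1 : R| <= 1 by rewrite normr1.
have := @gronwall _ n n (psi - phi - (fun s : R => s *: (phi s *m c s)))
  (fun t => (psi t - phi t) *m (b' t - b t) + phi t *m (b' t - b t - c t - t *: dh t)) b
  _ k E0 k0 nk _ _ bk _ 1 one1.
rewrite !fctE scale1r; apply.
- by rewrite scale0r phi0 psi0 !subrr.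
- move=> t t1.
  have [d E] := derive_subP (derive_subP (dpsi t t1) (dphi t t1))
    (derive_path_scale (dphi t t1) (dc t t1)).
  split; first exact: d.
  have -> : 'D_1 (fun s => psi s - phi s - s *: (phi s *m c s)) t =
    'D_1 (psi - phi - (fun s : R => s *: (phi s *m c s))) t by [].
  rewrite E.
  (* Flatness, in the form that moves the factor [b] to the right of [c]: the derivative of t phi c
     becomes (t phi c) b plus terms that match the variation of [b]. *)
  have F : b t *m c t + dv t = c t *m b t + dh t.
    apply/eqP; rewrite -subr_eq0; apply/eqP; rewrite -[RHS](flat t t1).
    by rewrite opprD addrACA addrC.
  rewrite -mulmxA -mulmxDr F.
  rewrite !(mulmxBl, mulmxBr, mulmxDr, scalerDr, mulmxDl) -!scalemxAl -!scalemxAr !mulmxA.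
  move: (psi t *m b' t) (phi t *m b t) (phi t *m c t *m b t) (phi t *m c t) (phi t *m dh t)
    (psi t *m b t) (phi t *m b' t) => A1 A2 A3 A4 A5 A6 A7.
  by apply/matrixP => i j; rewrite !mxE; ring.
- move=> t t1; rewrite (le_trans (ler_normD _ _))// lerD//.
    by apply: mulmx_bound; [exact: Delta|exact: be1].
  by apply: mulmx_bound; [exact: phi2|exact: be2].
Qed.

Lemma linear_map_of (L : rV -> 'M[R]_n) : (forall k u v, L (k *: u + v) = k *: L u + L v) ->
  exists2 L' : {linear rV -> 'M[R]_n}, continuous L' & L' =1 L.
Proof.
move=> Llin.
pose L' : {linear rV -> 'M[R]_n} :=
  HB.pack L (GRing.isLinear.Build R rV 'M[R]_n *:%R L (fun k u v => Llin k u v)).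
exists L' => //.
have oT : open [set: rV] by exact: openT.
have C : Ck 0 setT (fun v : rV => \sum_i v 0 i *: L' (delta_mx 0 i)).
  by apply: Ck_sum => // i; apply: Ck_scale => //; apply: Ck_entry => //; exact: Ck_id.
have E : (fun v : rV => \sum_i v 0 i *: L' (delta_mx 0 i)) = L'.
  apply/funext => v; rewrite [in RHS](row_sum_delta v) linear_sum.
  by apply: eq_bigr => i _; rewrite linearZ.
by move=> v; rewrite -E; exact: (C v I).
Qed.

(** The segments are followed up to parameter 2, as [linear_ode] asks for continuity there, hence 2
    rho <= r. The bounds 1/2 serve Picard iteration and Gronwall's inequality; rho <= 1 gives |v| <=
    1 in the constants. *)
Lemma small_radius (r K : R) : 0 < r -> 0 <= K ->
  exists rho, [/\ 0 < rho, rho <= 1, 2 * rho <= r, n%:R * (K * rho) <= 2^-1 & K * rho <= 2^-1].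
Proof.
move=> r0 K0; pose c := 2 * (n%:R + 1) * (K + 1).
have n0 : 0 <= n%:R :> R by [].
have c0 : 0 < c by rewrite !mulr_gt0// ltr_wpDl.
have nKc : n%:R * K * 2 <= c.
  by rewrite /c -subr_ge0; have -> : 2 * (n%:R + 1) * (K + 1) - n%:R * K * 2 =
    2 * (n%:R + K + 1) by [ring]; rewrite mulr_ge0// !addr_ge0.
have Kc : K * 2 <= c.
  by rewrite /c -subr_ge0; have -> : 2 * (n%:R + 1) * (K + 1) - K * 2 =
    2 * (n%:R * K + n%:R + 1) by [ring]; rewrite mulr_ge0// !addr_ge0// mulr_ge0.
have [rho [rho0 rho1 rhor rhoc]] : exists rho, [/\ 0 < rho, rho <= 1, 2 * rho <= r & rho * c <= 1].
  exists (Num.min 1 (Num.min (r / 2) c^-1)); split.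
  - by rewrite !lt_min ltr01 divr_gt0//= invr_gt0.
  - by rewrite ge_min lexx.
  - by rewrite mulrC -ler_pdivlMr// !ge_min lexx orbT.
  - by rewrite -ler_pdivlMr// div1r !ge_min lexx !orbT.
exists rho; split => //.
- rewrite -(ler_pM2r (ltr0n _ 2)) mulVf// (le_trans _ rhoc)//.
  have -> : n%:R * (K * rho) * 2 = rho * (n%:R * K * 2) by ring.
  by rewrite ler_wpM2l// ltW.
- rewrite -(ler_pM2r (ltr0n _ 2)) mulVf// (le_trans _ rhoc)//.
  have -> : K * rho * 2 = rho * (K * 2) by ring.
  by rewrite ler_wpM2l// ltW.
Qed.

(* F (q0 + v) is the solution at time 1 of the linear equation along the segment from
   q0 to q0 + v; by flatness and Gronwall's inequality, dF = F om also transversally. *)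
Theorem flat_connection_frame U om (q0 : rV) : open U -> U q0 ->
  (forall q k u v, om q (k *: u + v) = k *: om q u + om q v) ->
  (forall v, smooth U (om ^~ v)) ->
  (forall q u v, U q -> 'D_u (om ^~ v) q - 'D_v (om ^~ u) q +
     (om q u *m om q v - om q v *m om q u) = 0) ->
  exists (rho : R) (F : rV -> 'M[R]_n), [/\ 0 < rho, ball q0 rho `<=` U, F q0 = 1%:M &
    forall q, ball q0 rho q -> differentiable F q /\ forall v, 'D_v F q = F q *m om q v].
Proof.
move=> oU Uq0 omP Com flat.
have [r [K [r0 K0 [rU bnd]]]] := connection_bounds oU Uq0 omP Com.
have [rho [rho0 rho1 rhor nKr Kr]] := small_radius r0 K0.
have omD q u v : om q (u + v) = om q u + om q v by rewrite -{1}[u]scale1r omP scale1r.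
have om0 q : om q 0 = 0 by apply: (addIr (om q 0)); rewrite -omD !add0r.
have dom q v : U q -> differentiable (om ^~ v) q by move=> Uq; have [d _] := Com v 1%N; exact: d.
have Kr0 : 0 <= K * rho by rewrite mulr_ge0// ltW.
have inb v t : `|v| < rho -> `|t| <= 2 -> ball q0 r (q0 + t *: v).
  move=> vr t2; rewrite -ball_normE /= opprD addNKr normrN normrZ (lt_le_trans _ rhor)//.
  apply: (@le_lt_trans _ _ (2 * `|v|)); first by rewrite ler_wpM2r.
  by rewrite ltr_pM2l.
have one2 : (1 : R) <= 2 by rewrite ler1n.
have inb1 v t : `|v| < rho -> `|t| <= 1 -> ball q0 r (q0 + t *: v).
  by move=> vr t1; apply: inb => //; rewrite (le_trans t1).
have bK v w t : `|v| < rho -> `|t| <= 1 -> `|om (q0 + t *: v) w| <= K * `|w|.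
  move=> vr t1; have ib := inb1 v t vr t1.
  by have [] := bnd _ _ w ib ib.
have phi_ex v : exists phi : R -> 'M[R]_n, `|v| < rho -> phi 0 = 1%:M /\
    forall t, `|t| <= 1 -> differentiable phi t /\ 'D_1 phi t = phi t *m om (q0 + t *: v) v.
  have [vr|] := boolP (`|v| < rho); last by move=> /negP nv; exists (cst 0).
  have [||t t2|t t1|phi phi0 dphi] := @linear_ode R n (fun t => om (q0 + t *: v) v) (K * rho).
  - exact: Kr0.
  - exact: nKr.
  - apply: differentiable_continuous.
    have [] // := is_derive_diff (@is_derive_line R rV 'M[R]_n (om ^~ v) q0 v t _).
    by apply: dom; apply: rU; apply: inb => //; exact: ltW.
  - by rewrite (le_trans (bK v v t vr t1))// ler_wpM2l// ltW.
  - by exists phi.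
pose phi v := sval (cid (phi_ex v)).
have phiP v : `|v| < rho -> phi v 0 = 1%:M /\
    forall t, `|t| <= 1 -> differentiable (phi v) t /\
      'D_1 (phi v) t = phi v t *m om (q0 + t *: v) v.
  exact: svalP (cid (phi_ex v)).
move: (phi) phiP => {phi phi_ex} phi phiP.
have one1 : `|1 : R| <= 1 by rewrite normr1.
pose F q := phi (q - q0) 1.
have rhoU : ball q0 rho `<=` U.
  apply: subset_trans rU; apply: le_ball; rewrite (le_trans _ rhor)//.
  by rewrite ler_peMl// ltW.
exists rho, F; split => //.
  rewrite /F subrr; have [|p0 dp] := phiP 0; first by rewrite normr0.
  apply/eqP; rewrite -subr_eq0 -normr_le0.
  apply: (@mean_value_bound R n n (phi 0 - cst 1%:M) (fun=> 0) 0 (lexx _) _ _ _ 1 one1).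
  - by rewrite !fctE p0 subrr.
  - move=> t t1; have [d E] := dp t t1; split; first exact: differentiableB.
    rewrite deriveB; [|exact: diff_derivable|exact: derivable_cst].
    by rewrite derive_cst subr0 E om0 mulmx0.
  - by move=> t _; rewrite normr0.
move=> q; rewrite -ball_normE /= distrC => qr.
have Uq : U q by apply: rhoU; rewrite -ball_normE /= distrC.
pose v := q - q0.
have [L cL LE] := @linear_map_of (fun h => F q *m om q h) (fun k u w => 
  etrans (congr1 (mulmx (F q)) (omP q k u w)) (etrans (mulmxDr _ _ _) (congr1 (+%R^~ _) (esym (scalemxAr _ _ _))))).
suff [dF DF] : differentiable F q /\ (forall h, 'D_h F q = L h).
  by split => // h; rewrite DF LE.
apply: diff_intro => // e e0.
(* The bound of [flat_path_estimate] at e1 = 2 K |h| and e2 = 2 K |h|^2, with |h|^2 factored out.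
   The factors 2 come from adding a term in |v| <= 1. *)
pose C := 2 * (n%:R * (2 * (n%:R * 2 * (2 * K))) * (2 * K) + n%:R * 2 * (2 * K)).
have C0 : 0 <= C by rewrite !(mulr_ge0, addr_ge0).
have est h : `|v + h| < rho -> `|F (h + q) - F q - L h| <= C * `|h| ^+ 2.
  move=> vhr; rewrite LE.
  have [p0 dp] := phiP v qr; have [p'0 dp'] := phiP (v + h) vhr.
  have q1 : q0 + 1 *: v = q by rewrite scale1r /v addrC subrK.
  have -> : F (h + q) = phi (v + h) 1 by rewrite /F /v [h + q]addrC addrAC.
  have -> : F q *m om q h = phi v 1 *m om (q0 + 1 *: v) h by rewrite q1.
  have bv (t : R) w : `|t| <= 1 -> differentiable (fun s : R => om (q0 + s *: v) w) t /\
      'D_(1 : R) (fun s : R => om (q0 + s *: v) w) t = 'D_v (om ^~ w) (q0 + t *: v).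
    move=> t1; apply: is_derive_diff; apply: (@is_derive_line R rV 'M[R]_n (om ^~ w) q0 v t).
    by apply: dom; apply: rU; exact: inb1.
  have step (t : R) : `|t| <= 1 -> `|q0 + t *: (v + h) - (q0 + t *: v)| <= `|h|.
    move=> t1; rewrite opprD addrACA subrr add0r -scalerBr addrC addrA addNr add0r normrZ.
    by rewrite ler_piMl.
  have bb (t : R) w : `|t| <= 1 -> `|om (q0 + t *: (v + h)) w - om (q0 + t *: v) w| <= K * `|h| * `|w|.
    move=> t1; have [_ H _] := bnd _ _ w (inb1 v t qr t1) (inb1 (v + h) t vhr t1).
    by rewrite (le_trans H)// ler_wpM2r// ler_wpM2l// step.
  have tay (t : R) : `|t| <= 1 -> `|om (q0 + t *: (v + h)) v - om (q0 + t *: v) v -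
      t *: 'D_h (om ^~ v) (q0 + t *: v)| <= K * `|h| ^+ 2 * `|v|.
    move=> t1; have [_ _ H] := bnd _ _ v (inb1 v t qr t1) (inb1 (v + h) t vhr t1).
    have dd := dom _ v (rU _ (inb1 v t qr t1)).
    rewrite -(derive_dirZ _ _ dd).
    have E : q0 + t *: (v + h) - (q0 + t *: v) = t *: h.
      by rewrite opprD addrACA subrr add0r -scalerBr addrC addrA addNr add0r.
    have S := step t t1; rewrite E in H S.
    rewrite (le_trans H)// ler_wpM2r// ler_wpM2l// ler_sqr// nnegrE //.
  have v1 : `|v| <= 1 by rewrite (le_trans (ltW qr)).
  have := @flat_path_estimate (phi v) (phi (v + h)) (fun t => om (q0 + t *: v) v)
    (fun t => om (q0 + t *: (v + h)) (v + h)) (fun t => om (q0 + t *: v) h)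
    (fun t => 'D_v (om ^~ h) (q0 + t *: v)) (fun t => 'D_h (om ^~ v) (q0 + t *: v))
    (K * rho) (2 * (K * `|h|)) (2 * (K * `|h| ^+ 2)) Kr0.
  have e10 : 0 <= 2 * (K * `|h|) by rewrite !mulr_ge0.
  have e20 : 0 <= 2 * (K * `|h| ^+ 2) by rewrite !mulr_ge0.
  have CE : C * `|h| ^+ 2 = 2 * (n%:R * (2 * (n%:R * 2 * (2 * (K * `|h|)))) * (2 * (K * `|h|))
     + n%:R * 2 * (2 * (K * `|h| ^+ 2))).
    by rewrite /C; move: (`|h|) => x; ring.
  rewrite CE; apply => //.
  - by move=> t t1; exact: bv.
  - by move=> t t1; apply: flat; apply: rU; exact: inb1.
  - by move=> t t1; rewrite (le_trans (bK v v t qr t1))// ler_wpM2l// ltW.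
  - by move=> t t1; rewrite (le_trans (bK _ _ t vhr t1))// ler_wpM2l// ltW.
  - move=> t t1; have -> : om (q0 + t *: (v + h)) (v + h) - om (q0 + t *: v) v =
      om (q0 + t *: (v + h)) h + (om (q0 + t *: (v + h)) v - om (q0 + t *: v) v).
      by rewrite omD addrA [om _ h + _]addrC.
    rewrite (le_trans (ler_normD _ _))//.
    have H1 := bK _ h t vhr t1; have H2 := bb t v t1.
    rewrite (le_trans (lerD H1 H2))//.
    have Kh : 0 <= K * `|h| by rewrite mulr_ge0.
    have : K * `|h| * `|v| <= K * `|h| by rewrite ler_piMr.
    by move: (K * `|h|) (K * `|h| * `|v|) => *; lra.
  - move=> t t1.
    have -> : om (q0 + t *: (v + h)) (v + h) - om (q0 + t *: v) v - om (q0 + t *: v) h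
       - t *: 'D_h (om^~ v) (q0 + t *: v) =
      (om (q0 + t *: (v + h)) h - om (q0 + t *: v) h) +
      (om (q0 + t *: (v + h)) v - om (q0 + t *: v) v - t *: 'D_h (om^~ v) (q0 + t *: v)).
      rewrite omD; move: (om (q0 + t *: (v + h)) v) (om (q0 + t *: (v + h)) h)
        (om (q0 + t *: v) v) (om (q0 + t *: v) h) (t *: _) => A1 A2 A3 A4 A5.
      by apply/matrixP => i j; rewrite !mxE; ring.
    rewrite (le_trans (ler_normD _ _))//.
    have H1 := bb t h t1; have H2 := tay t t1.
    rewrite (le_trans (lerD H1 H2))// -[K * `|h| * `|h|]mulrA -expr2.
    have Kh : 0 <= K * `|h| ^+ 2 by rewrite mulr_ge0.
    have : K * `|h| ^+ 2 * `|v| <= K * `|h| ^+ 2 by rewrite ler_piMr.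
    by move: (K * `|h| ^+ 2) (K * `|h| ^+ 2 * `|v|) => *; lra.
have C10 : 0 < C + 1 by rewrite ltr_wpDl.
(* For such h the vector v + h stays shorter than [rho], and C |h|^2 <= e |h|. *)
have d0 : 0 < Num.min (rho - `|v|) (e / (C + 1)) by rewrite lt_min subr_gt0 qr divr_gt0.
apply/nbhs_ballP; exists (Num.min (rho - `|v|) (e / (C + 1))) => //.
move=> h; rewrite -ball_normE /= sub0r normrN lt_min ltrBrDl => /andP[h1 h2].
rewrite (le_trans (est h _))//; first by rewrite (le_lt_trans (ler_normD _ _)).
rewrite expr2 mulrA ler_wpM2r// (@le_trans _ _ ((C + 1) * `|h|))//.
  by rewrite ler_wpM2r// lerDl.
by rewrite mulrC -ler_pdivlMr// ltW.
Qed.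

End Frobenius.

(** * Cartan structure equations *)

Lemma row_mul_sum (R : comNzRingType) m n (x : 'rV[R]_m) (y : 'rV[R]_n) (l : 'I_n)
  (D : 'M[R]_n) (d : 'I_m -> 'I_n -> 'I_n -> R) :
  (forall j l, D j l = \sum_i x 0 i * d i j l) ->
  (y *m D) 0 l = \sum_j \sum_i x 0 i * y 0 j * d i j l.
Proof.
move=> H; rewrite mxE; apply: eq_bigr => j _; rewrite H mulr_sumr.
by apply: eq_bigr => i _; rewrite mulrCA mulrA.
Qed.

Lemma mulmx_gram_cancel (F : fieldType) m n (x : 'M[F]_(m, n)) (C : 'M[F]_n) :
  C \in unitmx -> x *m C^T *m invmx (C *m C^T) *m C = x.
Proof.
move=> uC; have uT : C^T \in unitmx by rewrite unitmx_tr.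
have uCC : C *m C^T \in unitmx by rewrite unitmx_mul uC.
apply: (can_inj (mulmxK uT)); rewrite -[LHS]mulmxA mulmxKV//.
Qed.

Section Dot.
Variables (R : realType) (n : nat).
Implicit Types x y z : 'rV[R]_n.

Definition dot x y : R := (x *m y^T) 0 0.

Lemma dotE x y : dot x y = \sum_i x 0 i * y 0 i.
Proof. by rewrite /dot mxE; apply: eq_bigr => i _; rewrite mxE. Qed.

Lemma dotC x y : dot x y = dot y x.
Proof. by rewrite !dotE; apply: eq_bigr => i _; rewrite mulrC. Qed.

Lemma dotDl x y z : dot (x + y) z = dot x z + dot y z.
Proof. by rewrite /dot mulmxDl mxE. Qed.

Lemma dotDr x y z : dot x (y + z) = dot x y + dot x z.
Proof. by rewrite dotC dotDl !(dotC x). Qed.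

Lemma dot_skew x y (B : 'M[R]_n) : B^T = - B -> dot x (y *m B) = - dot (x *m B) y.
Proof. by move=> BT; rewrite /dot trmx_mul BT mulNmx mulmxN mulmxA mxE. Qed.

Lemma dot_delta x i : dot x (delta_mx 0 i) = x 0 i.
Proof.
rewrite dotE (bigD1 i)//= mxE !eqxx mulr1 big1 ?addr0// => j /negPf ji.
by rewrite mxE ji andbF mulr0.
Qed.

End Dot.

Lemma derive_trmx (R : realType) (V : normedModType R) m n (f : V -> 'M[R]_(m, n)) p v :
  differentiable f p -> differentiable (fun q => (f q)^T) p /\
    'D_v (fun q => (f q)^T) p = ('D_v f p)^T.
Proof.
move=> df.
have E i j : (fun q => (f q)^T i j) = (fun q => f q j i) by apply/funext => q; rewrite mxE.
have dT : differentiable (fun q => (f q)^T) p.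
  by apply: differentiable_mx => i j; rewrite E; exact: differentiable_entry.
split => //; apply/matrixP => i j.
by rewrite (derive_entry _ _ _ dT) E [RHS]mxE (derive_entry _ _ _ df).
Qed.

Lemma derive_const (R : realType) (V W : normedModType R) (c : W) (p v : V) :
  'D_v (fun=> c) p = 0.
Proof. exact: derive_cst. Qed.

Lemma derive2_entry (R : realType) (V : normedModType R) m n (U : set V)
    (f : V -> 'M[R]_(m, n)) x y i j p :
  open U -> Ck 2 U f -> U p ->
  'D_x ('D_y f) p i j = 'D_x ('D_y (fun q => f q i j)) p.
Proof.
move=> oU [df Df] Up; have [dDf _] := Df y.
rewrite (derive_entry _ _ _ (dDf p Up)).
apply: near_eq_derive; apply: (@near_open _ _ U) => // q Uq.
by rewrite derive_entry//; exact: df.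
Qed.

Lemma addr_regroup (Z : zmodType) (a b c d e : Z) :
  a + (b + c) + (d + e) = a + c + e + (b + d).
Proof. by rewrite [b + c]addrC [d + e]addrC -addrA addrACA !addrA. Qed.

Lemma subr_regroup (Z : zmodType) (x a b c d s t : Z) :
  (x + a + c + (s + t)) - (x + b + d + (t + s)) = a - b + (c - d).
Proof.
by rewrite [t + s]addrC opprD addrACA subrr addr0 opprD addrACA opprD [X in X + _]addrACA subrr add0r.
Qed.

Section Cartan.
Variable R : realType.
Notation vec := 'rV[R]_4.
Variables (M : set vec) (C : vec -> 'M[R]_4) (A : vec -> vec -> 'M[R]_4) (g : vec -> 'M[R]_4).
Hypothesis oM : open M.
Hypothesis gE : forall q, g q = C q *m (C q)^T.
Hypothesis Cunit : forall q, M q -> C q \in unitmx.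
Hypothesis Csmooth : forall k, Ck k M C.
Hypothesis Asmooth : forall k u, Ck k M (A ^~ u).
Hypothesis Askew : forall q u, M q -> (A q u)^T = - A q u.
Hypothesis torsion_free : forall q u v, M q ->
  v *m 'D_u C q + v *m C q *m A q u = u *m 'D_v C q + u *m C q *m A q v.

Let dC q : M q -> differentiable C q.
Proof. by move=> Mq; have [d _] := Csmooth 1; exact: d. Qed.

Lemma bilE q u v : bil (g q) u v = dot (u *m C q) (v *m C q).
Proof. by rewrite /bil /dot gE trmx_mul !mulmxA. Qed.

Lemma derive_metric q u : M q ->
  'D_u g q = 'D_u C q *m (C q)^T + C q *m ('D_u C q)^T.
Proof.
move=> Mq; have <- : (fun q => C q *m (C q)^T) = g by apply/funext => p; rewrite gE.
have [dT <-] := derive_trmx u (dC Mq).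
by rewrite derive_mulmx//; exact: dC.
Qed.

(** The components in the coframe of the covariant derivative of the constant field v along u, for
    the connection described by [A]. That it is the Levi-Civita connection of [g] is the content of
    [connection_rowE]. *)
Definition cov (q u v : vec) : vec := v *m 'D_u C q + v *m C q *m A q u.

Lemma derive_metric_cov q x y z : M q ->
  (y *m 'D_x g q *m z^T) 0 0 = dot (cov q x y) (z *m C q) + dot (y *m C q) (cov q x z).
Proof.
move=> Mq; rewrite /cov dotDl dotDr (dot_skew _ _ (Askew x Mq)).
rewrite addrA addrAC addrK derive_metric// mulmxDr mulmxDl mxE.
by rewrite /dot !trmx_mul !mulmxA.
Qed.

(** Skewness of [A] splits each derivative of the metric into two [cov] terms, and symmetry of
    [cov], which is the absence of torsion, cancels four of the six. *)
Lemma koszul q u v : M q ->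
  v *m 'D_u g q + u *m 'D_v g q -
    \row_l (u *m 'D_(coord_vec R l) g q *m v^T) 0 0 = (cov q u v *m (C q)^T) *+ 2.
Proof.
move=> Mq; apply/rowP => l.
have nC x y : cov q x y = cov q y x by exact: torsion_free.
have eC w : (w *m (C q)^T) 0 l = dot w (coord_vec R l *m C q).
  by rewrite /dot trmx_mul mulmxA -[LHS]dot_delta.
have Dl x y : (y *m 'D_x g q) 0 l = dot (cov q x y) (coord_vec R l *m C q) +
    dot (y *m C q) (cov q x (coord_vec R l)).
  by rewrite -derive_metric_cov// -[LHS]dot_delta.
rewrite mulr2n [LHS]mxE [X in X + _]mxE [X in _ + X]mxE [X in _ - X]mxE [RHS]mxE.
rewrite [X in X + _ - _](Dl u v) [X in _ + X - _](Dl v u) [X in _ - X](derive_metric_cov (coord_vec R l) u v Mq) !(eC (cov q u v)) (nC v u) (nC (coord_vec R l) u) (nC (coord_vec R l) v).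
rewrite (dotC (cov q u (coord_vec R l))); ring.
Qed.

Definition connection_row q (u v : vec) : vec :=
  \row_(k < 4) \sum_(i < 4) \sum_(j < 4) u 0 i * v 0 j * christoffel g k i j q.

Lemma connection_rowE q u v : M q -> connection_row q u v *m C q = cov q u v.
Proof.
move=> Mq.
have dg : differentiable g q.
  have <- : (fun q => C q *m (C q)^T) = g by apply/funext => p; rewrite gE.
  by apply: differentiable_mulmx; [exact: dC|have [] := derive_trmx 0 (dC Mq)].
have uC := Cunit Mq.
have gT : (g q)^T = g q by rewrite gE trmx_mul trmxK.
have gu : g q \in unitmx by rewrite gE unitmx_mul uC unitmx_tr.
pose d i j l := 'D_(coord_vec R i) g q j l.
have coordE i j l : 'D_(coord_vec R i) (fun p => g p j l) q = d i j l.
  by rewrite /d derive_entry.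
have dirE (x : vec) j l : 'D_x g q j l = \sum_i x 0 i * d i j l.
  rewrite {1}[x]row_sum_delta derive_dir_sum// summxE.
  by apply: eq_bigr => i _; rewrite derive_dirZ// mxE.
pose X i j l := d i j l + d j i l - d l i j.
have rowE k : connection_row q u v 0 k =
    2^-1 * \sum_l (\sum_i \sum_j u 0 i * v 0 j * X i j l) * invmx (g q) l k.
  rewrite mxE mulr_sumr.
  transitivity (\sum_i \sum_j \sum_l 2^-1 * (u 0 i * v 0 j * X i j l * invmx (g q) l k)).
    apply: eq_bigr => i _; apply: eq_bigr => j _.
    rewrite /christoffel mulrCA !mulr_sumr; apply: eq_bigr => l _.
    rewrite !coordE -/(X i j l).
    have -> : invmx (g q) k l = invmx (g q) l k by rewrite -{1}gT -trmx_inv mxE.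
    by rewrite -[in RHS]mulrA [X i j l * _]mulrC.
  under eq_bigr do rewrite exchange_big; rewrite exchange_big /=.
  apply: eq_bigr => l _; rewrite mulr_suml mulr_sumr; apply: eq_bigr => i _.
  by rewrite mulr_suml mulr_sumr.
have key : connection_row q u v *+ 2 = (v *m 'D_u g q + u *m 'D_v g q -
    \row_l (u *m 'D_(coord_vec R l) g q *m v^T) 0 0) *m invmx (g q).
  apply/rowP => k; rewrite mulr2n mxE rowE -mulrDl -[2^-1 in X in X * _]mul1r -splitr mul1r [RHS]mxE.
  apply: eq_bigr => l _; congr (_ * _).
  rewrite [RHS]mxE [X in _ = X + _]mxE [X in _ = _ + X]mxE [X in _ = _ - X]mxE.
  rewrite [X in _ = X + _ - _](row_mul_sum v l (dirE u)) [X in _ = _ + X - _](row_mul_sum u l (dirE v)).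
  have E3 : (u *m 'D_(coord_vec R l) g q *m v^T) 0 0 = \sum_i \sum_j u 0 i * v 0 j * d l i j.
    rewrite mxE exchange_big /=; apply: eq_bigr => j _; rewrite mxE mulr_suml.
    by apply: eq_bigr => i _; rewrite [v^T _ _]mxE mulrAC.
  rewrite [X in _ = _ - X]E3 [X in _ = X + _ - _]exchange_big /=.
  rewrite -big_split -sumrB /=; apply: eq_bigr => i _.
  rewrite -big_split -sumrB /=; apply: eq_bigr => j _.
  by rewrite [v 0 j * u 0 i]mulrC -mulrDr -mulrBr.
have : (connection_row q u v *+ 2) *m C q = cov q u v *+ 2.
  rewrite key koszul//; move: (cov q u v) => c; rewrite !mulr2n !mulmxDl.
  by congr (_ + _); rewrite gE; exact: mulmx_gram_cancel.
rewrite !mulr2n mulmxDl => E; apply/rowP => k; move/rowP/(_ k): E.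
rewrite [LHS]mxE [RHS]mxE; move: ((_ *m C q) 0 k) (cov q u v 0 k) => x y E.
by lra.
Qed.

Lemma nablaE (X Y : vec -> vec) q : M q -> differentiable Y q ->
  nabla g X Y q *m C q = 'D_(X q) (fun p => Y p *m C p) q + Y q *m C q *m A q (X q).
Proof.
move=> Mq dY; rewrite /nabla -/(connection_row q (X q) (Y q)) mulmxDl connection_rowE//.
by rewrite derive_mulmx//; [rewrite addrA|exact: dC].
Qed.

Lemma nabla0 (X Y : vec -> vec) q : X q = 0 -> nabla g X Y q = 0.
Proof.
move=> X0; rewrite /nabla X0 derive0 add0r; apply/rowP => k; rewrite !mxE.
by rewrite big1 // => i _; rewrite big1 // => j _; rewrite mxE !mul0r.
Qed.

Lemma lie_bracket_cst u v q : lie_bracket (fun=> u) (fun=> v) q = 0 :> vec.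
Proof. by rewrite /lie_bracket !derive_const subrr. Qed.

Lemma nabla_cst_rowE v w q : M q -> nabla g (fun=> v) (fun=> w) q = cov q v w *m invmx (C q).
Proof.
move=> Mq; apply: (can_inj (mulmxK (Cunit Mq))).
rewrite nablaE// mulmxKV ?Cunit//; congr (_ + _).
by rewrite derive_mulmx//; [rewrite derive_const mul0mx add0r|exact: dC].
Qed.

Lemma cov_smooth k v w : Ck k M (fun q => cov q v w).
Proof.
have [_ DC] := Csmooth k.+1.
have Cw : Ck k M (fun _ : vec => w) by exact: Ck_cst.
apply: Ck_add; first exact: oM.
  by apply: Ck_mulmx; [exact: oM|exact: Cw|exact: DC].
apply: Ck_mulmx; [exact: oM| |exact: Asmooth].
by apply: Ck_mulmx; [exact: oM|exact: Cw|exact: Csmooth].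
Qed.

(** The products come in the order opposite to the usual one because connection matrices act on rows
    from the right: differentiating along v and then along u multiplies by [A q v] first. *)
Definition curvature_form q u v : 'M[R]_4 :=
  'D_u (A ^~ v) q - 'D_v (A ^~ u) q + (A q v *m A q u - A q u *m A q v).

(** The last bracket collects the terms symmetric in u and v, which disappear from the commutator;
    the second derivative of [C] does so too, by Schwarz's theorem. *)
Lemma nabla_nabla_cst u v w q : M q ->
  nabla g (fun=> u) (nabla g (fun=> v) (fun=> w)) q *m C q =
  w *m 'D_u ('D_v C) q + w *m C q *m 'D_u (A ^~ v) q + w *m C q *m A q v *m A q u +
  (w *m 'D_u C q *m A q v + w *m 'D_v C q *m A q u).
Proof.
move=> Mq.
have [_ DC] := Csmooth 2; have [dDC _] := DC v.
have [dA _] := Asmooth 1 v.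
have [dcov _] := cov_smooth 1 v w.
have [dinv _] := Ck_invmx oM Cunit (Csmooth 1).
have dwC : differentiable (fun p => w *m C p) q by apply: differentiable_mulmx => //; exact: dC.
have dY : differentiable (nabla g (fun=> v) (fun=> w)) q.
  apply: (@near_eq_differentiable _ _ _ (fun p => cov p v w *m invmx (C p))).
    by apply: (@near_open _ _ M) => // p Mp; rewrite nabla_cst_rowE.
  by apply: differentiable_mulmx; [exact: dcov|exact: dinv].
rewrite nablaE//.
have -> : 'D_u (fun p => nabla g (fun=> v) (fun=> w) p *m C p) q = 'D_u (fun p => cov p v w) q.
  apply: near_eq_derive; apply: (@near_open _ _ M) => // p Mp.
  by rewrite nabla_cst_rowE// mulmxKV// Cunit.
rewrite nabla_cst_rowE// mulmxKV ?Cunit//.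
have E1 : 'D_u (fun p => w *m 'D_v C p) q = w *m 'D_u ('D_v C) q.
  by rewrite derive_mulmx//; [rewrite derive_const mul0mx add0r|exact: dDC].
have E2 : 'D_u (fun p => w *m C p *m A p v) q =
    w *m 'D_u C q *m A q v + w *m C q *m 'D_u (A ^~ v) q.
  rewrite derive_mulmx//; last exact: dA.
  by rewrite derive_mulmx//; [rewrite derive_const mul0mx add0r|exact: dC].
have -> : 'D_u (fun p => cov p v w) q = 'D_u (fun p => w *m 'D_v C p) q + 'D_u (fun p => w *m C p *m A p v) q.
  apply: (@deriveD _ _ _ (fun p => w *m 'D_v C p) (fun p => w *m C p *m A p v)); apply: diff_derivable.
    by apply: differentiable_mulmx => //; exact: dDC.
  by apply: differentiable_mulmx => //; exact: dA.
rewrite E1 E2 /cov mulmxDl.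
exact: addr_regroup.
Qed.

Lemma derive_coframe_sym u v q : M q -> 'D_u ('D_v C) q = 'D_v ('D_u C) q.
Proof.
move=> Mq; apply/matrixP => i j.
have E x y := @derive2_entry R vec 4 4 M C x y i j q oM (Csmooth 2) Mq.
apply: etrans (E u v) _; apply: etrans _ (esym (E v u)).
exact: (@schwarz R vec M (fun p => C p i j) q v u oM (Ck_entry i j oM (Csmooth 2)) Mq).
Qed.

Lemma curvature_cst u v w q : M q ->
  curvature g (fun=> u) (fun=> v) (fun=> w) q *m C q = w *m C q *m curvature_form q u v.
Proof.
move=> Mq; rewrite /curvature [X in _ - X]nabla0; last exact: lie_bracket_cst.
rewrite subr0 mulmxBl !nabla_nabla_cst// (derive_coframe_sym u v Mq) /curvature_form.
rewrite mulmxDr !mulmxBr !mulmxA; exact: subr_regroup.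
Qed.

Lemma RmE q u v w x : M q -> Rm g q u v w x = dot (w *m C q *m curvature_form q u v) (x *m C q).
Proof. by move=> Mq; rewrite /Rm bilE curvature_cst. Qed.

Section DualFrame.
Variable E : 'I_4 -> vec -> vec.
Hypothesis Edual : forall q i, M q -> E i q *m C q = delta_mx 0 i.

Lemma GammaE k i j q : M q -> Gamma g E k i j q = A q (E i q) j k.
Proof.
move=> Mq; rewrite /Gamma bilE Edual// dot_delta.
have [dinv _] := Ck_invmx oM Cunit (Csmooth 1).
have dE : differentiable (E j) q.
  apply: (@near_eq_differentiable _ _ _ (fun p => delta_mx 0 j *m invmx (C p))).
    by apply: (@near_open _ _ M) => // p Mp; rewrite -(Edual j Mp) mulmxK ?Cunit.
  by apply: differentiable_mulmx => //; exact: dinv.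
rewrite nablaE// Edual// -rowE.
have -> : 'D_(E i q) (fun p => E j p *m C p) q = 'D_(E i q) (cst (delta_mx 0 j : vec)) q.
  by apply: near_eq_derive; apply: (@near_open _ _ M) => // p Mp; rewrite Edual.
by rewrite derive_cst add0r mxE.
Qed.

End DualFrame.

End Cartan.

(** * The Toda metric *)

Section DerivativeRules.
Variable R : realType.
Notation vec := 'rV[R]_4.
Implicit Types (f g : vec -> R) (p u : vec).

(** Differentiability travels with the value, so that the tactic [deriv] can compute a derivative by
    recursion on the syntax of the function. *)
Definition has_deriv f p u (d : R) := differentiable f p /\ 'D_u f p = d.

Lemma has_deriv_cst (k : R) p u : has_deriv (fun=> k) p u 0.
Proof. by split; [exact: differentiable_cst|exact: derive_const]. Qed.

Lemma has_deriv_add f g p u df dg : has_deriv f p u df -> has_deriv g p u dg ->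
  has_deriv (fun q => f q + g q) p u (df + dg).
Proof.
move=> [d1 <-] [d2 <-]; split; first exact: (@differentiableD _ _ _ f g).
by apply: (@deriveD _ _ _ f g); exact: diff_derivable.
Qed.

Lemma has_deriv_opp f p u df : has_deriv f p u df -> has_deriv (fun q => - f q) p u (- df).
Proof.
move=> [d1 <-]; split; first exact: (@differentiableN _ _ _ f).
by apply: (@deriveN _ _ _ f); exact: diff_derivable.
Qed.

Lemma has_deriv_mul f g p u df dg : has_deriv f p u df -> has_deriv g p u dg ->
  has_deriv (fun q => f q * g q) p u (df * g p + f p * dg).
Proof.
move=> [d1 <-] [d2 <-]; split; first exact: (@differentiableM _ _ f g).
have -> : 'D_u (fun q => f q * g q) p = f p *: 'D_u g p + g p *: 'D_u f p.
  by apply: (@deriveM _ _ f g); exact: diff_derivable.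
by rewrite addrC; congr (_ + _); exact: mulrC.
Qed.

Lemma has_deriv_comp (f1 : R -> R) f p u df d1 : has_deriv f p u df ->
  is_derive (f p) (1 : R) f1 d1 -> has_deriv (fun q => f1 (f q)) p u (d1 * df).
Proof.
move=> [df1 <-] /is_derive_diff[df2 <-].
split; first exact: (@differentiable_comp _ _ _ _ f f1).
rewrite (@derive_comp _ _ _ _ f f1)// -['D_u f p]mulr1 derive_dirZ// mulr1.
by rewrite [LHS]mulrC.
Qed.

Lemma has_deriv_sin f p u df : has_deriv f p u df ->
  has_deriv (fun q => sin (f q)) p u (cos (f p) * df).
Proof. by move=> /has_deriv_comp; apply; exact: is_derive_sin. Qed.

Lemma has_deriv_cos f p u df : has_deriv f p u df ->
  has_deriv (fun q => cos (f q)) p u (- sin (f p) * df).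
Proof. by move=> /has_deriv_comp; apply; exact: is_derive_cos. Qed.

Lemma has_deriv_coord i p u : has_deriv (fun q : vec => q 0 i) p u (u 0 i).
Proof.
have di : differentiable (fun q : vec => q : vec) p by exact: ex_diff.
split; first exact: (differentiable_entry 0 i di).
by rewrite -(derive_entry u 0 i di) (derive_id p u).
Qed.

Lemma has_deriv_z p u : has_deriv (@zc R) p u (u 0 o3).
Proof. exact: has_deriv_coord. Qed.

Lemma has_deriv_t p u : has_deriv (@tc R) p u (u 0 o4).
Proof. exact: has_deriv_coord. Qed.

Lemma xyE p : (xy p) 0 0 = p 0 o1 /\ (xy p) 0 1 = p 0 o2.
Proof. by rewrite /xy !mxE; split; congr (p _ _); apply: val_inj. Qed.

Lemma ord2_ind (P : 'I_2 -> Prop) : P 0 -> P 1 -> forall i, P i.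
Proof.
move=> P0 P1 [[|[|//]] i]; first by have <- : 0 = Ordinal i by apply: val_inj.
by have <- : 1 = Ordinal i by apply: val_inj.
Qed.

Lemma differentiable_xy p : differentiable (@xy R) p.
Proof.
apply: differentiable_mx => i; rewrite (ord1 i); apply: ord2_ind.
  by rewrite (_ : (fun q => _) = fun q : vec => q 0 o1); [have [] := has_deriv_coord o1 p 0|apply/funext => q; have [] := xyE q].
by rewrite (_ : (fun q => _) = fun q : vec => q 0 o2); [have [] := has_deriv_coord o2 p 0|apply/funext => q; have [] := xyE q].
Qed.

Lemma has_deriv_xy (f : 'rV[R]_2 -> R) p u : differentiable f (xy p) ->
  has_deriv (fun q => f (xy q)) p u
    (u 0 o1 * 'D_(ux R) f (xy p) + u 0 o2 * 'D_(uy R) f (xy p)).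
Proof.
move=> df; split; first exact: (differentiable_comp (differentiable_xy p) df).
rewrite (@derive_comp_rV _ _ _ (@xy R) f)//; last exact: differentiable_xy.
rewrite big_ord_recl big_ord1.
have -> : (fun q : vec => xy q 0 ord0) = (fun q => q 0 o1) by apply/funext => q; have [] := xyE q.
have -> : (fun q : vec => xy q 0 (lift ord0 ord0)) = (fun q => q 0 o2).
  by apply/funext => q; have [_ <-] := xyE q; congr (xy q _ _); apply: val_inj.
have [_ ->] := has_deriv_coord o1 p u; have [_ ->] := has_deriv_coord o2 p u.
by congr (_ + _ * 'D_(delta_mx _ _) f _); apply: val_inj.
Qed.

Lemma has_deriv_eq f p u d d' : has_deriv f p u d -> d = d' -> has_deriv f p u d'.
Proof. by move=> ? <-. Qed.

Lemma sum4 (V : zmodType) (F : 'I_4 -> V) : \sum_(i < 4) F i = F o1 + F o2 + F o3 + F o4.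
Proof.
rewrite !big_ord_recl big_ord0 addr0 -!addrA.
by congr (F _ + (F _ + (F _ + F _))); apply: val_inj.
Qed.

Lemma ord4_ind (P : 'I_4 -> Prop) : P o1 -> P o2 -> P o3 -> P o4 -> forall i, P i.
Proof.
move=> P1 P2 P3 P4 [[|[|[|[|//]]]] i].
- by have <- : o1 = Ordinal i by apply: val_inj.
- by have <- : o2 = Ordinal i by apply: val_inj.
- by have <- : o3 = Ordinal i by apply: val_inj.
- by have <- : o4 = Ordinal i by apply: val_inj.
Qed.

End DerivativeRules.

Ltac deriv :=
  lazymatch goal with
  | |- has_deriv (fun _ => ?k) _ _ _ => exact (has_deriv_cst _ _ _)
  | |- has_deriv (fun q => zc q) _ _ _ => exact (has_deriv_z _ _)
  | |- has_deriv (fun q => tc q) _ _ _ => exact (has_deriv_t _ _)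
  | |- has_deriv (fun q => @?f q + @?g q) _ _ _ => refine (@has_deriv_add _ f g _ _ _ _ _ _); deriv
  | |- has_deriv (fun q => - (@?f q)) _ _ _ => refine (@has_deriv_opp _ f _ _ _ _); deriv
  | |- has_deriv (fun q => @?f q * @?g q) _ _ _ => refine (@has_deriv_mul _ f g _ _ _ _ _ _); deriv
  | |- has_deriv (fun q => sin (@?f q)) _ _ _ => refine (@has_deriv_sin _ f _ _ _ _); deriv
  | |- has_deriv (fun q => cos (@?f q)) _ _ _ => refine (@has_deriv_cos _ f _ _ _ _); deriv
  | D : has_deriv ?f _ _ _ |- has_deriv ?f _ _ _ => exact D
  end.

Lemma toda_rearrange (F : fieldType) (a X Y h H : F) : a != 0 -> (2 : F) != 0 ->
  X + Y = 2 * a ^+ 2 * h ^+ 2 - 4 * a ^+ 2 * H ^+ 2 ->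
  (2 * a)^-1 * X = - (2 * a)^-1 * Y + a * h ^+ 2 - 2 * a * H ^+ 2.
Proof.
move=> a0 n2 E; have -> : X = 2 * a ^+ 2 * h ^+ 2 - 4 * a ^+ 2 * H ^+ 2 - Y.
  by rewrite -E addrK.
by field; rewrite a0.
Qed.

Lemma antisym_rearrange (F : comNzRingType) (a h H X1 Y1 X2 Y2 u1 u2 v1 v2 : F) :
  X2 = Y1 + a * h ^+ 2 - 2 * a * H ^+ 2 ->
  (- (u1 * X1 + u2 * Y1) * v1 - (u1 * X2 + u2 * Y2) * v2) -
  (- (v1 * X1 + v2 * Y1) * u1 - (v1 * X2 + v2 * Y2) * u2) =
  (2 * a * H ^+ 2 - a * h ^+ 2) * (u1 * v2 - u2 * v1).
Proof. by move=> ->; ring. Qed.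

Lemma antisym_laplacian (F : comNzRingType) (X1 Y1 X2 Y2 u1 u2 v1 v2 : F) :
  (- (u1 * X1 + u2 * Y1) * v1 + (u1 * X2 + u2 * Y2) * v2) -
  (- (v1 * X1 + v2 * Y1) * u1 + (v1 * X2 + v2 * Y2) * u2) =
  (X2 + Y1) * (u1 * v2 - u2 * v1).
Proof. by ring. Qed.

Lemma addB_subB_entry (Z : zmodType) m n (X Y P Q : 'M[Z]_(m, n)) i j :
  ((X - Y) + (P - Q)) i j = X i j - Y i j + (P i j - Q i j).
Proof. by rewrite !mxE. Qed.

Section SmoothRules.
Variables (R : realType) (M : set 'rV[R]_4).
Hypothesis oM : open M.
Notation vec := 'rV[R]_4.

Lemma Ck_sin_comp k (f : vec -> R) : Ck k M f -> Ck k M (fun p => sin (f p)).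
Proof.
by move=> Cf; have [Cs _] := Ck_sin_cos R k; exact: (@Ck_comp_real R vec k M setT f sin).
Qed.

Lemma Ck_cos_comp k (f : vec -> R) : Ck k M f -> Ck k M (fun p => cos (f p)).
Proof.
by move=> Cf; have [_ Cc] := Ck_sin_cos R k; exact: (@Ck_comp_real R vec k M setT f cos).
Qed.

Lemma Ck_coord k i : Ck k M (fun p : vec => p 0 i).
Proof. by apply: Ck_entry => //; exact: Ck_id. Qed.

Lemma Ck_xy k (U : set 'rV[R]_2) (f : 'rV[R]_2 -> R) : (forall p, M p -> U (xy p)) ->
  Ck k U f -> Ck k M (fun p => f (xy p)).
Proof.
move=> MU Cf; apply: (@Ck_comp_rV R vec k 2 M U (@xy R) f) => //.
apply: Ck_mx => // i; rewrite (ord1 i); apply: ord2_ind.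
  by apply: Ck_ext (Ck_coord k o1) => // p _; have [-> _] := xyE p.
by apply: Ck_ext (Ck_coord k o2) => // p _; have [_ ->] := xyE p.
Qed.

End SmoothRules.

Ltac smooth_tac :=
  lazymatch goal with
  | |- Ck _ _ (fun _ => ?k) => apply: Ck_cst
  | |- Ck _ _ (fun q => zc q) => apply: Ck_coord; eassumption
  | |- Ck _ _ (fun q => tc q) => apply: Ck_coord; eassumption
  | |- Ck _ _ (fun q => @?f q + @?g q) => refine (@Ck_add _ _ _ _ _ f g _ _ _); [eassumption|smooth_tac|smooth_tac]
  | |- Ck _ _ (fun q => - (@?f q)) => refine (@Ck_opp _ _ _ _ _ f _ _); [eassumption|smooth_tac]
  | |- Ck _ _ (fun q => @?f q * @?g q) => refine (@Ck_mul _ _ _ _ f g _ _ _); [eassumption|smooth_tac|smooth_tac]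
  | |- Ck _ _ (fun q => sin (@?f q)) => refine (@Ck_sin_comp _ _ _ _ f _); [eassumption|smooth_tac]
  | |- Ck _ _ (fun q => cos (@?f q)) => refine (@Ck_cos_comp _ _ _ _ f _); [eassumption|smooth_tac]
  | D : Ck _ _ ?f |- Ck _ _ ?f => exact D
  end.

(** * Coframe, connection forms and curvature form of the metric *)

Section TodaMetric.
Variables (R : realType) (a : R) (U : set 'rV[R]_2) (h H : 'rV[R]_2 -> R).
Hypothesis a0 : a != 0.
Hypothesis oU : open U.
Hypothesis hsmooth : smooth U h.
Hypothesis Hsmooth : smooth U H.
Hypothesis hpos : forall q, U q -> 0 < h q.
Hypothesis Hpos : forall q, U q -> 0 < H q.
Hypothesis toda : forall q, U q ->
  laplacian (@ln R \o H) q = 2 * a ^+ 2 * h q ^+ 2 - 4 * a ^+ 2 * H q ^+ 2.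
Notation vec := 'rV[R]_4.
Notation M := (domM a U).

Definition mx : 'rV[R]_2 -> R := 'D_(ux R) (@ln R \o h).
Definition my : 'rV[R]_2 -> R := 'D_(uy R) (@ln R \o h).

Lemma smooth_ln (f : 'rV[R]_2 -> R) k : smooth U f -> (forall q, U q -> 0 < f q) ->
  Ck k U (@ln R \o f).
Proof. by move=> fs fp; apply: (Ck_comp_real oU fp (fs k)); exact: Ck_ln. Qed.

Lemma derive_ln (f : 'rV[R]_2 -> R) q v : smooth U f -> (forall q, U q -> 0 < f q) -> U q ->
  'D_v f q = f q * 'D_v (@ln R \o f) q.
Proof.
move=> fs fp Uq; have [df _] := fs 1%N; have dl := is_derive_diff (is_derive1_ln (fp q Uq)).
rewrite [X in _ = _ * X]derive_comp; [|exact: df|by case: dl].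
rewrite -['D_v f q in RHS]mulr1 derive_dirZ; last by case: dl.
by case: dl => _ ->; rewrite mulrCA mulfV ?mulr1// gt_eqF// fp.
Qed.

Lemma diff_h q : U q -> differentiable h q.
Proof. by move=> Uq; have [d _] := hsmooth 1; exact: d. Qed.
Lemma diff_H q : U q -> differentiable H q.
Proof. by move=> Uq; have [d _] := Hsmooth 1; exact: d. Qed.

Lemma smooth_mx k : Ck k U mx.
Proof. by have [_ D] := smooth_ln k.+1 hsmooth hpos; exact: D. Qed.
Lemma smooth_my k : Ck k U my.
Proof. by have [_ D] := smooth_ln k.+1 hsmooth hpos; exact: D. Qed.
Lemma smooth_l2 k : Ck k U (l2 a H).
Proof.
have [_ D] := smooth_ln k.+1 Hsmooth Hpos.
by apply: Ck_mul; [exact: oU|exact: Ck_cst|exact: D].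
Qed.
Lemma smooth_n2 k : Ck k U (n2 a H).
Proof.
have [_ D] := smooth_ln k.+1 Hsmooth Hpos.
by apply: Ck_mul; [exact: oU|exact: Ck_cst|exact: D].
Qed.

Lemma diff_of_Ck (f : 'rV[R]_2 -> R) q : (forall k, Ck k U f) -> U q -> differentiable f q.
Proof. by move=> s Uq; have [d _] := s 1%N; exact: d. Qed.

Lemma derive_H q : U q ->
  'D_(ux R) H q = 2 * a * H q * n2 a H q /\ 'D_(uy R) H q = - (2 * a * H q * l2 a H q).
Proof.
move=> Uq; rewrite !(derive_ln _ Hsmooth Hpos Uq) /n2 /l2; split; by field.
Qed.

Lemma derive_h q : U q ->
  'D_(ux R) h q = h q * mx q /\ 'D_(uy R) h q = h q * my q.
Proof. by move=> Uq; rewrite !(derive_ln _ hsmooth hpos Uq). Qed.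

(** This is the equation for the Laplacian of ln H in first-order form, with [l2] and [n2] as
    rescaled derivatives of ln H. The structure equations use it only in this shape. *)
Lemma derive_n2_l2 q : U q ->
  'D_(ux R) (n2 a H) q = 'D_(uy R) (l2 a H) q + a * h q ^+ 2 - 2 * a * H q ^+ 2.
Proof.
move=> Uq; have [_ D] := smooth_ln 2 Hsmooth Hpos.
have E v k : 'D_v (fun q => k * 'D_v (@ln R \o H) q) q = k * 'D_v ('D_v (@ln R \o H)) q.
  have [d _] := D v.
  by apply: (@deriveZ _ _ _ ('D_v (@ln R \o H)) k); apply: diff_derivable; exact: d.
have Ex := E (ux R) (2 * a)^-1; have Ey := E (uy R) (- (2 * a)^-1).
apply: (etrans Ex); apply: (etrans (toda_rearrange a0 (lt0r_neq0 (ltr0n _ 2)) (toda Uq))).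
by congr (_ + _ - _); exact: esym Ey.
Qed.

(** The form dt - l2 dx - n2 dy. Together with [bet] and [gam], which are H dx and H dy rotated
    through the angle 2 a t, it gives theta3 and theta4; the derivatives of [bet] and [gam] are
    again combinations of these two, which keeps all later computations polynomial. *)
Definition tau (q u : vec) : R :=
  u 0 o4 - l2 a H (xy q) * u 0 o1 - n2 a H (xy q) * u 0 o2.
Definition bet (q u : vec) : R :=
  H (xy q) * (cos (2 * a * tc q) * u 0 o1 - sin (2 * a * tc q) * u 0 o2).
Definition gam (q u : vec) : R :=
  H (xy q) * (sin (2 * a * tc q) * u 0 o1 + cos (2 * a * tc q) * u 0 o2).
Definition th1 (q u : vec) : R := cos (a * zc q) * h (xy q) * u 0 o1.
Definition th2 (q u : vec) : R := cos (a * zc q) * h (xy q) * u 0 o2.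
Definition th3 (q u : vec) : R :=
  sin (2 * a * zc q) * tau q u - cos (2 * a * zc q) * bet q u.
Definition th4 (q u : vec) : R := u 0 o3 - gam q u.
(** The connection forms solve the first structure equation. Here [mu] is a tan(az) theta1 and [nu]
    is - a tan(az) theta2, while [sig] is the z-derivative of theta3 and [rho] is sig / 2 - a tau
    plus the connection form of the plane metric h^2 (dx^2 + dy^2). *)
Definition mu (q u : vec) : R := a * sin (a * zc q) * h (xy q) * u 0 o1.
Definition nu (q u : vec) : R := - (a * sin (a * zc q) * h (xy q) * u 0 o2).
Definition sig (q u : vec) : R :=
  2 * a * (cos (2 * a * zc q) * tau q u + sin (2 * a * zc q) * bet q u).
Definition rho (q u : vec) : R :=
  - (a * tau q u) + a * (cos (2 * a * zc q) * tau q u + sin (2 * a * zc q) * bet q u)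
  - my (xy q) * u 0 o1 + mx (xy q) * u 0 o2.

Definition cofr (q : vec) : 'M[R]_4 := \matrix_(i, j) theta a h H j q 0 i.
(* conn q u k l is g(nabla_u E_k, E_l). *)
Definition conn (q u : vec) : 'M[R]_4 := \matrix_(k, l)
  nth 0 (nth [::] [:: [:: 0; rho q u; nu q u; mu q u];
                      [:: - rho q u; 0; mu q u; - nu q u];
                      [:: - nu q u; - mu q u; 0; - sig q u];
                      [:: - mu q u; nu q u; sig q u; 0]] k) l.

Lemma cofrE q u : [/\ (u *m cofr q) 0 o1 = th1 q u, (u *m cofr q) 0 o2 = th2 q u,
  (u *m cofr q) 0 o3 = th3 q u & (u *m cofr q) 0 o4 = th4 q u].
Proof.
split; rewrite mxE sum4 !mxE /= /theta1 /theta2 /theta3 /theta4 ?mxE /=.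
- by rewrite /th1; ring.
- by rewrite /th2; ring.
- by rewrite /th3 /tau /bet; ring.
- by rewrite /th4 /gam; ring.
Qed.

Opaque l2 n2 mx my.

(** Ring identities modulo the Pythagorean relations for the angles a z and 2 a t; the angle 2 a z
    is first eliminated by [trig_double]. *)
Ltac ring_trig := intros; lazymatch goal with
  | cs : @eq _ (@GRing.exp _ _ _) _, ct : @eq _ (@GRing.exp _ _ _) _ |- _ => ring: cs ct
  end.

Lemma trig_double q : sin (2 * a * zc q) = 2 * sin (a * zc q) * cos (a * zc q) /\
  cos (2 * a * zc q) = 1 - 2 * sin (a * zc q) ^+ 2.
Proof.
have -> : 2 * a * zc q = (a * zc q) *+ 2 by rewrite mulr2n; ring.
rewrite sin_mulr2n cos_mulr2n; have := cos2Dsin2 (a * zc q) => E; split; first by rewrite mulr2n; ring.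
by rewrite -(addrK (sin (a * zc q) ^+ 2) (cos (a * zc q) ^+ 2)) E mulr2n; ring.
Qed.

Ltac abstract_at q :=
  move: (h (xy q)) (H (xy q)) (l2 a H (xy q)) (n2 a H (xy q)) (mx (xy q)) (my (xy q))
    (cos (a * zc q)) (sin (a * zc q)) (cos (2 * a * zc q)) (sin (2 * a * zc q))
    (cos (2 * a * tc q)) (sin (2 * a * tc q)) (tau q).

Lemma deriv_tau_gen q u v dl dn : has_deriv (fun p => l2 a H (xy p)) q u dl ->
  has_deriv (fun p => n2 a H (xy p)) q u dn ->
  has_deriv (fun p => tau p v) q u (- dl * v 0 o1 - dn * v 0 o2).
Proof.
move=> Dl Dn; rewrite /tau; apply: has_deriv_eq; first by deriv.
by rewrite /=; abstract_at q => *; ring.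
Qed.

Lemma deriv_tau q u v : U (xy q) -> has_deriv (fun p => tau p v) q u
  (- (u 0 o1 * 'D_(ux R) (l2 a H) (xy q) + u 0 o2 * 'D_(uy R) (l2 a H) (xy q)) * v 0 o1
   - (u 0 o1 * 'D_(ux R) (n2 a H) (xy q) + u 0 o2 * 'D_(uy R) (n2 a H) (xy q)) * v 0 o2).
Proof.
move=> Uq; apply: deriv_tau_gen; apply: has_deriv_xy; apply: diff_of_Ck Uq => k.
  exact: smooth_l2.
exact: smooth_n2.
Qed.

Lemma deriv_H q u : U (xy q) -> has_deriv (fun p => H (xy p)) q u
  (2 * a * H (xy q) * (n2 a H (xy q) * u 0 o1 - l2 a H (xy q) * u 0 o2)).
Proof.
move=> Uq; apply: has_deriv_eq; first exact: has_deriv_xy u (diff_H Uq).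
have [-> ->] := derive_H Uq.
by move: (H (xy q)) (l2 a H (xy q)) (n2 a H (xy q)) => x y z; ring.
Qed.

Lemma deriv_h q u : U (xy q) -> has_deriv (fun p => h (xy p)) q u
  (h (xy q) * (mx (xy q) * u 0 o1 + my (xy q) * u 0 o2)).
Proof.
move=> Uq; apply: has_deriv_eq; first exact: has_deriv_xy u (diff_h Uq).
have [-> ->] := derive_h Uq.
by move: (h (xy q)) (mx (xy q)) (my (xy q)) => x y z; ring.
Qed.

Lemma deriv_bet q u v : U (xy q) -> has_deriv (fun p => bet p v) q u
  (2 * a * (n2 a H (xy q) * u 0 o1 - l2 a H (xy q) * u 0 o2) * bet q v
   - 2 * a * u 0 o4 * gam q v).
Proof.
move=> Uq; have dH := deriv_H u Uq; rewrite /bet /gam.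
apply: has_deriv_eq; first by deriv.
by rewrite /=; abstract_at q => *; ring.
Qed.

Lemma deriv_gam q u v : U (xy q) -> has_deriv (fun p => gam p v) q u
  (2 * a * (n2 a H (xy q) * u 0 o1 - l2 a H (xy q) * u 0 o2) * gam q v
   + 2 * a * u 0 o4 * bet q v).
Proof.
move=> Uq; have dH := deriv_H u Uq; rewrite /bet /gam.
apply: has_deriv_eq; first by deriv.
by rewrite /=; abstract_at q => *; ring.
Qed.

Lemma deriv_row n q u (v : 'rV[R]_n) (B : vec -> 'M[R]_(n, 4)) j d : differentiable B q ->
  has_deriv (fun p => (v *m B p) 0 j) q u d -> (v *m 'D_u B q) 0 j = d.
Proof.
move=> dB [_ <-].
have dvB : differentiable (fun p => v *m B p) q.
  by apply: differentiable_mulmx => //; exact: differentiable_cst.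
rewrite -(derive_entry u 0 j dvB) (derive_mulmx u (differentiable_cst v q) dB).
by rewrite derive_const mul0mx add0r.
Qed.

Lemma deriv_th1 q u v : U (xy q) -> has_deriv (fun p => th1 p v) q u
  (h (xy q) * (- (a * sin (a * zc q) * u 0 o3) +
     cos (a * zc q) * (mx (xy q) * u 0 o1 + my (xy q) * u 0 o2)) * v 0 o1).
Proof.
move=> Uq; have dh := deriv_h u Uq; rewrite /th1.
apply: has_deriv_eq; first by deriv.
by rewrite /=; abstract_at q => *; ring.
Qed.

Lemma deriv_th2 q u v : U (xy q) -> has_deriv (fun p => th2 p v) q u
  (h (xy q) * (- (a * sin (a * zc q) * u 0 o3) +
     cos (a * zc q) * (mx (xy q) * u 0 o1 + my (xy q) * u 0 o2)) * v 0 o2).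
Proof.
move=> Uq; have dh := deriv_h u Uq; rewrite /th2.
apply: has_deriv_eq; first by deriv.
by rewrite /=; abstract_at q => *; ring.
Qed.

Lemma deriv_th3 q u v dt db : has_deriv (fun p => tau p v) q u dt ->
  has_deriv (fun p => bet p v) q u db -> has_deriv (fun p => th3 p v) q u
  (2 * a * u 0 o3 * (cos (2 * a * zc q) * tau q v + sin (2 * a * zc q) * bet q v) +
   sin (2 * a * zc q) * dt - cos (2 * a * zc q) * db).
Proof.
move=> Dt Db; rewrite /th3; apply: has_deriv_eq; first by deriv.
by rewrite /=; move: (bet q v); abstract_at q => *; ring.
Qed.

Lemma deriv_th4 q u v dg : has_deriv (fun p => gam p v) q u dg ->
  has_deriv (fun p => th4 p v) q u (- dg).
Proof.
move=> Dg; rewrite /th4; apply: has_deriv_eq; first by deriv.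
by rewrite sub0r.
Qed.

Lemma deriv_sig q u v dt db : has_deriv (fun p => tau p v) q u dt ->
  has_deriv (fun p => bet p v) q u db -> has_deriv (fun p => sig p v) q u
  (2 * a * (- 2 * a * u 0 o3 * th3 q v +
   cos (2 * a * zc q) * dt + sin (2 * a * zc q) * db)).
Proof.
move=> Dt Db; rewrite /sig /th3; apply: has_deriv_eq; first by deriv.
by rewrite /=; move: (bet q v); abstract_at q => *; ring.
Qed.

Lemma conn_row (y : vec) q u :
  [/\ (y *m conn q u) 0 o1 = - (rho q u * y 0 o2 + nu q u * y 0 o3 + mu q u * y 0 o4),
      (y *m conn q u) 0 o2 = rho q u * y 0 o1 - mu q u * y 0 o3 + nu q u * y 0 o4,
      (y *m conn q u) 0 o3 = nu q u * y 0 o1 + mu q u * y 0 o2 + sig q u * y 0 o4 &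
      (y *m conn q u) 0 o4 = mu q u * y 0 o1 - nu q u * y 0 o2 - sig q u * y 0 o3].
Proof.
split; rewrite mxE sum4 ![conn q u _ _]mxE /=;
  move: (rho q u) (mu q u) (nu q u) (sig q u) (y 0 o1) (y 0 o2) (y 0 o3) (y 0 o4) => *; ring.
Qed.

Definition dtau (q u v : vec) : R :=
  - (u 0 o1 * 'D_(ux R) (l2 a H) (xy q) + u 0 o2 * 'D_(uy R) (l2 a H) (xy q)) * v 0 o1
  - (u 0 o1 * 'D_(ux R) (n2 a H) (xy q) + u 0 o2 * 'D_(uy R) (n2 a H) (xy q)) * v 0 o2.

(** The exterior derivative of [tau], a multiple of dx /\ dy: the place where the equation for H
    acts on the structure equations. *)
Lemma dtauB q u v : U (xy q) -> dtau q u v - dtau q v u =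
  (2 * a * H (xy q) ^+ 2 - a * h (xy q) ^+ 2) * (u 0 o1 * v 0 o2 - u 0 o2 * v 0 o1).
Proof.
by move=> Uq; exact: antisym_rearrange (derive_n2_l2 Uq).
Qed.

Lemma cofr_rowE v (j : 'I_4) : (fun p => (v *m cofr p) 0 j) =
  nth (th1^~ v) [:: th1^~ v; th2^~ v; th3^~ v; th4^~ v] j.
Proof.
move: j; apply: ord4_ind => /=; apply/funext => p; have [E1 E2 E3 E4] := cofrE p v; by [].
Qed.

Lemma cofr_entryE i j : (fun p => cofr p i j) =
  (fun p => ((delta_mx 0 i : vec) *m cofr p) 0 j).
Proof. by apply/funext => p; rewrite -rowE [RHS]mxE. Qed.

Lemma diff_cofr q : U (xy q) -> differentiable cofr q.
Proof.
move=> Uq; apply: differentiable_mx => i j; rewrite cofr_entryE cofr_rowE.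
have Dt := deriv_tau 0 (delta_mx 0 i) Uq; have Db := deriv_bet 0 (delta_mx 0 i) Uq.
move: j; apply: ord4_ind => /=.
- by have [] := deriv_th1 0 (delta_mx 0 i) Uq.
- by have [] := deriv_th2 0 (delta_mx 0 i) Uq.
- by have [] := deriv_th3 Dt Db.
- by have [] := deriv_th4 (deriv_gam 0 (delta_mx 0 i) Uq).
Qed.

Lemma derive_cofr q u v (j : 'I_4) d : U (xy q) ->
  has_deriv (nth (th1^~ v) [:: th1^~ v; th2^~ v; th3^~ v; th4^~ v] j) q u d ->
  (v *m 'D_u cofr q) 0 j = d.
Proof. by move=> Uq; rewrite -cofr_rowE => /(deriv_row (diff_cofr Uq)). Qed.

Lemma cofr_torsion q u v : U (xy q) ->
  v *m 'D_u cofr q + v *m cofr q *m conn q u = u *m 'D_v cofr q + u *m cofr q *m conn q v.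
Proof.
move=> Uq; apply/rowP; have [Eu1 Eu2 Eu3 Eu4] := cofrE q u; have [Ev1 Ev2 Ev3 Ev4] := cofrE q v.
have [A1 A2 A3 A4] := conn_row (v *m cofr q) q u.
have [B1 B2 B3 B4] := conn_row (u *m cofr q) q v.
have [S2 C2] := trig_double q.
have cs : cos (a * zc q) ^+ 2 = 1 - sin (a * zc q) ^+ 2 by rewrite cos2sin2.
have ct : cos (2 * a * tc q) ^+ 2 = 1 - sin (2 * a * tc q) ^+ 2.
  by rewrite cos2sin2.
have Dt := dtauB u v Uq.
apply: ord4_ind; rewrite [LHS]mxE [RHS]mxE ?A1 ?A2 ?A3 ?A4 ?B1 ?B2 ?B3 ?B4
  ?Eu1 ?Eu2 ?Eu3 ?Eu4 ?Ev1 ?Ev2 ?Ev3 ?Ev4.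
- rewrite [X in X + _ = _](@derive_cofr q u v o1 _ Uq (deriv_th1 u v Uq)) [X in _ = X + _](@derive_cofr q v u o1 _ Uq (deriv_th1 v u Uq)).
  rewrite /rho /sig /nu /mu /th1 /th2 /th3 /th4 S2 C2 /bet /gam; clear -cs ct.
  by move: (tau q u) (tau q v) cs ct; abstract_at q; ring_trig.
- rewrite [X in X + _ = _](@derive_cofr q u v o2 _ Uq (deriv_th2 u v Uq)) [X in _ = X + _](@derive_cofr q v u o2 _ Uq (deriv_th2 v u Uq)).
  rewrite /rho /sig /nu /mu /th1 /th2 /th3 /th4 S2 C2 /bet /gam; clear -cs ct.
  by move: (tau q u) (tau q v) cs ct; abstract_at q; ring_trig.
- rewrite [X in X + _ = _](@derive_cofr q u v o3 _ Uq (deriv_th3 (deriv_tau u v Uq) (deriv_bet u v Uq))).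
  rewrite [X in _ = X + _](@derive_cofr q v u o3 _ Uq (deriv_th3 (deriv_tau v u Uq) (deriv_bet v u Uq))).
  rewrite -/(dtau q u v) -/(dtau q v u).
  (* The derivatives of [l2] and [n2] are known only through their antisymmetric combination. One of
     the two terms is therefore expressed by the other, which cancels as an indeterminate. *)
  have -> : dtau q u v = dtau q v u + (dtau q u v - dtau q v u) by rewrite addrC subrK.
  rewrite Dt; move: (dtau q v u).
  rewrite /rho /sig /nu /mu /th1 /th2 /th3 /th4 S2 C2 /bet /gam /tau; clear -cs ct.
  by move: cs ct; abstract_at q; ring_trig.
- rewrite [X in X + _ = _](@derive_cofr q u v o4 _ Uq (deriv_th4 (deriv_gam u v Uq))) [X in _ = X + _](@derive_cofr q v u o4 _ Uq (deriv_th4 (deriv_gam v u Uq))).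
  rewrite /rho /sig /nu /mu /th1 /th2 /th3 /th4 S2 C2 /bet /gam /tau; clear -cs ct.
  by move: cs ct; abstract_at q; ring_trig.
Qed.

Definition drho_h (q u v : vec) : R :=
  - (u 0 o1 * 'D_(ux R) my (xy q) + u 0 o2 * 'D_(uy R) my (xy q)) * v 0 o1
  + (u 0 o1 * 'D_(ux R) mx (xy q) + u 0 o2 * 'D_(uy R) mx (xy q)) * v 0 o2.

Lemma deriv_rho_h q u (v : vec) : U (xy q) ->
  has_deriv (fun p => - my (xy p) * v 0 o1 + mx (xy p) * v 0 o2) q u (drho_h q u v).
Proof.
move=> Uq.
have Dx := has_deriv_xy u (diff_of_Ck smooth_mx Uq).
have Dy := has_deriv_xy u (diff_of_Ck smooth_my Uq).
have Cv j := has_deriv_cst (v 0 j) q u.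
apply: has_deriv_eq.
  exact: has_deriv_add (has_deriv_mul (has_deriv_opp Dy) (Cv o1)) (has_deriv_mul Dx (Cv o2)).
by rewrite /drho_h !mulr0 !addr0.
Qed.

(** The exterior derivative of the plane connection form (ln h)_x dy - (ln h)_y dx; it brings the
    Laplacian of ln h into the curvature. *)
Lemma drho_hB q u v : drho_h q u v - drho_h q v u =
  laplacian (@ln R \o h) (xy q) * (u 0 o1 * v 0 o2 - u 0 o2 * v 0 o1).
Proof. exact: antisym_laplacian. Qed.

Lemma deriv_rho q u (v : vec) dt db dr : has_deriv (fun p => tau p v) q u dt ->
  has_deriv (fun p => bet p v) q u db ->
  has_deriv (fun p => - my (xy p) * v 0 o1 + mx (xy p) * v 0 o2) q u dr ->
  has_deriv (fun p => rho p v) q u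
  (- (a * dt) + a * (- 2 * a * u 0 o3 * th3 q v +
   cos (2 * a * zc q) * dt + sin (2 * a * zc q) * db) + dr).
Proof.
move=> Dt Db Dr.
have -> : (fun p => rho p v) = (fun p => (- (a * tau p v) +
    a * (cos (2 * a * zc p) * tau p v + sin (2 * a * zc p) * bet p v)) +
    (- my (xy p) * v 0 o1 + mx (xy p) * v 0 o2)).
  by apply/funext => p; rewrite /rho -addrA mulNr.
rewrite /th3; apply: has_deriv_eq; first by refine (has_deriv_add _ Dr); deriv.
by rewrite /=; move: (bet q v); abstract_at q => *; ring.
Qed.

Lemma deriv_mu q u v : U (xy q) -> has_deriv (fun p => mu p v) q u
  (a * h (xy q) * (a * cos (a * zc q) * u 0 o3 +
     sin (a * zc q) * (mx (xy q) * u 0 o1 + my (xy q) * u 0 o2)) * v 0 o1).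
Proof.
move=> Uq; have dh := deriv_h u Uq; rewrite /mu.
apply: has_deriv_eq; first by deriv.
by rewrite /=; abstract_at q => *; ring.
Qed.

Lemma deriv_nu q u v : U (xy q) -> has_deriv (fun p => nu p v) q u
  (- (a * h (xy q) * (a * cos (a * zc q) * u 0 o3 +
     sin (a * zc q) * (mx (xy q) * u 0 o1 + my (xy q) * u 0 o2)) * v 0 o2)).
Proof.
move=> Uq; have dh := deriv_h u Uq; rewrite /nu.
apply: has_deriv_eq; first by deriv.
by rewrite /=; abstract_at q => *; ring.
Qed.

Lemma conn_entryE v (k l : 'I_4) : (fun p => conn p v k l) = (fun p =>
  nth 0 (nth [::] [:: [:: 0; rho p v; nu p v; mu p v];
                      [:: - rho p v; 0; mu p v; - nu p v];
                      [:: - nu p v; - mu p v; 0; - sig p v];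
                      [:: - mu p v; nu p v; sig p v; 0]] k) l).
Proof. by apply/funext => p; rewrite mxE. Qed.

Lemma diff_conn q v : U (xy q) -> differentiable (conn ^~ v) q.
Proof.
move=> Uq; apply: differentiable_mx => k l; rewrite conn_entryE.
have Dt := deriv_tau 0 v Uq; have Db := deriv_bet 0 v Uq; have Dr := deriv_rho_h 0 v Uq.
have [dr _] := deriv_rho Dt Db Dr; have [dm _] := deriv_mu 0 v Uq.
have [dn _] := deriv_nu 0 v Uq; have [ds _] := deriv_sig Dt Db.
have d0 : differentiable (fun _ : vec => 0 : R) q by exact: differentiable_cst.
have dN (f : vec -> R) : differentiable f q -> differentiable (fun p => - f p) q.
  exact: (@differentiableN _ _ _ f).
by move: k; apply: ord4_ind; move: l; apply: ord4_ind => /=;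
  first [exact d0|exact dr|exact dm|exact dn|exact ds|exact (dN _ dr)|exact (dN _ dm)|exact (dN _ dn)|exact (dN _ ds)].
Qed.

Lemma derive_conn q u v (k l : 'I_4) (f : vec -> R) d : U (xy q) -> (fun p => conn p v k l) = f ->
  has_deriv f q u d -> 'D_u (conn ^~ v) q k l = d.
Proof. by move=> Uq <- [_ <-]; rewrite (derive_entry u k l (diff_conn v Uq)). Qed.

Lemma curvature_entry q u v (k l : 'I_4) duv dvu (f : vec -> vec -> R) : U (xy q) ->
  (forall w, (fun p => conn p w k l) = f^~ w) ->
  has_deriv (f^~ v) q u duv -> has_deriv (f^~ u) q v dvu ->
  curvature_form conn q u v k l = duv - dvu +
   (\sum_m conn q v k m * conn q u m l - \sum_m conn q u k m * conn q v m l).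
Proof.
move=> Uq fE Duv Dvu.
rewrite /curvature_form addB_subB_entry.
rewrite (derive_conn Uq (fE v) Duv) (derive_conn Uq (fE u) Dvu).
by congr (_ + (_ - _)); rewrite mxE.
Qed.

Definition wed (q u v : vec) (i j : 'I_4) : R :=
  (u *m cofr q) 0 i * (v *m cofr q) 0 j - (u *m cofr q) 0 j * (v *m cofr q) 0 i.

Definition Bfun (q : 'rV[R]_2) : R := - 4 * a ^+ 2 * h q ^+ 2 + 2 * a ^+ 2 * H q ^+ 2
    - laplacian (@ln R \o h) q.

Ltac expand_forms S2 C2 := rewrite !sum4 ![conn _ _ _ _]mxE /= /Bfun /rho /sig /mu /nu
  /th1 /th2 /th3 /th4 S2 C2 /bet /gam.

(** Only the (1, 2) entry contains the Laplacian of ln h. The other entries, and that one without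
    its last term, are the curvature form of the projective plane of holomorphic sectional curvature
    4 a^2. *)
Lemma curvature_entries q u v : U (xy q) ->
  let T := curvature_form conn q u v in
  [/\ T o1 o2 = - 4 * a ^+ 2 * wed q u v o1 o2 + 2 * a ^+ 2 * wed q u v o3 o4
        - Bfun (xy q) * (u 0 o1 * v 0 o2 - u 0 o2 * v 0 o1),
      T o1 o3 = a ^+ 2 * (wed q u v o2 o4 - wed q u v o1 o3),
      T o1 o4 = - a ^+ 2 * (wed q u v o1 o4 + wed q u v o2 o3),
      T o2 o3 = - a ^+ 2 * (wed q u v o1 o4 + wed q u v o2 o3) &
      T o2 o4 = a ^+ 2 * (wed q u v o1 o3 - wed q u v o2 o4) /\
      T o3 o4 = a ^+ 2 * (2 * wed q u v o1 o2 - 4 * wed q u v o3 o4)].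
Proof.
move=> Uq T.
have [Eu1 Eu2 Eu3 Eu4] := cofrE q u; have [Ev1 Ev2 Ev3 Ev4] := cofrE q v.
have [S2 C2] := trig_double q.
have cs : cos (a * zc q) ^+ 2 = 1 - sin (a * zc q) ^+ 2 by rewrite cos2sin2.
have ct : cos (2 * a * tc q) ^+ 2 = 1 - sin (2 * a * tc q) ^+ 2 by rewrite cos2sin2.
have Dt := dtauB u v Uq; have Dr := drho_hB q u v.
have tv : has_deriv (fun p => tau p v) q u (dtau q u v) := deriv_tau u v Uq.
have tu : has_deriv (fun p => tau p u) q v (dtau q v u) := deriv_tau v u Uq.
have bv := deriv_bet u v Uq; have rv := deriv_rho_h u v Uq.
have bu := deriv_bet v u Uq; have ru := deriv_rho_h v u Uq.
have Et : dtau q u v = dtau q v u + (dtau q u v - dtau q v u) by rewrite addrC subrK.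
have Er : drho_h q u v = drho_h q v u + (drho_h q u v - drho_h q v u) by rewrite addrC subrK.
rewrite /wed Eu1 Eu2 Eu3 Eu4 Ev1 Ev2 Ev3 Ev4 /T.
split; last split.
- rewrite (@curvature_entry q u v o1 o2 _ _ rho Uq (fun w => conn_entryE w o1 o2)
    (deriv_rho tv bv rv) (deriv_rho tu bu ru)).
  rewrite Et Dt Er Dr; move: (dtau q v u) (drho_h q v u); expand_forms S2 C2; rewrite /tau; clear -cs ct.
  by move: (laplacian _ _) cs ct; abstract_at q; ring_trig.
- rewrite (@curvature_entry q u v o1 o3 _ _ nu Uq (fun w => conn_entryE w o1 o3)
    (deriv_nu u v Uq) (deriv_nu v u Uq)).
  expand_forms S2 C2; clear -cs ct.
  by move: (tau q u) (tau q v) cs ct; abstract_at q; ring_trig.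
- rewrite (@curvature_entry q u v o1 o4 _ _ mu Uq (fun w => conn_entryE w o1 o4)
    (deriv_mu u v Uq) (deriv_mu v u Uq)).
  expand_forms S2 C2; clear -cs ct.
  by move: (tau q u) (tau q v) cs ct; abstract_at q; ring_trig.
- rewrite (@curvature_entry q u v o2 o3 _ _ mu Uq (fun w => conn_entryE w o2 o3)
    (deriv_mu u v Uq) (deriv_mu v u Uq)).
  expand_forms S2 C2; clear -cs ct.
  by move: (tau q u) (tau q v) cs ct; abstract_at q; ring_trig.
- rewrite (@curvature_entry q u v o2 o4 _ _ (fun p w => - nu p w) Uq (fun w => conn_entryE w o2 o4)
    (has_deriv_opp (deriv_nu u v Uq)) (has_deriv_opp (deriv_nu v u Uq))).
  expand_forms S2 C2; clear -cs ct.
  by move: (tau q u) (tau q v) cs ct; abstract_at q; ring_trig.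
- rewrite (@curvature_entry q u v o3 o4 _ _ (fun p w => - sig p w) Uq (fun w => conn_entryE w o3 o4)
    (has_deriv_opp (deriv_sig tv bv)) (has_deriv_opp (deriv_sig tu bu))).
  rewrite Et Dt; move: (dtau q v u); expand_forms S2 C2; rewrite /tau; clear -cs ct.
  by move: cs ct; abstract_at q; ring_trig.
Qed.

Lemma domM_open : open M.
Proof.
have cxy p : {for p, continuous (@xy R)}.
  by apply: differentiable_continuous; exact: differentiable_xy.
have cz p : {for p, continuous (@zc R)}.
  by have [d _] := has_deriv_z p 0; exact: differentiable_continuous.
have -> : M = (@xy R @^-1` U) `&` ((fun p => `|zc p|) @^-1` `]0, (pi / (2 * `|a|))[%classic).
  by apply/seteqP; split => p /=; rewrite in_itv.
apply: openI; first by apply: open_comp oU => p _; exact: cxy.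
apply: open_comp; last exact: interval_open.
move=> p _; apply: (@continuous_comp _ _ _ (@zc R) (fun x : R => `|x|)); first exact: cz.
exact: norm_continuous.
Qed.

Lemma domM_U p : M p -> U (xy p). Proof. by case. Qed.

(** The range of z keeps the coframe independent: cos(az) scales theta1 and theta2, and sin(2az) is
    the coefficient of dt in theta3. *)
Lemma domM_trig p : M p -> 0 < cos (a * zc p) /\ sin (a * zc p) != 0.
Proof.
move=> [_ /andP[z0 zb]].
have na : 0 < `|a| by rewrite normr_gt0.
have azb : `|a * zc p| < pi / 2.
  rewrite normrM -ltr_pdivlMl// (lt_le_trans zb)// le_eqVlt; apply/orP; left; apply/eqP.
  by rewrite invfM mulrA mulrC.
have [n1 n2] : - (pi / 2) < a * zc p /\ a * zc p < pi / 2.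
  by move: azb; rewrite ltr_norml => /andP[].
have pi0 := pi_gt0 R.
split; first by apply: cos_gt0_pihalf; rewrite n1 n2.
have az0 : a * zc p != 0 by rewrite mulf_neq0// -normr_gt0.
have [azp|azn] := ltrP 0 (a * zc p).
  by rewrite gt_eqF// sin_gt0_pi// azp /=; move: n2 pi0; lra.
rewrite -[a * zc p]opprK sinN oppr_eq0 gt_eqF// sin_gt0_pi//.
have : a * zc p < 0 by rewrite lt_neqAle az0.
by move: n1 pi0 => ? ? ?; apply/andP; split; lra.
Qed.

Lemma cofr_unit p : M p -> cofr p \in unitmx.
Proof.
move=> Mp; rewrite -row_free_unit; apply: inj_row_free => u E.
have [E1 E2 E3 E4] := cofrE p u.
have [c0 s0] := domM_trig Mp; have h0 := hpos (domM_U Mp).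
have ch0 : cos (a * zc p) * h (xy p) != 0 by rewrite mulf_neq0// gt_eqF.
move: E1 E2 E3 E4; rewrite E !mxE => E1 E2 E3 E4.
have u1 : u 0 o1 = 0 by move/eqP: E1; rewrite /th1 eq_sym mulf_eq0 (negPf ch0) => /eqP.
have u2 : u 0 o2 = 0 by move/eqP: E2; rewrite /th2 eq_sym mulf_eq0 (negPf ch0) => /eqP.
have u3 : u 0 o3 = 0 by move: E4; rewrite /th4 /gam u1 u2 !mulr0 addr0 mulr0 subr0.
have u4 : u 0 o4 = 0.
  move/eqP: E3; rewrite /th3 /tau /bet u1 u2 !(mulr0, subr0) eq_sym.
  rewrite mulf_eq0 (trig_double p).1 !mulf_eq0 (negPf s0) (gt_eqF c0) pnatr_eq0 /=.
  by move/eqP.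
by apply/rowP; apply: ord4_ind; rewrite ?u1 ?u2 ?u3 ?u4 mxE.
Qed.

Lemma forms_smooth k v : [/\ Ck k M (tau^~ v), Ck k M (bet^~ v), Ck k M (gam^~ v),
  Ck k M (fun p => h (xy p)) & Ck k M (fun p => mx (xy p)) /\ Ck k M (fun p => my (xy p))].
Proof.
have oM := domM_open.
have Ch := Ck_xy oM domM_U (hsmooth k); have CH := Ck_xy oM domM_U (Hsmooth k).
have Cl := Ck_xy oM domM_U (smooth_l2 k); have Cn := Ck_xy oM domM_U (smooth_n2 k).
have Cx := Ck_xy oM domM_U (smooth_mx k); have Cy := Ck_xy oM domM_U (smooth_my k).
by split; rewrite ?/tau ?/bet ?/gam; [smooth_tac|smooth_tac|smooth_tac|exact: Ch|split].
Qed.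

Lemma cofr_smooth k : Ck k M cofr.
Proof.
have oM := domM_open; apply: Ck_mx => // i j; rewrite cofr_entryE cofr_rowE.
have [Ct Cb Cg Ch _] := forms_smooth k (delta_mx 0 i).
by move: j; apply: ord4_ind => /=; rewrite ?/th1 ?/th2 ?/th3 ?/th4; smooth_tac.
Qed.

Lemma conn_smooth k v : Ck k M (conn^~ v).
Proof.
have oM := domM_open; apply: Ck_mx => // i j; rewrite conn_entryE.
have [Ct Cb Cg Ch [Cx Cy]] := forms_smooth k v.
have Cr : Ck k M (rho^~ v) by rewrite /rho; smooth_tac.
have Cs : Ck k M (sig^~ v) by rewrite /sig; smooth_tac.
have Cm : Ck k M (mu^~ v) by rewrite /mu; smooth_tac.
have Cu : Ck k M (nu^~ v) by rewrite /nu; smooth_tac.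
by move: i; apply: ord4_ind; move: j; apply: ord4_ind => /=; smooth_tac.
Qed.

Lemma conn_skew q u : (conn q u)^T = - conn q u.
Proof.
by apply/matrixP; apply: ord4_ind; apply: ord4_ind; rewrite !mxE /= ?oppr0 ?opprK.
Qed.

Lemma gmetE q : gmet a h H q = cofr q *m (cofr q)^T.
Proof.
apply/matrixP => i j; rewrite /gmet /metric_of_coframe summxE mxE.
by apply: eq_bigr => k _; rewrite !mxE big_ord1 !mxE.
Qed.

End TodaMetric.

(** * The Hodge operator *)

Section LeviCivita.

(* Laplace expansion of a 0-1 determinant over int, to compute levi_civita. *)
Fixpoint detz (n : nat) (f : nat -> nat -> bool) : int :=
  if n is n'.+1 then
    foldr (fun j s => (if f 0 j then (-1) ^+ j * detz n' (fun i k => f i.+1 (bump j k)) else 0) + s)%R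
      0 (iota 0 n)
  else 1.

Lemma detzS n f : detz n.+1 f =
  foldr (fun j s => (if f 0 j then (-1) ^+ j * detz n (fun i k => f i.+1 (bump j k)) else 0) + s)%R
    0 (iota 0 n.+1).
Proof. by []. Qed.

Lemma detzE (R : comNzRingType) n (f : nat -> nat -> bool) :
  \det (\matrix_(i < n, j < n) (f i j)%:R) = (detz n f)%:~R :> R.
Proof.
elim: n f => [|n IH] f; first by rewrite det_mx00.
rewrite (expand_det_row _ ord0) detzS.
transitivity (\sum_(j < n.+1) (if f 0%N j then
    (-1) ^+ j * detz n (fun i k => f i.+1 (bump j k)) else 0)%:~R : R).
  apply: eq_bigr => j _; rewrite mxE /cofactor add0n.
  case: (f _ j); last by rewrite mul0r.
  rewrite [X in X * _ = _](_ : _ = 1)// mul1r intrM -IH.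
  congr (_ * _); first by rewrite rmorphXn rmorphN1.
  by congr determinant; apply/matrixP => i k; rewrite !mxE.
rewrite -(big_mkord xpredT (fun j => (if f 0%N j then
    (-1) ^+ j * detz n (fun i k => f i.+1 (bump j k)) else 0)%:~R)) /index_iota subn0.
elim: (iota 0 n.+1) => [|j s IHs]; first by rewrite big_nil.
by rewrite big_cons IHs /= intrD.
Qed.

(** The sign of the permutation i, j, k, l of 0, 1, 2, 3, and zero on any other quadruple; [Negz 0]
    is -1. *)
Definition lcz (i j k l : nat) : int :=
  match i, j, k, l with
  | 0, 1, 2, 3 => Posz 1 | 0, 2, 3, 1 => Posz 1 | 0, 3, 1, 2 => Posz 1
  | 0, 1, 3, 2 => Negz 0 | 0, 3, 2, 1 => Negz 0 | 0, 2, 1, 3 => Negz 0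
  | 1, 0, 2, 3 => Negz 0 | 1, 2, 3, 0 => Negz 0 | 1, 3, 0, 2 => Negz 0
  | 1, 0, 3, 2 => Posz 1 | 1, 3, 2, 0 => Posz 1 | 1, 2, 0, 3 => Posz 1
  | 2, 0, 1, 3 => Posz 1 | 2, 1, 3, 0 => Posz 1 | 2, 3, 0, 1 => Posz 1
  | 2, 0, 3, 1 => Negz 0 | 2, 3, 1, 0 => Negz 0 | 2, 1, 0, 3 => Negz 0
  | 3, 0, 1, 2 => Negz 0 | 3, 1, 2, 0 => Negz 0 | 3, 2, 0, 1 => Negz 0
  | 3, 0, 2, 1 => Posz 1 | 3, 2, 1, 0 => Posz 1 | 3, 1, 0, 2 => Posz 1
  | _, _, _, _ => Posz 0
  end%N.

Lemma levi_civitaE (R : realType) (i j k l : 'I_4) :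
  levi_civita R i j k l = (lcz i j k l)%:~R.
Proof.
have -> : levi_civita R i j k l =
    \det (\matrix_(r < 4, s < 4) (nth (i : nat) [:: i : nat; j : nat; k : nat; l : nat] r == s)%:R).
  rewrite /levi_civita; congr (\det _); apply/matrixP => r s; rewrite !mxE.
  by move: r; apply: ord4_ind.
rewrite (detzE R 4 (fun r s => nth (i : nat) [:: i : nat; j : nat; k : nat; l : nat] r == s)).
congr (_%:~R).
by move: i; apply: ord4_ind; move: j; apply: ord4_ind; move: k; apply: ord4_ind;
  move: l; apply: ord4_ind; vm_compute.
Qed.

Lemma levi_civita_sum (R : realType) (V : lmodType R) (G : 'I_4 -> 'I_4 -> 'I_4 -> 'I_4 -> V) :
  \sum_i \sum_j \sum_k \sum_l levi_civita R i j k l *: G i j k l =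
  (G o1 o2 o3 o4 - G o1 o2 o4 o3 + (- G o1 o3 o2 o4 + G o1 o3 o4 o2) + (G o1 o4 o2 o3 - G o1 o4 o3 o2)) +
  (- G o2 o1 o3 o4 + G o2 o1 o4 o3 + (G o2 o3 o1 o4 - G o2 o3 o4 o1) + (- G o2 o4 o1 o3 + G o2 o4 o3 o1)) +
  (G o3 o1 o2 o4 - G o3 o1 o4 o2 + (- G o3 o2 o1 o4 + G o3 o2 o4 o1) + (G o3 o4 o1 o2 - G o3 o4 o2 o1)) +
  (- G o4 o1 o2 o3 + G o4 o1 o3 o2 + (G o4 o2 o1 o3 - G o4 o2 o3 o1) + (- G o4 o3 o1 o2 + G o4 o3 o2 o1)).
Proof.
have E0 : (Posz 0)%:~R = 0 :> R by [].
have E1 : (Posz 1)%:~R = 1 :> R by [].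
have EN : (Negz 0)%:~R = -1 :> R by [].
rewrite sum4; congr (_ + _ + _ + _); rewrite !sum4 !levi_civitaE /= ?E0 ?E1 ?EN;
  by rewrite !(scale0r, scale1r, scaleN1r, add0r, addr0).
Qed.

End LeviCivita.

Section Hodge.
Variables (R : realType) (g : 'rV[R]_4 -> 'M[R]_4) (f : 'I_4 -> 'rV[R]_4 -> 'rV[R]_4).
Variables (p : 'rV[R]_4) (w : 'M[R]_4).
Hypothesis wT : w^T = - w.

Lemma bil_skew u v : bil w u v = - bil w v u.
Proof.
have E : (u *m w *m v^T)^T = - (v *m w *m u^T).
  by rewrite !trmx_mul trmxK wT mulNmx mulmxN mulmxA.
by rewrite /bil -(trmxK (u *m w *m v^T)) E [LHS]mxE [LHS]mxE.
Qed.

Lemma wedge11_skew (x y : 'rV[R]_4) : wedge11 x y = - wedge11 y x.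
Proof. by rewrite /wedge11 opprB. Qed.

(** For a skew [w], swapping the first two indices or the last two repeats a term, so the 24
    permutations group in fours and absorb the factor 1/4. *)
Lemma hodge_skew (b := fun i j => bil w (f i p) (f j p))
    (W := fun i j => wedge11 (f i p *m g p) (f j p *m g p)) :
  hodge g f p w = b o1 o2 *: W o3 o4 - b o1 o3 *: W o2 o4 + b o1 o4 *: W o2 o3 +
    b o2 o3 *: W o1 o4 - b o2 o4 *: W o1 o3 + b o3 o4 *: W o1 o2.
Proof.
pose G i j k l := b i j *: W k l.
have -> : hodge g f p w = 4^-1 *: \sum_i \sum_j \sum_k \sum_l levi_civita R i j k l *: G i j k l.
  rewrite /hodge; congr (_ *: _); do 4!(apply: eq_bigr => ? _).
  by rewrite /G scalerA.
rewrite levi_civita_sum /G.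
have bs i j : b j i = - b i j by rewrite /b bil_skew.
have Ws i j : W j i = - W i j by rewrite /W wedge11_skew.
rewrite (bs o1 o2) (bs o1 o3) (bs o1 o4) (bs o2 o3) (bs o2 o4) (bs o3 o4).
rewrite (Ws o1 o2) (Ws o1 o3) (Ws o1 o4) (Ws o2 o3) (Ws o2 o4) (Ws o3 o4).
move: (b o1 o2) (b o1 o3) (b o1 o4) (b o2 o3) (b o2 o4) (b o3 o4) => b12 b13 b14 b23 b24 b34.
move: (W o1 o2) (W o1 o3) (W o1 o4) (W o2 o3) (W o2 o4) (W o3 o4) => W12 W13 W14 W23 W24 W34.
by apply/matrixP => i j; rewrite !mxE; field.
Qed.

End Hodge.

(** * Curvature of the Toda metric *)

Section FrameCurvature.
Variable R : realType.
Notation vec := 'rV[R]_4.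

Definition w2 (x y : vec) (i j : 'I_4) : R := x 0 i * y 0 j - x 0 j * y 0 i.

(* The curvature tensor of the Toda metric in the coframe theta, with c = a^2 and
   K = B / D. *)
Definition Rc (c K : R) (x y z t : vec) : R :=
  ((- 4 * c - K) * w2 x y o1 o2 + 2 * c * w2 x y o3 o4) * w2 z t o1 o2
  + c * (w2 x y o2 o4 - w2 x y o1 o3) * w2 z t o1 o3
  - c * (w2 x y o1 o4 + w2 x y o2 o3) * w2 z t o1 o4
  - c * (w2 x y o1 o4 + w2 x y o2 o3) * w2 z t o2 o3
  + c * (w2 x y o1 o3 - w2 x y o2 o4) * w2 z t o2 o4
  + c * (2 * w2 x y o1 o2 - 4 * w2 x y o3 o4) * w2 z t o3 o4.

Definition ric (c K : R) (x y : vec) : R :=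
  (6 * c + K) * (x 0 o1 * y 0 o1 + x 0 o2 * y 0 o2)
  + 6 * c * (x 0 o3 * y 0 o3 + x 0 o4 * y 0 o4).

Lemma sum_Rc c K x y : \sum_i Rc c K (delta_mx 0 i) x y (delta_mx 0 i) = ric c K x y.
Proof. by rewrite sum4 /Rc /ric /w2 !mxE /=; ring. Qed.

Lemma sum_ric c K : \sum_i ric c K (delta_mx 0 i) (delta_mx 0 i) = 24 * c + 2 * K.
Proof. by rewrite sum4 /ric !mxE /=; ring. Qed.

Lemma dot_skew_mx (T : 'M[R]_4) z t : T^T = - T -> dot (z *m T) t =
  T o1 o2 * w2 z t o1 o2 + T o1 o3 * w2 z t o1 o3 + T o1 o4 * w2 z t o1 o4 +
  T o2 o3 * w2 z t o2 o3 + T o2 o4 * w2 z t o2 o4 + T o3 o4 * w2 z t o3 o4.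
Proof.
move=> TT; have E i j : T j i = - T i j by move/matrixP/(_ i j): TT; rewrite !mxE.
have D i : T i i = 0 by apply/eqP; rewrite -eqNr -E.
rewrite dotE !sum4 !mxE !sum4 !D (E o1 o2) (E o1 o3) (E o1 o4) (E o2 o3) (E o2 o4) (E o3 o4) /w2.
by move: (T o1 o2) (T o1 o3) (T o1 o4) (T o2 o3) (T o2 o4) (T o3 o4) => *; ring.
Qed.

Lemma comb6_entry m n (b1 b2 b3 b4 b5 b6 : R) (X1 X2 X3 X4 X5 X6 : 'M[R]_(m, n)) k l :
  (b1 *: X1 + b2 *: X2 + b3 *: X3 + b4 *: X4 + b5 *: X5 + b6 *: X6) k l =
  b1 * X1 k l + b2 * X2 k l + b3 * X3 k l + b4 * X4 k l + b5 * X5 k l + b6 * X6 k l.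
Proof. by rewrite !mxE. Qed.

Lemma bil_outer (s t u v : vec) : bil (s^T *m t) u v = pair1 s u * pair1 t v.
Proof.
by rewrite /bil mulmxA -mulmxA mxE big_ord1 /pair1 -[(u *m s^T)]trmxK [X in X * _]mxE trmx_mul trmxK.
Qed.

Lemma bil_wedge11 (x y u v : vec) :
  bil (wedge11 x y) u v = pair1 x u * pair1 y v - pair1 y u * pair1 x v.
Proof. by rewrite -!bil_outer /bil /wedge11 mulmxBr mulmxBl [LHS]mxE [X in _ + X]mxE. Qed.

End FrameCurvature.

Section TodaCurvature.
Variables (R : realType) (a : R) (U : set 'rV[R]_2) (h H : 'rV[R]_2 -> R).
Hypothesis a0 : a != 0.
Hypothesis oU : open U.
Hypothesis hsmooth : smooth U h.
Hypothesis Hsmooth : smooth U H.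
Hypothesis hpos : forall q, U q -> 0 < h q.
Hypothesis Hpos : forall q, U q -> 0 < H q.
Hypothesis toda : forall q, U q ->
  laplacian (@ln R \o H) q = 2 * a ^+ 2 * h q ^+ 2 - 4 * a ^+ 2 * H q ^+ 2.
Notation vec := 'rV[R]_4.
Notation M := (domM a U).
Notation g := (gmet a h H).
Notation C := (cofr a h H).
Notation A := (conn a h H).

Definition Dfun (p : vec) : R := h (xy p) ^+ 2 * cos (a * zc p) ^+ 2.

Lemma Dfun_neq0 p : M p -> Dfun p != 0.
Proof.
move=> Mp; have [c0 _] := domM_trig a0 Mp.
by rewrite /Dfun mulf_neq0// expf_neq0// gt_eqF// hpos//; exact: domM_U Mp.
Qed.

Lemma curvature_form_skew p u v : M p -> (curvature_form A p u v)^T = - curvature_form A p u v.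
Proof.
move=> Mp; have Up := domM_U Mp.
have dA w := diff_conn a0 oU hsmooth Hsmooth hpos Hpos w Up.
have E x w : ('D_x (A ^~ w) p)^T = - 'D_x (A ^~ w) p.
  have [_ <-] := derive_trmx x (dA w).
  have -> : (fun q => (A q w)^T) = (fun q => - A q w) by apply/funext => q; exact: conn_skew.
  by rewrite (@deriveN _ _ _ (A ^~ w))//; exact: diff_derivable.
rewrite /curvature_form raddfD raddfB /= !E raddfB /= !trmx_mul !conn_skew.
by rewrite !mulNmx !mulmxN !opprK opprD !opprB; congr (_ + _); rewrite addrC.
Qed.

Lemma RmE_frame p u v w x : M p ->
  Rm g p u v w x = Rc (a ^+ 2) (Bfun a h H (xy p) / Dfun p) (u *m C p) (v *m C p) (w *m C p) (x *m C p).
Proof.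
move=> Mp; have Up := domM_U Mp; have D0 := Dfun_neq0 Mp.
have T q y z : M q -> z *m 'D_y C q + z *m C q *m A q y = y *m 'D_z C q + y *m C q *m A q z.
  by move=> /domM_U Uq; exact: (cofr_torsion a0 oU hsmooth Hsmooth hpos Hpos toda).
rewrite (@RmE R M C A g (domM_open oU) (gmetE a h H)
  (fun q => cofr_unit H a0 hpos (p:=q)) (cofr_smooth a oU hsmooth Hsmooth hpos Hpos)
  (conn_smooth a oU hsmooth Hsmooth hpos Hpos) (fun q y _ => conn_skew a h H q y) T)//.
rewrite (dot_skew_mx _ _ (curvature_form_skew u v Mp)).
have [-> -> -> -> [-> ->]] := curvature_entries a0 oU hsmooth Hsmooth hpos Hpos toda u v Up.
(* Since theta1 /\ theta2 = D dx /\ dy, the term in dx /\ dy becomes B / D times theta1 /\ theta2: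
   this is the denominator of all the formulas. *)
have -> : Bfun a h H (xy p) * (u 0 o1 * v 0 o2 - u 0 o2 * v 0 o1) =
    Bfun a h H (xy p) / Dfun p * wed a h H p u v o1 o2.
  rewrite /wed; have [-> -> _ _] := cofrE a h H p u; have [-> -> _ _] := cofrE a h H p v.
  move: D0; rewrite /th1 /th2 /Dfun mulf_eq0 !expf_eq0 /= negb_or => /andP[].
  by move: (Bfun _ _ _ _) (h _) (cos _) => B x1 x2 n1 n2; field; rewrite n1 n2.
rewrite /Rc /wed -/(w2 _ _ _ _); move: (Bfun a h H (xy p) / Dfun p) => K.
by rewrite /w2; ring.
Qed.

Section Frame.
Variable E : 'I_4 -> vec -> vec.
Hypothesis Edual : dual_frame M (theta a h H) E.
Notation c := (a ^+ 2).
Notation K p := (Bfun a h H (xy p) / Dfun p).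
Notation f := (oriented E).
Notation Th p i j := (wedge11 (theta a h H i p) (theta a h H j p)).

Lemma frameE p i : M p -> E i p *m C p = delta_mx 0 i.
Proof.
move=> Mp; apply/rowP => j; rewrite [RHS]mxE eqxx /= -(Edual j i Mp).
by rewrite [LHS]mxE /pair1 [RHS]mxE; apply: eq_bigr => k _; rewrite !mxE mulrC.
Qed.

Lemma frame_theta p i : M p -> E i p *m g p = theta a h H i p.
Proof. by move=> Mp; rewrite gmetE mulmxA frameE// -rowE; apply/rowP => j; rewrite !mxE. Qed.

Lemma ricci_frame p u v : M p -> ricci g E p u v = ric c (K p) (u *m C p) (v *m C p).
Proof.
move=> Mp; rewrite /ricci -sum_Rc; apply: eq_bigr => i _.
by rewrite RmE_frame// frameE.
Qed.

Lemma scalar_frame p : M p -> scalar_curv g E p = 24 * c + 2 * K p.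
Proof.
move=> Mp; rewrite /scalar_curv -sum_ric; apply: eq_bigr => i _.
by rewrite ricci_frame// frameE.
Qed.

(** [oriented] only exchanges the last two frame vectors, so traces over the frame ignore it and the
    orientation matters for [hodge] alone. *)
Lemma oriented_sum (V : zmodType) (F : vec -> V) p :
  \sum_i F (f i p) = \sum_i F (E i p).
Proof. by rewrite !sum4 /oriented /= -!addrA [F (E o4 p) + _]addrC. Qed.

Lemma ricci_oriented p u v : ricci g f p u v = ricci g E p u v.
Proof. exact: (oriented_sum (fun e => Rm g p e u v e)). Qed.

Lemma scalar_oriented p : scalar_curv g f p = scalar_curv g E p.
Proof.
apply: etrans _ (oriented_sum (fun e => ricci g E p e e) p).
by apply: eq_bigr => i _; rewrite ricci_oriented.
Qed.

Definition Wc (k K : R) (x y z t : vec) : R := Rc k K x y z t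
  - 2^-1 * (dot x t * ric k K y z + dot y z * ric k K x t
            - dot x z * ric k K y t - dot y t * ric k K x z)
  + (24 * k + 2 * K) / 6 * (dot x t * dot y z - dot x z * dot y t).

Lemma weylE p u v w x : M p ->
  weyl g f p u v w x = Wc c (K p) (u *m C p) (v *m C p) (w *m C p) (x *m C p).
Proof.
move=> Mp; rewrite /weyl RmE_frame// !ricci_oriented !ricci_frame// scalar_oriented scalar_frame//.
by rewrite !(bilE (gmetE a h H)).
Qed.

Lemma Wc_frame (k K : R) z t (e := fun i : 'I_4 => delta_mx 0 i : vec) (W := fun i j => Wc k K (e i) (e j) z t) :
  [/\ W o1 o2 = - (2 * k + K / 3) * w2 z t o1 o2 + 2 * k * w2 z t o3 o4,
     W o3 o4 = 2 * k * w2 z t o1 o2 - (2 * k + K / 3) * w2 z t o3 o4,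
     W o1 o3 = (k + K / 6) * w2 z t o1 o3 + k * w2 z t o2 o4,
     W o2 o4 = k * w2 z t o1 o3 + (k + K / 6) * w2 z t o2 o4 &
     W o1 o4 = (k + K / 6) * w2 z t o1 o4 - k * w2 z t o2 o3 /\
     W o2 o3 = - k * w2 z t o1 o4 + (k + K / 6) * w2 z t o2 o3].
Proof.
by rewrite /W /e; split; last split; rewrite /Wc /Rc /ric /w2 !dotE !sum4 !mxE /=; field.
Qed.

Lemma Wc_skew (k K : R) x y z t : Wc k K y x z t = - Wc k K x y z t.
Proof. by rewrite /Wc /Rc /ric /w2; move: (dot x t) (dot y z) (dot x z) (dot y t) => *; ring. Qed.

Lemma sum_skew (b W : 'I_4 -> 'I_4 -> R) : (forall i j, b j i = - b i j) -> (forall i j, W j i = - W i j) ->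
  2^-1 * (\sum_i \sum_j b i j * W i j) = b o1 o2 * W o1 o2 + b o1 o3 * W o1 o3 + b o1 o4 * W o1 o4 +
    b o2 o3 * W o2 o3 + b o2 o4 * W o2 o4 + b o3 o4 * W o3 o4.
Proof.
move=> bs Ws; have D i : b i i = 0 by apply/eqP; rewrite -eqNr -bs.
rewrite !sum4 !D (bs o1 o2) (bs o1 o3) (bs o1 o4) (bs o2 o3) (bs o2 o4) (bs o3 o4).
rewrite (Ws o1 o2) (Ws o1 o3) (Ws o1 o4) (Ws o2 o3) (Ws o2 o4) (Ws o3 o4).
move: (W o1 o2) (W o1 o3) (W o1 o4) (W o2 o3) (W o2 o4) (W o3 o4).
by move: (b o1 o2) (b o1 o3) (b o1 o4) (b o2 o3) (b o2 o4) (b o3 o4) => *; field.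
Qed.

Section TwoForm.
Variables (p : vec) (w : 'M[R]_4).
Hypothesis Mp : M p.
Hypothesis wT : w^T = - w.
Let b i j := bil w (E i p) (E j p).

Lemma bilE_frame : w = C p *m (\matrix_(i, j) b i j) *m (C p)^T.
Proof.
pose X := \matrix_i E i p.
have XC : X *m C p = 1%:M by apply/row_matrixP => i; rewrite row_mul rowK frameE// row1.
have CX : C p *m X = 1%:M by exact: mulmx1C.
have -> : \matrix_(i, j) b i j = X *m w *m X^T.
  apply/matrixP => i j; rewrite mxE /b /bil.
  have r k : E k p = row k X by rewrite rowK.
  rewrite !r -row_mul tr_row [LHS]mxE [RHS]mxE; apply: eq_bigr => k _.
  by congr (_ * _); [rewrite [LHS]mxE|rewrite [LHS]mxE].
by rewrite !mulmxA CX mul1mx -mulmxA -trmx_mul CX trmx1 mulmx1.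
Qed.

Lemma form_decomposition : w = b o1 o2 *: Th p o1 o2 + b o1 o3 *: Th p o1 o3 + b o1 o4 *: Th p o1 o4 +
    b o2 o3 *: Th p o2 o3 + b o2 o4 *: Th p o2 o4 + b o3 o4 *: Th p o3 o4.
Proof.
have bs i j : b j i = - b i j by exact: bil_skew.
have D i : b i i = 0 by apply/eqP; rewrite -eqNr -bs.
rewrite {1}bilE_frame; set B := \matrix_(i, j) b i j; apply/matrixP => k l.
have BE i j : B i j = b i j by rewrite mxE.
have -> : (C p *m B *m (C p)^T) k l =
    \sum_j \sum_i C p k i * b i j * C p l j.
  rewrite mxE; apply: eq_bigr => j _; rewrite [X in X * _]mxE mulr_suml.
  by apply: eq_bigr => i _; rewrite BE [(C p)^T _ _]mxE.
have T i j : Th p i j k l = C p k i * C p l j - C p k j * C p l i.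
  by rewrite /wedge11 !mxE !big_ord1 !mxE.
rewrite !sum4 !D (bs o1 o2) (bs o1 o3) (bs o1 o4) (bs o2 o3) (bs o2 o4) (bs o3 o4).
rewrite comb6_entry !T.
move: (b o1 o2) (b o1 o3) (b o1 o4) (b o2 o3) (b o2 o4) (b o3 o4) => *; ring.
Qed.

Lemma hodgeE : hodge g f p w =
  - b o3 o4 *: Th p o1 o2 + b o2 o4 *: Th p o1 o3 + - b o2 o3 *: Th p o1 o4 +
  - b o1 o4 *: Th p o2 o3 + b o1 o3 *: Th p o2 o4 + - b o1 o2 *: Th p o3 o4.
Proof.
rewrite hodge_skew// /oriented /= !frame_theta// (bil_skew wT (E o4 p) (E o3 p)) -!/(b _ _).
rewrite [wedge11 (theta a h H o4 p) _]wedge11_skew.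
move: (b o1 o2) (b o1 o3) (b o1 o4) (b o2 o3) (b o2 o4) (b o3 o4).
move: (Th p o1 o2) (Th p o1 o3) (Th p o1 o4) (Th p o2 o3) (Th p o2 o4) (Th p o3 o4) => *.
by apply/matrixP => i j; rewrite !mxE; ring.
Qed.

Lemma asd_entries : hodge g f p w = - w -> [/\ b o1 o2 = b o3 o4, b o1 o4 = b o2 o3 & b o1 o3 = - b o2 o4].
Proof.
rewrite hodgeE => hw.
have N i j : bil (- w) (E i p) (E j p) = - b i j by rewrite /bil mulmxN mulNmx mxE.
have B i j k l : bil (Th p i j) (E k p) (E l p) =
    (i == k)%:R * (j == l)%:R - (j == k)%:R * (i == l)%:R by rewrite bil_wedge11 !Edual.
have X x1 x2 x3 x4 x5 x6 (Y1 Y2 Y3 Y4 Y5 Y6 : 'M[R]_4) u v : bil (x1 *: Y1 + x2 *: Y2 + x3 *: Y3 +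
    x4 *: Y4 + x5 *: Y5 + x6 *: Y6) u v = x1 * bil Y1 u v + x2 * bil Y2 u v + x3 * bil Y3 u v +
    x4 * bil Y4 u v + x5 * bil Y5 u v + x6 * bil Y6 u v.
  by rewrite /bil !(mulmxDl, mulmxDr) -!scalemxAr -!scalemxAl comb6_entry.
have Y k l := congr1 (fun y => bil y (E k p) (E l p)) hw.
split.
- have := Y o1 o2; rewrite /= N X !B /=; move: (b o1 o2) (b o1 o3) (b o1 o4) (b o2 o3) (b o2 o4) (b o3 o4) => *; lra.
- have := Y o1 o4; rewrite /= N X !B /=; move: (b o1 o2) (b o1 o3) (b o1 o4) (b o2 o3) (b o2 o4) (b o3 o4) => *; lra.
- have := Y o1 o3; rewrite /= N X !B /=; move: (b o1 o2) (b o1 o3) (b o1 o4) (b o2 o3) (b o2 o4) (b o3 o4) => *; lra.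
Qed.

(** The index pairs 12 with 34, 13 with 24 and 14 with 23 decouple. On anti-self-dual forms the
    contributions of c cancel in each of them, reflecting the self-duality of the projective plane,
    and only multiples of K remain. *)
Lemma weyl_opE : weyl_op g f p w =
  (b o1 o2 * (2 * c + K p / 3) - b o3 o4 * (2 * c)) *: Th p o1 o2
  + - (b o1 o3 * (c + K p / 6) + b o2 o4 * c) *: Th p o1 o3
  + (b o2 o3 * c - b o1 o4 * (c + K p / 6)) *: Th p o1 o4
  + (b o1 o4 * c - b o2 o3 * (c + K p / 6)) *: Th p o2 o3
  + - (b o1 o3 * c + b o2 o4 * (c + K p / 6)) *: Th p o2 o4
  + (b o3 o4 * (2 * c + K p / 3) - b o1 o2 * (2 * c)) *: Th p o3 o4.
Proof.
apply/matrixP => k l; rewrite comb6_entry [LHS]mxE.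
set z := coord_vec R l *m C p; set t := coord_vec R k *m C p.
pose W i j := Wc c (K p) (delta_mx 0 i) (delta_mx 0 j) z t.
have -> : \sum_i \sum_j bil w (f i p) (f j p) * weyl g f p (f i p) (f j p) (coord_vec R l) (coord_vec R k) =
    \sum_i \sum_j b i j * W i j.
  rewrite (oriented_sum (fun e => \sum_j bil w e (f j p) * weyl g f p e (f j p) (coord_vec R l) (coord_vec R k))).
  apply: eq_bigr => i _.
  rewrite (oriented_sum (fun e => bil w (E i p) e * weyl g f p (E i p) e (coord_vec R l) (coord_vec R k))).
  by apply: eq_bigr => j _; rewrite weylE// !frameE.
rewrite sum_skew; [|by move=> i j; exact: bil_skew|by move=> i j; exact: Wc_skew].
rewrite /W; have [-> -> -> -> [-> ->]] := Wc_frame c (K p) z t.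
have T i j : Th p i j k l = - w2 z t i j.
  by rewrite /w2 /z /t -!rowE /wedge11 !mxE !big_ord1 !mxE; ring.
rewrite !T; move: (w2 z t) => y.
move: (b o1 o2) (b o1 o3) (b o1 o4) (b o2 o3) (b o2 o4) (b o3 o4) (K p) => *.
by field.
Qed.

Lemma weyl_minus_eigen (r : R) : hodge g f p w = - w -> weyl_op g f p w = r *: w ->
  weyl_minus g f p w = r *: w.
Proof.
move=> hw ww; rewrite /weyl_minus ww.
have -> : hodge g f p (r *: w) = r *: hodge g f p w.
  rewrite /hodge scalerA mulrC -scalerA; congr (_ *: _).
  do 4!(rewrite scaler_sumr; apply: eq_bigr => ? _).
  rewrite scalerA; congr (_ *: _).
  by rewrite /bil -scalemxAr -scalemxAl mxE mulrCA.
by rewrite hw; apply/matrixP => i j; rewrite !mxE; field.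
Qed.

End TwoForm.

Lemma OmegaE p : Omega a h H p = Th p o1 o2 + Th p o3 o4.
Proof. by []. Qed.

Lemma Omega_skew p : (Omega a h H p)^T = - Omega a h H p.
Proof.
rewrite /Omega /wedge11.
move: (theta1 a h p) (theta2 a h p) (theta3 a H p) (theta4 a H p) => x y z t.
by apply/matrixP => i j; rewrite !mxE !big_ord1 !mxE; ring.
Qed.

Lemma Omega_frame p i j : M p -> bil (Omega a h H p) (E i p) (E j p) =
  (o1 == i)%:R * (o2 == j)%:R - (o2 == i)%:R * (o1 == j)%:R +
  ((o3 == i)%:R * (o4 == j)%:R - (o4 == i)%:R * (o3 == j)%:R).
Proof.
move=> Mp; rewrite OmegaE {1}/bil mulmxDr mulmxDl mxE -!/(bil _ _ _) !bil_wedge11.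
by rewrite !Edual.
Qed.

Lemma weyl_minus_Omega p : M p ->
  weyl_minus g f p (Omega a h H p) = (K p / 3) *: Omega a h H p.
Proof.
move=> Mp; have OT := Omega_skew p; apply: weyl_minus_eigen => //.
  rewrite hodgeE// !Omega_frame//= OmegaE.
  move: (Th p o1 o2) (Th p o1 o3) (Th p o1 o4) (Th p o2 o3) (Th p o2 o4) (Th p o3 o4) => *.
  by apply/matrixP => i j; rewrite !mxE; ring.
rewrite weyl_opE// !Omega_frame//= OmegaE; move: (K p).
move: (Th p o1 o2) (Th p o1 o3) (Th p o1 o4) (Th p o2 o3) (Th p o2 o4) (Th p o3 o4) => *.
by apply/matrixP => i j; rewrite !mxE; field.
Qed.

Lemma weyl_minus_LM p w : M p -> in_LM g f (Omega a h H) p w ->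
  weyl_minus g f p w = - (K p / 6) *: w.
Proof.
move=> Mp [[wT hw]] iw; apply: weyl_minus_eigen => //.
have [E12 E14 E13] := asd_entries Mp wT hw.
(* Orthogonality to [Omega] makes the coefficients of theta1 /\ theta2 and theta3 /\ theta4
   opposite, while anti-self-duality makes them equal. *)
have w0 : bil w (E o1 p) (E o2 p) = 0.
  move: iw; rewrite /ip2 (oriented_sum (fun e => \sum_j bil w e (f j p) * bil (Omega a h H p) e (f j p))).
  have -> : \sum_i \sum_j bil w (E i p) (f j p) * bil (Omega a h H p) (E i p) (f j p) =
      \sum_i \sum_j bil w (E i p) (E j p) * bil (Omega a h H p) (E i p) (E j p).
    apply: eq_bigr => i _.
    exact: (oriented_sum (fun e => bil w (E i p) e * bil (Omega a h H p) (E i p) e)).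
  rewrite (sum_skew (b := fun i j => bil w (E i p) (E j p)) (W := fun i j => bil (Omega a h H p) (E i p) (E j p))).
  - by rewrite !Omega_frame//= -E12; move: (bil w _ _) => x; lra.
  - by move=> i j; exact: bil_skew.
  - by move=> i j; apply: bil_skew; exact: Omega_skew.
rewrite [in RHS](form_decomposition Mp wT) weyl_opE// -E12 w0 E13 E14.
move: (bil w _ _) (bil w _ _) (K p) => x y k.
move: (Th p o1 o2) (Th p o1 o3) (Th p o1 o4) (Th p o2 o3) (Th p o2 o4) (Th p o3 o4) => *.
by apply/matrixP => i j; rewrite !mxE; field.
Qed.
Lemma pair1_theta p u i : pair1 (theta a h H i p) u = (u *m C p) 0 i.
Proof. by rewrite /pair1 !mxE; apply: eq_bigr => k _; rewrite !mxE mulrC. Qed.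

Lemma frame_forms p i : M p -> [/\ th1 a h p (E i p) = (i == o1)%:R, th2 a h p (E i p) = (i == o2)%:R,
  th3 a H p (E i p) = (i == o3)%:R & th4 a H p (E i p) = (i == o4)%:R].
Proof.
move=> Mp; have [<- <- <- <-] := cofrE a h H p (E i p).
by rewrite frameE// !mxE !eqxx /= ![_ == i]eq_sym.
Qed.

Lemma Gamma_conn k i j p : M p -> Gamma g E k i j p = A p (E i p) j k.
Proof.
move=> Mp.
have T q y z : M q -> z *m 'D_y C q + z *m C q *m A q y = y *m 'D_z C q + y *m C q *m A q z.
  by move=> /domM_U Uq; exact: (cofr_torsion a0 oU hsmooth Hsmooth hpos Hpos toda).
exact: (GammaE (domM_open oU) (gmetE a h H)
  (fun q => cofr_unit H a0 hpos (p:=q)) (cofr_smooth a oU hsmooth Hsmooth hpos Hpos)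
  (fun q y _ => conn_skew a h H q y) T (fun q i => @frameE q i)).
Qed.

Lemma frame_coords p : M p -> let c1 := cos (a * zc p) in
  [/\ E o1 p 0 o1 = (c1 * h (xy p))^-1 /\ E o1 p 0 o2 = 0,
      E o2 p 0 o1 = 0 /\ E o2 p 0 o2 = (c1 * h (xy p))^-1,
      E o3 p 0 o1 = 0 /\ E o3 p 0 o2 = 0 &
      E o4 p 0 o1 = 0 /\ E o4 p 0 o2 = 0].
Proof.
move=> Mp c1; have [c0 _] := domM_trig a0 Mp; have hp := hpos (domM_U Mp).
have n0 : c1 * h (xy p) != 0 by rewrite mulf_neq0// gt_eqF.
have X i : E i p 0 o1 = (c1 * h (xy p))^-1 * (i == o1)%:R /\
           E i p 0 o2 = (c1 * h (xy p))^-1 * (i == o2)%:R.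
  by have [<- <- _ _] := frame_forms i Mp; rewrite /th1 /th2 !mulKf.
by split; rewrite !(X _).1 !(X _).2 /= ?mulr1 ?mulr0.
Qed.

Lemma trig_ne0 p : M p -> [/\ cos (a * zc p) != 0, sin (a * zc p) != 0 & sin (2 * a * zc p) != 0].
Proof.
move=> Mp; have [c0 s0] := domM_trig a0 Mp; have [-> _] := trig_double a p.
by rewrite !mulf_neq0// gt_eqF.
Qed.

(** On the kernel of theta3, which contains E1 and E2, [tau] equals cot(2az) [bet]; substituting it
    in [rho] leaves (1 - cos(2az)) / sin(2az) = tan(az). *)
Lemma rho_horizontal p u : M p -> th3 a H p u = 0 ->
  rho a h H p u = a * (sin (a * zc p) / cos (a * zc p)) * bet a H p u
    - my h (xy p) * u 0 o1 + mx h (xy p) * u 0 o2.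
Proof.
move=> Mp; have [c0 s0 _] := trig_ne0 Mp; have [S2 C2] := trig_double a p.
have cs : cos (a * zc p) ^+ 2 = 1 - sin (a * zc p) ^+ 2 by rewrite cos2sin2.
rewrite /th3 /rho => E3.
have -> : tau a H p u = cos (2 * a * zc p) * bet a H p u / sin (2 * a * zc p).
  have [_ _ n0] := trig_ne0 Mp.
  by move/eqP: E3; rewrite subr_eq0 => /eqP <-; rewrite mulrAC mulfV// mul1r.
congr (_ - _ + _); rewrite S2 C2; move: (bet a H p u) cs c0 s0.
move: (sin (a * zc p)) (cos (a * zc p)) => s c1 b cs c0 s0; field: cs.
by rewrite c0 s0.
Qed.

Lemma Gamma_horizontal p : M p ->
  Gamma g E o2 o1 o1 p =
    a * sin (a * zc p) * cos (2 * a * tc p) * H (xy p) / (cos (a * zc p) ^+ 2 * h (xy p))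
    - 'D_(uy R) h (xy p) / (cos (a * zc p) * h (xy p) ^+ 2) /\
  Gamma g E o1 o2 o2 p =
    a * sin (a * zc p) * sin (2 * a * tc p) * H (xy p) / (cos (a * zc p) ^+ 2 * h (xy p))
    - 'D_(ux R) h (xy p) / (cos (a * zc p) * h (xy p) ^+ 2).
Proof.
move=> Mp; have [c0 _ _] := trig_ne0 Mp; have h0 : h (xy p) != 0 by rewrite gt_eqF// hpos//; exact: domM_U Mp.
have [-> ->] := derive_h hsmooth hpos (domM_U Mp).
have [[x1 y1] [x2 y2] _ _] := frame_coords Mp.
rewrite !Gamma_conn// !mxE /=.
have [_ _ t1 _] := frame_forms o1 Mp; have [_ _ t2 _] := frame_forms o2 Mp.
rewrite !rho_horizontal// /bet x1 x2 y1 y2.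
move: (mx _ _) (my _ _) h0 c0; move: (h _) (H _) (cos (2 * _ * _)) (sin (2 * _ * _)) (sin _) (cos _).
by move=> *; split; field; apply/andP.
Qed.

Lemma deriv_tan p u : cos (a * zc p) != 0 ->
  has_deriv (fun q => tan (a * zc q)) p u (a * u 0 o3 / cos (a * zc p) ^+ 2).
Proof.
move=> c0; apply: (@has_deriv_eq _ _ _ _ ((cos (a * zc p) ^+ 2)^-1 * (a * u 0 o3))).
  apply: (fun D => @has_deriv_comp _ tan (fun q => a * zc q) p u _ _ D (is_derive_tan c0)).
  apply: has_deriv_eq; first by deriv.
  by rewrite /= mul0r add0r.
by rewrite mulrC.
Qed.

Lemma nabla_lee p i : M p ->
  nabla_form1 g (lee_theta a H) (E i) (E i) p =
  - (2 * a ^+ 2 / cos (a * zc p) ^+ 2 * E i p 0 o3) * (i == o4)%:R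
  + 2 * a * tan (a * zc p) * A p (E i p) i o4.
Proof.
move=> Mp; have [c0 _ _] := trig_ne0 Mp.
have L q u : pair1 (lee_theta a H q) u = - (2 * a * tan (a * zc q)) * (u *m C q) 0 o4.
  by rewrite -(pair1_theta q u o4) /pair1 /lee_theta -scaleNr -scalemxAl mxE.
rewrite /nabla_form1 L.
have -> : 'D_(E i p) (fun q => pair1 (lee_theta a H q) (E i q)) p =
    'D_(E i p) (fun q => - (2 * a * tan (a * zc q)) * (i == o4)%:R) p.
  apply: near_eq_derive; apply: (@near_open _ _ M) => [|//|q Mq]; first exact: domM_open.
  by rewrite L frameE// [X in _ * X]mxE eqxx (eq_sym o4).
have -> : (nabla g (E i) (E i) p *m C p) 0 o4 = A p (E i p) i o4.
  by rewrite -(Gamma_conn o4 i i Mp) /Gamma (bilE (gmetE a h H)) frameE// dot_delta.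
have dt := deriv_tan (E i p) c0.
have [_ ->] : has_deriv (fun q => - (2 * a * tan (a * zc q)) * (i == o4)%:R) p (E i p)
   (- (2 * a ^+ 2 / cos (a * zc p) ^+ 2 * E i p 0 o3) * (i == o4)%:R).
  apply: has_deriv_eq; first by deriv.
  rewrite /=; move: (tan _) (E i p 0 o3) c0; move: (cos _) => x y z x0.
  by field.
by rewrite [X in _ - X]mulNr opprK.
Qed.

Lemma conformal_frame p : M p ->
  conformal_scalar_curv g E (lee_theta a H) p = 2 * K p.
Proof.
move=> Mp; rewrite /conformal_scalar_curv scalar_frame//.
(* Six times this value is the constant part 24 a^2 of the scalar curvature, so only 2 K
   survives. *)
suff -> : normsq1 E (lee_theta a H) p + codiff g E (lee_theta a H) p = 4 * c by ring.
have [c0 s0 n0] := trig_ne0 Mp; have [S2 C2] := trig_double a p.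
have h0 : h (xy p) != 0 by rewrite gt_eqF// hpos//; exact: domM_U Mp.
have cs : cos (a * zc p) ^+ 2 = 1 - sin (a * zc p) ^+ 2 by rewrite cos2sin2.
have L i : pair1 (lee_theta a H p) (E i p) = - (2 * a * tan (a * zc p)) * (o4 == i)%:R.
  by rewrite -(Edual o4 i Mp) /pair1 /lee_theta -scaleNr -scalemxAl mxE.
rewrite /normsq1 /codiff !sum4 !nabla_lee// !L !mxE /= /mu /nu /sig.
have [[x1 y1] [x2 y2] [x3 y3] [x4 y4]] := frame_coords Mp.
have [_ _ + _] := frame_forms o3 Mp; have [_ _ _ +] := frame_forms o4 Mp.
rewrite /th3 /th4 /bet /gam x1 x3 x4 y2 y3 y4 /= !(mulr0, addr0, subr0) => E43 E33.
have -> : tau a H p (E o3 p) = (sin (2 * a * zc p))^-1 by apply: (mulfI n0); rewrite E33 mulfV.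
rewrite E43 S2 C2 /tan; move: h0 cs c0 s0.
move: (sin (a * zc p)) (cos (a * zc p)) (h (xy p)) => s c1 h1 h0 cs c0 s0; field: cs.
by rewrite c0 s0 h0.
Qed.

Lemma lee_form_Omega p u v w : M p ->
  ext_deriv2 (Omega a h H) p u v w = 2 * wedge12 (lee_theta a H p) (Omega a h H p) u v w.
Proof.
move=> Mp; have Up := domM_U Mp; have [c0 s0 n0] := trig_ne0 Mp; have [S2 C2] := trig_double a p.
have cs : cos (a * zc p) ^+ 2 = 1 - sin (a * zc p) ^+ 2 by rewrite cos2sin2.
have OmE q x y : bil (Omega a h H q) x y = th1 a h q x * th2 a h q y - th2 a h q x * th1 a h q y
    + (th3 a H q x * th4 a H q y - th4 a H q x * th3 a H q y).
  rewrite OmegaE {1}/bil mulmxDr mulmxDl mxE -!/(bil _ _ _) !bil_wedge11 !pair1_theta.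
  by have [-> -> -> ->] := cofrE a h H q x; have [-> -> -> ->] := cofrE a h H q y.
pose d1 (x y : vec) := h (xy p) * (- (a * sin (a * zc p) * x 0 o3) +
     cos (a * zc p) * (mx h (xy p) * x 0 o1 + my h (xy p) * x 0 o2)) * y 0 o1.
pose d2 (x y : vec) := h (xy p) * (- (a * sin (a * zc p) * x 0 o3) +
     cos (a * zc p) * (mx h (xy p) * x 0 o1 + my h (xy p) * x 0 o2)) * y 0 o2.
pose ds (x : vec) := 2 * a * (n2 a H (xy p) * x 0 o1 - l2 a H (xy p) * x 0 o2).
pose dt (x y : vec) := dtau a H p x y.
pose d3 (x y : vec) := 2 * a * x 0 o3 * (cos (2 * a * zc p) * tau a H p y + sin (2 * a * zc p) * bet a H p y) +
   sin (2 * a * zc p) * dt x y - cos (2 * a * zc p) * (ds x * bet a H p y - 2 * a * x 0 o4 * gam a H p y).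
pose d4 (x y : vec) := - (ds x * gam a H p y + 2 * a * x 0 o4 * bet a H p y).
have D x y z : 'D_x (fun q => bil (Omega a h H q) y z) p =
    d1 x y * th2 a h p z + th1 a h p y * d2 x z - (d2 x y * th1 a h p z + th2 a h p y * d1 x z)
    + (d3 x y * th4 a H p z + th3 a H p y * d4 x z - (d4 x y * th3 a H p z + th4 a H p y * d3 x z)).
  have -> : (fun q => bil (Omega a h H q) y z) = (fun q => th1 a h q y * th2 a h q z
      - th2 a h q y * th1 a h q z + (th3 a H q y * th4 a H q z - th4 a H q y * th3 a H q z)).
    by apply/funext => q; exact: OmE.
  have D1 y' : has_deriv (fun q => th1 a h q y') p x (d1 x y') := deriv_th1 a H hsmooth hpos x y' Up.
  have D2 y' : has_deriv (fun q => th2 a h q y') p x (d2 x y') := deriv_th2 a H hsmooth hpos x y' Up.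
  have D3 y' : has_deriv (fun q => th3 a H q y') p x (d3 x y').
    exact: (deriv_th3 h (deriv_tau a h oU Hsmooth Hpos x y' Up) (deriv_bet h a0 Hsmooth Hpos x y' Up)).
  have D4 y' : has_deriv (fun q => th4 a H q y') p x (d4 x y').
    exact: (deriv_th4 (deriv_gam h a0 Hsmooth Hpos x y' Up)).
  have := D1 y; have := D2 y; have := D3 y; have := D4 y; have := D1 z; have := D2 z; have := D3 z; have := D4 z.
  move=> ? ? ? ? ? ? ? ?.
  suff [] : has_deriv (fun q => th1 a h q y * th2 a h q z - th2 a h q y * th1 a h q z +
     (th3 a H q y * th4 a H q z - th4 a H q y * th3 a H q z)) p x
    (d1 x y * th2 a h p z + th1 a h p y * d2 x z + - (d2 x y * th1 a h p z + th2 a h p y * d1 x z)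
    + (d3 x y * th4 a H p z + th3 a H p y * d4 x z + - (d4 x y * th3 a H p z + th4 a H p y * d3 x z))) by [].
  by deriv.
have Lw x : pair1 (lee_theta a H p) x = - (2 * a * tan (a * zc p)) * th4 a H p x.
  have [_ _ _ <-] := cofrE a h H p x.
  by rewrite -(pair1_theta p x o4) /pair1 /lee_theta -scaleNr -scalemxAl mxE.
rewrite /ext_deriv2 /wedge12 !D !Lw !OmE.
(* As for the torsion, only the antisymmetric part of [dt] is known; the three remaining values
   cancel in the cyclic sum. *)
have Et x y : dt x y = dt y x + (2 * a * H (xy p) ^+ 2 - a * h (xy p) ^+ 2) * (x 0 o1 * y 0 o2 - x 0 o2 * y 0 o1).
  by rewrite -(dtauB a0 oU Hsmooth Hpos toda x y Up) addrC subrK.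
rewrite /d3 (Et u v) (Et v w) (Et w u) /d4 /d1 /d2 /ds /th1 /th2 /th3 /th4 S2 C2 /bet /gam /tan /tau.
have ct : cos (2 * a * tc p) ^+ 2 = 1 - sin (2 * a * tc p) ^+ 2 by rewrite cos2sin2.
move: (dt v u) (dt w v) (dt u w) cs ct c0; clear.
move: (h (xy p)) (H (xy p)) (l2 a H (xy p)) (n2 a H (xy p)) (mx h (xy p)) (my h (xy p))
    (cos (a * zc p)) (sin (a * zc p)) (cos (2 * a * tc p)) (sin (2 * a * tc p)).
move: (u 0 o1) (u 0 o2) (u 0 o3) (u 0 o4) (v 0 o1) (v 0 o2) (v 0 o3) (v 0 o4) (w 0 o1) (w 0 o2) (w 0 o3) (w 0 o4).
by intros; lazymatch goal with cs : @eq _ (@GRing.exp _ _ _) _, ct : @eq _ (@GRing.exp _ _ _) _ |- _ => field: cs ct end.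
Qed.

Lemma curvature_ratio p : M p ->
  (- 8 * a ^+ 2 * h (xy p) ^+ 2 + 4 * a ^+ 2 * H (xy p) ^+ 2
         - 2 * laplacian (@ln R \o h) (xy p)) / Dfun p = 2 * K p.
Proof.
move=> Mp; rewrite /Bfun; move: (Dfun_neq0 Mp); move: (Dfun p) (h _) (H _) (laplacian _ _) => d x y z d0.
by field.
Qed.

Lemma ricci_matrix p : M p -> let lambda : R := K p + 6 * a ^+ 2 in
  \matrix_(i < 4, j < 4) ricci g E p (E i p) (E j p) =
  diag_mx (\row_(i < 4) [:: lambda; lambda; 6 * a ^+ 2; 6 * a ^+ 2]`_i).
Proof.
move=> Mp l; apply/matrixP => i j; rewrite [LHS]mxE ricci_frame// !frameE//.
rewrite [RHS]mxE mxE /ric !mxE /l; move: (K p) => k.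
by move: i; apply: ord4_ind; move: j; apply: ord4_ind => /=;
  rewrite ?(mulr1n, mulr0n); ring.
Qed.

Lemma sectional_frame p : M p ->
  sectional g p (E o1 p) (E o2 p) =
    (2 * a ^+ 2 * H (xy p) ^+ 2 - laplacian (@ln R \o h) (xy p))
      / (cos (a * zc p) ^+ 2 * h (xy p) ^+ 2)
    - 4 * a ^+ 2 * tan (a * zc p) ^+ 2 /\
  sectional g p (E o3 p) (E o4 p) = 4 * a ^+ 2.
Proof.
move=> Mp; rewrite /sectional !RmE_frame// !frameE//.
have [c0 _ _] := trig_ne0 Mp.
have h0 : h (xy p) != 0 by rewrite gt_eqF// hpos//; exact: domM_U Mp.
have cs : cos (a * zc p) ^+ 2 = 1 - sin (a * zc p) ^+ 2 by rewrite cos2sin2.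
rewrite /Rc /w2 !mxE /=; split; last by ring.
rewrite /Bfun /Dfun /tan; move: cs c0 h0.
move: (sin (a * zc p)) (cos (a * zc p)) (h _) (H _) (laplacian _ _) => s c1 h1 H1 l cs c0 h0.
by field: cs; rewrite c0 h0.
Qed.

(** [Jbar] is given only through its Kähler form; nondegeneracy of the metric recovers its matrix in
    the coframe, with E1 sent to E2 and E3 to -E4. *)
Lemma Jbar_frame (Jbar : vec -> 'M[R]_4) p u : M p -> kahler_form g Jbar p = Omega_bar a h H p ->
  u *m Jbar p *m C p = \row_j [:: - (u *m C p) 0 o2; (u *m C p) 0 o1; (u *m C p) 0 o4; - (u *m C p) 0 o3]`_j.
Proof.
move=> Mp; rewrite /kahler_form gmetE => kJ.
set r := \row_j _.
have Cu : (C p)^T \in unitmx by rewrite unitmx_tr (cofr_unit H a0 hpos Mp).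
suff : u *m Jbar p *m C p *m (C p)^T = r *m (C p)^T.
  exact: (can_inj (mulmxK Cu)).
rewrite -mulmxA -[u *m _ *m _]mulmxA kJ /Omega_bar.
have W (x y : vec) : u *m wedge11 x y = pair1 x u *: y - pair1 y u *: x.
  rewrite /wedge11 mulmxBr !mulmxA; congr (_ - _); apply/rowP => j;
    by rewrite mxE big_ord1 [RHS]mxE /pair1 -[u *m _]trmxK mxE trmx_mul trmxK.
rewrite mulmxDr !W (pair1_theta p u o1) (pair1_theta p u o2) (pair1_theta p u o3) (pair1_theta p u o4).
move: (u *m C p) @r => y r; apply/rowP => j; rewrite [RHS]mxE sum4 ![(C p)^T _ _]mxE ![r _ _]mxE /=.
by rewrite ![C p _ _]mxE /= !mxE; ring.
Qed.

Lemma space_form_iff (Jbar : vec -> 'M[R]_4) :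
  (forall p, M p -> kahler_form g Jbar p = Omega_bar a h H p) ->
  space_form g M Jbar <-> forall q, U q -> Bfun a h H q = 0.
Proof.
move=> kJ.
have RJ p u : M p -> let x := u *m C p in
    Rm g p u (u *m Jbar p) (u *m Jbar p) u =
    4 * c * (x 0 o1 ^+ 2 + x 0 o2 ^+ 2 + x 0 o3 ^+ 2 + x 0 o4 ^+ 2) ^+ 2
    + K p * (x 0 o1 ^+ 2 + x 0 o2 ^+ 2) ^+ 2.
  move=> Mp; rewrite RmE_frame// (Jbar_frame u Mp (kJ p Mp)) /=.
  move: (u *m C p) (K p) => x k; rewrite /Rc /w2 !mxE /=.
  by move: (x 0 o1) (x 0 o2) (x 0 o3) (x 0 o4) => *; ring.
have norm p u : let x := u *m C p in
    bil (g p) u u = x 0 o1 ^+ 2 + x 0 o2 ^+ 2 + x 0 o3 ^+ 2 + x 0 o4 ^+ 2.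
  by rewrite (bilE (gmetE a h H)) dotE sum4 -!expr2.
split=> [[k sf] q Uq|B0]; last first.
  exists (4 * c) => p u Mp; rewrite norm RJ// (B0 _ (domM_U Mp)) !mul0r addr0 => ->.
  by rewrite expr1n mulr1.
(* Every point of [U] must be seen from [M]: this height is half the upper bound allowed for |z|,
   and t = 0 is arbitrary. *)
pose z0 : R := pi / (4 * `|a|).
pose p : vec := \row_j [:: q 0 0; q 0 1; z0; 0]`_j.
have pE : xy p = q.
  by apply/rowP; apply: ord2_ind; [have [-> _] := xyE p|have [_ ->] := xyE p]; rewrite mxE.
have a1 : 0 < `|a| by rewrite normr_gt0.
have z1 : 0 < z0 by rewrite /z0 divr_gt0 ?pi_gt0// mulr_gt0.
have Mp : M p.
  split; rewrite ?pE// /zc mxE /= gtr0_norm// z1 /= /z0 ltr_pM2l ?pi_gt0//.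
  by rewrite ltf_pV2 ?posrE ?mulr_gt0// ltr_pM2r// ltr_nat.
(* The holomorphic sectional curvature is 4 a^2 at E4 and 4 a^2 + K at E1, so constancy forces K =
   0. *)
have C4 := sf p (E o4 p) Mp; have C1 := sf p (E o1 p) Mp.
move: C4 C1; rewrite !norm !RJ// !frameE// !mxE /= pE.
rewrite !(expr0n, expr1n, add0r, addr0, mulr1, mulr0) /= => /(_ erefl) <- /(_ erefl) E0.
have /eqP : Bfun a h H q / Dfun p = 0 by rewrite -[RHS](subrr (4 * c)) -{1}E0 addrAC subrr add0r.
by rewrite mulf_eq0 invr_eq0 (negPf (Dfun_neq0 Mp)) orbF => /eqP.
Qed.

End Frame.
End TodaCurvature.

(** * The flat case and the projective plane *)

Definition k0 : 'I_3 := @Ordinal 3 0 isT.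
Definition k1 : 'I_3 := @Ordinal 3 1 isT.
Definition k2 : 'I_3 := @Ordinal 3 2 isT.

Lemma sum3 (V : zmodType) (F : 'I_3 -> V) : \sum_(i < 3) F i = F k0 + F k1 + F k2.
Proof.
rewrite !big_ord_recl big_ord0 addr0 -!addrA.
by congr (F _ + (F _ + F _)); apply: val_inj.
Qed.

Lemma ord3_ind (P : 'I_3 -> Prop) : P k0 -> P k1 -> P k2 -> forall i, P i.
Proof.
move=> P0 P1 P2 [[|[|[|//]]] i].
- by have <- : k0 = Ordinal i by apply: val_inj.
- by have <- : k1 = Ordinal i by apply: val_inj.
- by have <- : k2 = Ordinal i by apply: val_inj.
Qed.

Section Blocks.
Variables (R : realType) (V : normedModType R).

Lemma Ck_block k (U : set V) m1 m2 n1 n2 (A : V -> 'M[R]_(m1, n1)) (B : V -> 'M[R]_(m1, n2))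
    (C : V -> 'M[R]_(m2, n1)) (D : V -> 'M[R]_(m2, n2)) : open U ->
  Ck k U A -> Ck k U B -> Ck k U C -> Ck k U D ->
  Ck k U (fun q => block_mx (A q) (B q) (C q) (D q)).
Proof.
move=> oU CA CB CC CD; apply: Ck_mx => // i j.
by case: (split_ordP i) => i' ->; case: (split_ordP j) => j' ->;
  [apply: Ck_ext (Ck_entry i' j' oU CA)|apply: Ck_ext (Ck_entry i' j' oU CB)
  |apply: Ck_ext (Ck_entry i' j' oU CC)|apply: Ck_ext (Ck_entry i' j' oU CD)] => // q _;
  rewrite ?block_mxEul ?block_mxEur ?block_mxEdl ?block_mxEdr.
Qed.

Lemma derive_block p v m1 m2 n1 n2 (A : V -> 'M[R]_(m1, n1)) (B : V -> 'M[R]_(m1, n2))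
    (C : V -> 'M[R]_(m2, n1)) (D : V -> 'M[R]_(m2, n2)) :
  differentiable A p -> differentiable B p -> differentiable C p -> differentiable D p ->
  'D_v (fun q => block_mx (A q) (B q) (C q) (D q)) p =
  block_mx ('D_v A p) ('D_v B p) ('D_v C p) ('D_v D p).
Proof.
move=> dA dB dC dD.
pose X q := block_mx (A q) (B q) (C q) (D q).
have Xul i j : (fun q => X q (lshift m2 i) (lshift n2 j)) = (fun q => A q i j).
  by apply/funext => q; exact: block_mxEul.
have Xur i j : (fun q => X q (lshift m2 i) (rshift n1 j)) = (fun q => B q i j).
  by apply/funext => q; exact: block_mxEur.
have Xdl i j : (fun q => X q (rshift m1 i) (lshift n2 j)) = (fun q => C q i j).
  by apply/funext => q; exact: block_mxEdl.
have Xdr i j : (fun q => X q (rshift m1 i) (rshift n1 j)) = (fun q => D q i j).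
  by apply/funext => q; exact: block_mxEdr.
have dX : differentiable X p.
  by apply: differentiable_mx => i j; case: (split_ordP i) => i' ->; case: (split_ordP j) => j' ->;
    rewrite ?Xul ?Xur ?Xdl ?Xdr; exact: differentiable_entry.
apply/matrixP => i j; rewrite (derive_entry v i j dX).
case: (split_ordP i) => i' ->; case: (split_ordP j) => j' ->.
- by rewrite Xul block_mxEul (derive_entry v i' j' dA).
- by rewrite Xur block_mxEur (derive_entry v i' j' dB).
- by rewrite Xdl block_mxEdl (derive_entry v i' j' dC).
- by rewrite Xdr block_mxEdr (derive_entry v i' j' dD).
Qed.

End Blocks.

(** * Algebra of the su(3)-valued connection form *)

Section CartanAlgebra.
Variables (R : realType) (a : R).
Notation vec := 'rV[R]_4.
Implicit Types (x y : vec) (B T : 'M[R]_4) (P Q : 'M[R]_3).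

(* The real matrix of the complex matrix P + i Q. *)
Definition cplx P Q : 'M[R]_(3 + 3) := block_mx P (- Q) Q P.

(* cp_re + i cp_im is the su(3)-valued connection form of CP^2 in a unitary coframe x,
   with B the Levi-Civita connection form; the factors 3^-1 make it traceless. *)
Definition cp_re x B : 'M[R]_3 := \matrix_(k, l) nth 0 (nth [::]
  [:: [:: 0; a * x 0 o1; - B o1 o4];
      [:: - (a * x 0 o1); 0; - (a * x 0 o4)];
      [:: B o1 o4; a * x 0 o4; 0]] k) l.

Definition cp_im x B : 'M[R]_3 := \matrix_(k, l) nth 0 (nth [::]
  [:: [:: 3^-1 * (2 * B o1 o2 + B o3 o4); a * x 0 o2; B o1 o3];
      [:: a * x 0 o2; 3^-1 * (B o3 o4 - B o1 o2); a * x 0 o3];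
      [:: B o1 o3; a * x 0 o3; - (3^-1 * (2 * B o3 o4 + B o1 o2))]] k) l.

Lemma cp_re_lin k x y B T : cp_re (k *: x + y) (k *: B + T) = k *: cp_re x B + cp_re y T.
Proof.
by apply/matrixP => i j; rewrite !mxE /=; move: i; apply: ord3_ind;
  move: j; apply: ord3_ind => /=; ring.
Qed.

Lemma cp_im_lin k x y B T : cp_im (k *: x + y) (k *: B + T) = k *: cp_im x B + cp_im y T.
Proof.
by apply/matrixP => i j; rewrite !mxE /=; move: i; apply: ord3_ind;
  move: j; apply: ord3_ind => /=; ring.
Qed.

(** The last two equations say that the skew matrix commutes with [Jbar], which sends E1 to E2 and
    E3 to -E4; for the Levi-Civita form this is the Kähler condition. *)
Definition unitary_form B := [/\ B^T = - B, B o2 o3 = B o1 o4 & B o2 o4 = - B o1 o3].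

Lemma unitary_entries B : unitary_form B ->
  [/\ [/\ B o1 o1 = 0, B o2 o2 = 0, B o3 o3 = 0 & B o4 o4 = 0],
      [/\ B o2 o1 = - B o1 o2, B o3 o1 = - B o1 o3, B o4 o1 = - B o1 o4 & B o4 o3 = - B o3 o4] &
      [/\ B o2 o3 = B o1 o4, B o3 o2 = - B o1 o4, B o2 o4 = - B o1 o3 & B o4 o2 = B o1 o3]].
Proof.
move=> [BT B23 B24]; have E i j : B j i = - B i j by move/matrixP/(_ i j): BT; rewrite !mxE.
have D i : B i i = 0 by apply/eqP; rewrite -eqNr -E.
by split; split=> //; rewrite E // ?B23 ?B24 ?opprK.
Qed.

(** The curvature of the projective plane, recorded for the four entries that [cp_re] and [cp_im]
    read. *)
Definition cp_curvature x y T := [/\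
  T o1 o2 = - 4 * a ^+ 2 * w2 x y o1 o2 + 2 * a ^+ 2 * w2 x y o3 o4,
  T o1 o3 = a ^+ 2 * (w2 x y o2 o4 - w2 x y o1 o3),
  T o1 o4 = - a ^+ 2 * (w2 x y o1 o4 + w2 x y o2 o3) &
  T o3 o4 = a ^+ 2 * (2 * w2 x y o1 o2 - 4 * w2 x y o3 o4)].

Section Flat.
Variables (x y : vec) (Bu Bv T : 'M[R]_4).
Hypothesis uBu : unitary_form Bu.
Hypothesis uBv : unitary_form Bv.
Hypothesis Tcp : cp_curvature x y T.
(** When x, y are the coframe values of u, v and [T] is the curvature, [X] and [Y] are the exterior
    derivatives at u, v of the coframe and of the connection form, as absence of torsion and the
    definition of curvature prescribe them. *)
Let X := x *m Bv - y *m Bu.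
Let Y := T - (Bv *m Bu - Bu *m Bv).

Let XE j : X 0 j = \sum_k x 0 k * Bv k j - \sum_k y 0 k * Bu k j.
Proof. by rewrite /X !mxE. Qed.

Let YE i j : Y i j = T i j - (\sum_k Bv i k * Bu k j - \sum_k Bu i k * Bv k j).
Proof. by rewrite /Y !mxE. Qed.

Let cp_entries : (X 0 o1 = - (Bv o1 o2 * x 0 o2 + Bv o1 o3 * x 0 o3 + Bv o1 o4 * x 0 o4)
       + (Bu o1 o2 * y 0 o2 + Bu o1 o3 * y 0 o3 + Bu o1 o4 * y 0 o4)) /\
  [/\ X 0 o2 = Bv o1 o2 * x 0 o1 - Bv o1 o4 * x 0 o3 + Bv o1 o3 * x 0 o4
       - (Bu o1 o2 * y 0 o1 - Bu o1 o4 * y 0 o3 + Bu o1 o3 * y 0 o4),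
     X 0 o3 = Bv o1 o3 * x 0 o1 + Bv o1 o4 * x 0 o2 - Bv o3 o4 * x 0 o4
       - (Bu o1 o3 * y 0 o1 + Bu o1 o4 * y 0 o2 - Bu o3 o4 * y 0 o4) &
     X 0 o4 = Bv o1 o4 * x 0 o1 - Bv o1 o3 * x 0 o2 + Bv o3 o4 * x 0 o3
       - (Bu o1 o4 * y 0 o1 - Bu o1 o3 * y 0 o2 + Bu o3 o4 * y 0 o3)] /\
  [/\ Y o1 o2 = - 4 * a ^+ 2 * w2 x y o1 o2 + 2 * a ^+ 2 * w2 x y o3 o4
        + 2 * (Bv o1 o3 * Bu o1 o4 - Bu o1 o3 * Bv o1 o4),
     Y o1 o3 = a ^+ 2 * (w2 x y o2 o4 - w2 x y o1 o3)
        - (Bv o1 o2 * Bu o1 o4 - Bv o1 o4 * Bu o3 o4 - (Bu o1 o2 * Bv o1 o4 - Bu o1 o4 * Bv o3 o4)),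
     Y o1 o4 = - a ^+ 2 * (w2 x y o1 o4 + w2 x y o2 o3)
        - (- (Bv o1 o2 * Bu o1 o3) + Bv o1 o3 * Bu o3 o4 - (- (Bu o1 o2 * Bv o1 o3) + Bu o1 o3 * Bv o3 o4)) &
     Y o3 o4 = a ^+ 2 * (2 * w2 x y o1 o2 - 4 * w2 x y o3 o4)
        + 2 * (Bv o1 o3 * Bu o1 o4 - Bu o1 o3 * Bv o1 o4)].
Proof.
have [[u11 u22 u33 u44] [u21 u31 u41 u43] [u23 u32 u24 u42]] := unitary_entries uBu.
have [[v11 v22 v33 v44] [v21 v31 v41 v43] [v23 v32 v24 v42]] := unitary_entries uBv.
have [T12 T13 T14 T34] := Tcp.
rewrite !XE !YE T12 T13 T14 T34 !sum4 u11 u22 u33 u44 u21 u31 u41 u43 u23 u32 u24 u42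
  v11 v22 v33 v44 v21 v31 v41 v43 v23 v32 v24 v42.
by split; [ring|split; split; ring].
Qed.

Lemma cp_flat_re : cp_re X Y + (cp_re x Bu *m cp_re y Bv - cp_im x Bu *m cp_im y Bv -
  (cp_re y Bv *m cp_re x Bu - cp_im y Bv *m cp_im x Bu)) = 0.
Proof.
have [E1 [[E2 E3 E4] [Y12 Y13 Y14 Y34]]] := cp_entries.
have S (P1 P2 P3 P4 P5 P6 P7 P8 P9 : 'M[R]_3) i j :
  (P1 + (P2 *m P3 - P4 *m P5 - (P6 *m P7 - P8 *m P9))) i j = P1 i j +
    (\sum_k P2 i k * P3 k j - \sum_k P4 i k * P5 k j -
    (\sum_k P6 i k * P7 k j - \sum_k P8 i k * P9 k j)) by rewrite !mxE.
apply/matrixP => i j; rewrite S !sum3 ![cp_re _ _ _ _]mxE ![cp_im _ _ _ _]mxE [RHS]mxE.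
move: i; apply: ord3_ind; move: j; apply: ord3_ind => /=;
  rewrite ?E1 ?E2 ?E3 ?E4 ?Y12 ?Y13 ?Y14 ?Y34 /w2; by field.
Qed.

Lemma cp_flat_im : cp_im X Y + (cp_re x Bu *m cp_im y Bv + cp_im x Bu *m cp_re y Bv -
  (cp_re y Bv *m cp_im x Bu + cp_im y Bv *m cp_re x Bu)) = 0.
Proof.
have [E1 [[E2 E3 E4] [Y12 Y13 Y14 Y34]]] := cp_entries.
have S (P1 P2 P3 P4 P5 P6 P7 P8 P9 : 'M[R]_3) i j :
  (P1 + (P2 *m P3 + P4 *m P5 - (P6 *m P7 + P8 *m P9))) i j = P1 i j +
    (\sum_k P2 i k * P3 k j + \sum_k P4 i k * P5 k j -
    (\sum_k P6 i k * P7 k j + \sum_k P8 i k * P9 k j)) by rewrite !mxE.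
apply/matrixP => i j; rewrite S !sum3 ![cp_re _ _ _ _]mxE ![cp_im _ _ _ _]mxE [RHS]mxE.
move: i; apply: ord3_ind; move: j; apply: ord3_ind => /=;
  rewrite ?E1 ?E2 ?E3 ?E4 ?Y12 ?Y13 ?Y14 ?Y34 /w2; by field.
Qed.

Lemma cp_flat : cplx (cp_re X Y) (cp_im X Y) +
  (cplx (cp_re x Bu) (cp_im x Bu) *m cplx (cp_re y Bv) (cp_im y Bv) -
   cplx (cp_re y Bv) (cp_im y Bv) *m cplx (cp_re x Bu) (cp_im x Bu)) = 0.
Proof.
move: cp_flat_re cp_flat_im; rewrite /cplx.
move: (cp_re X Y) (cp_im X Y) (cp_re x Bu) (cp_im x Bu) (cp_re y Bv) (cp_im y Bv).
move=> P Q P1 Q1 P2 Q2 E1 E2.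
rewrite !mulmx_block !mulmxN !mulNmx opp_block_mx !add_block_mx -block_mx0.
have E3 : Q + (Q1 *m P2 + P1 *m Q2 - (Q2 *m P1 + P2 *m Q1)) = 0.
  by rewrite -[RHS]E2 [Q1 *m P2 + _]addrC [Q2 *m P1 + _]addrC.
congr block_mx => //.
  by rewrite -[RHS]oppr0 -E2 !opprD !opprK.
by rewrite -[RHS]E1 [- (Q1 *m Q2) + _]addrC [- (Q2 *m Q1) + _]addrC.
Qed.

End Flat.
End CartanAlgebra.

Lemma constant_on_ball (R : realType) (V : normedModType R) m n (p0 : V) (r : R) (G : V -> 'M[R]_(m, n)) : 0 < r ->
  (forall q, ball p0 r q -> differentiable G q /\ forall v, 'D_v G q = 0) ->
  forall q, ball p0 r q -> G q = G p0.
Proof.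
move=> r0 dG q qr; apply/matrixP => i j; apply/eqP; rewrite -subr_eq0; apply/eqP.
have lt1 t : 0 <= t <= 1 -> ball p0 r (p0 + t *: (q - p0)) by apply: ball_convex => //; exact: ballxx.
have [|t t01] := @mvt_line _ _ (fun x => G x i j) p0 (q - p0).
  by move=> t t01; apply: differentiable_entry; have [] := dG _ (lt1 t t01).
rewrite [p0 + _]addrC subrK => ->; have [d D] := dG _ (lt1 t t01).
by rewrite -(derive_entry _ i j d) D mxE.
Qed.

(** * The Fubini-Study metric in homogeneous coordinates *)

Section FubiniStudy.
Variables (R : realType).
Notation vec := 'rV[R]_4.

Lemma fubini_studyE (c : R) (w u v : vec) (s := 1 + pair1 w w) :
  bil (fubini_study c w) u v =
  4 / c / s ^+ 2 * (s * dot u v - pair1 w u * pair1 w v - pair1 (mul_i w) u * pair1 (mul_i w) v).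
Proof.
rewrite -2!bil_outer /bil /fubini_study -/s -scalemxAr -scalemxAl [LHS]mxE.
have S (X Y Z : 'M[R]_1) : (X - Y - Z) 0 0 = X 0 0 - Y 0 0 - Z 0 0 by rewrite !mxE.
rewrite !mulmxBr !mulmxBl S mul_mx_scalar -scalemxAl; congr (_ * (_ - _ - _)).
by rewrite [LHS]mxE.
Qed.

(* For Z = (Z0, Z1, Z2) in C^3 with w = (Z0 / Z1, Z2 / Z1), both sides are the
   pull-back of the Fubini-Study metric multiplied by |Z|^4. *)
Lemma projective_gram (x0 y0 x1 y1 x2 y2 p0 q0 p2 q2 : R)
    (X0 Y0 X1 Y1 X2 Y2 P0 Q0 P2 Q2 X0' Y0' X1' Y1' X2' Y2' P0' Q0' P2' Q2' : R)
    (r1 := x1 ^+ 2 + y1 ^+ 2) (s := 1 + (p0 * p0 + q0 * q0 + p2 * p2 + q2 * q2)) :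
  x0 = x1 * p0 - y1 * q0 -> y0 = x1 * q0 + y1 * p0 ->
  x2 = x1 * p2 - y1 * q2 -> y2 = x1 * q2 + y1 * p2 ->
  X0 = X1 * p0 + x1 * P0 - (Y1 * q0 + y1 * Q0) -> Y0 = X1 * q0 + x1 * Q0 + (Y1 * p0 + y1 * P0) ->
  X2 = X1 * p2 + x1 * P2 - (Y1 * q2 + y1 * Q2) -> Y2 = X1 * q2 + x1 * Q2 + (Y1 * p2 + y1 * P2) ->
  X0' = X1' * p0 + x1 * P0' - (Y1' * q0 + y1 * Q0') -> Y0' = X1' * q0 + x1 * Q0' + (Y1' * p0 + y1 * P0') ->
  X2' = X1' * p2 + x1 * P2' - (Y1' * q2 + y1 * Q2') -> Y2' = X1' * q2 + x1 * Q2' + (Y1' * p2 + y1 * P2') ->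
  r1 ^+ 2 * (s * (P0 * P0' + Q0 * Q0' + P2 * P2' + Q2 * Q2')
    - (p0 * P0 + q0 * Q0 + p2 * P2 + q2 * Q2) * (p0 * P0' + q0 * Q0' + p2 * P2' + q2 * Q2')
    - (- q0 * P0 + p0 * Q0 - q2 * P2 + p2 * Q2) * (- q0 * P0' + p0 * Q0' - q2 * P2' + p2 * Q2')) =
  (x0 ^+ 2 + y0 ^+ 2 + (x1 ^+ 2 + y1 ^+ 2) + (x2 ^+ 2 + y2 ^+ 2)) *
    (X0 * X0' + Y0 * Y0' + (X1 * X1' + Y1 * Y1') + (X2 * X2' + Y2 * Y2'))
  - (x0 * X0 + y0 * Y0 + (x1 * X1 + y1 * Y1) + (x2 * X2 + y2 * Y2)) *
    (x0 * X0' + y0 * Y0' + (x1 * X1' + y1 * Y1') + (x2 * X2' + y2 * Y2'))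
  - (x0 * Y0 - y0 * X0 + (x1 * Y1 - y1 * X1) + (x2 * Y2 - y2 * X2)) *
    (x0 * Y0' - y0 * X0' + (x1 * Y1' - y1 * X1') + (x2 * Y2' - y2 * X2')) /\
  r1 * s = x0 ^+ 2 + y0 ^+ 2 + (x1 ^+ 2 + y1 ^+ 2) + (x2 ^+ 2 + y2 ^+ 2).
Proof.
rewrite /r1 /s => -> -> -> -> -> -> -> -> -> -> -> ->; split; ring.
Qed.

End FubiniStudy.

Section ProjectiveChart.
Variables (R : realType).
Notation vec := 'rV[R]_4.
Variables (V : set vec) (x0 y0 x1 y1 x2 y2 : vec -> R).
Hypothesis oV : open V.
Hypothesis Cx0 : forall k, Ck k V (fun q => x0 q).
Hypothesis Cy0 : forall k, Ck k V (fun q => y0 q).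
Hypothesis Cx1 : forall k, Ck k V (fun q => x1 q).
Hypothesis Cy1 : forall k, Ck k V (fun q => y1 q).
Hypothesis Cx2 : forall k, Ck k V (fun q => x2 q).
Hypothesis Cy2 : forall k, Ck k V (fun q => y2 q).
Hypothesis n1 : forall q, V q -> x1 q * x1 q + y1 q * y1 q != 0.

(** Real part of the complex quotient (x + i y) / (x1 + i y1); [chart_im] is the imaginary part. The
    denominator is the middle homogeneous coordinate. *)
Definition chart_re (x y : vec -> R) q := (x q * x1 q + y q * y1 q) * (x1 q * x1 q + y1 q * y1 q)^-1.
Definition chart_im (x y : vec -> R) q := (y q * x1 q - x q * y1 q) * (x1 q * x1 q + y1 q * y1 q)^-1.
Definition chart (q : vec) : vec :=
  \row_j [:: chart_re x0 y0 q; chart_im x0 y0 q; chart_re x2 y2 q; chart_im x2 y2 q]`_j.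

Let n1_smooth k : Ck k V (fun q => (x1 q * x1 q + y1 q * y1 q)^-1).
Proof.
apply: Ck_inv => //; have c1 := Cx1 k; have d1 := Cy1 k; smooth_tac.
Qed.

Lemma chart_re_smooth k x y : Ck k V (fun q => x q) -> Ck k V (fun q => y q) -> Ck k V (fun q => chart_re x y q).
Proof.
move=> cx cy; have c1 := Cx1 k; have d1 := Cy1 k; have i1 := n1_smooth k.
by apply: (@Ck_mul _ _ _ _ _ _ oV _ i1); smooth_tac.
Qed.

Lemma chart_im_smooth k x y : Ck k V (fun q => x q) -> Ck k V (fun q => y q) -> Ck k V (fun q => chart_im x y q).
Proof.
move=> cx cy; have c1 := Cx1 k; have d1 := Cy1 k; have i1 := n1_smooth k.
by apply: (@Ck_mul _ _ _ _ _ _ oV _ i1); smooth_tac.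
Qed.

Lemma chartE q : [/\ chart q 0 o1 = chart_re x0 y0 q, chart q 0 o2 = chart_im x0 y0 q,
  chart q 0 o3 = chart_re x2 y2 q & chart q 0 o4 = chart_im x2 y2 q].
Proof. by split; rewrite mxE. Qed.

Lemma chart_smooth : smooth V chart.
Proof.
move=> k; apply: Ck_mx => // i; rewrite (ord1 i) {i}; apply: ord4_ind.
- by apply: Ck_ext (chart_re_smooth (Cx0 k) (Cy0 k)) => // q _; have [] := chartE q.
- by apply: Ck_ext (chart_im_smooth (Cx0 k) (Cy0 k)) => // q _; have [] := chartE q.
- by apply: Ck_ext (chart_re_smooth (Cx2 k) (Cy2 k)) => // q _; have [] := chartE q.
- by apply: Ck_ext (chart_im_smooth (Cx2 k) (Cy2 k)) => // q _; have [] := chartE q.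
Qed.

Lemma chart_derive q u : V q -> [/\ 'D_u chart q 0 o1 = 'D_u (chart_re x0 y0) q,
  'D_u chart q 0 o2 = 'D_u (chart_im x0 y0) q, 'D_u chart q 0 o3 = 'D_u (chart_re x2 y2) q &
  'D_u chart q 0 o4 = 'D_u (chart_im x2 y2) q].
Proof.
move=> Vq; have [/(_ q Vq) dc _] := chart_smooth 1.
by split; rewrite (derive_entry u _ _ dc); congr ('D_u _ q); apply/funext => p; have [] := chartE p.
Qed.

Lemma chart_lift q x y : V q -> x q = x1 q * chart_re x y q - y1 q * chart_im x y q /\
  y q = x1 q * chart_im x y q + y1 q * chart_re x y q.
Proof.
move=> /n1; rewrite /chart_re /chart_im; move: (x q) (y q) (x1 q) (y1 q) => a b c d n0.
by split; field.
Qed.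

(** Differentiating the product Z = Z1 w rather than the quotient yields the relations that
    [projective_gram] takes as hypotheses. *)
Lemma chart_lift_derive q u x y : V q -> Ck 1 V (fun q => x q) -> Ck 1 V (fun q => y q) ->
  'D_u x q = 'D_u x1 q * chart_re x y q + x1 q * 'D_u (chart_re x y) q
     - ('D_u y1 q * chart_im x y q + y1 q * 'D_u (chart_im x y) q) /\
  'D_u y q = 'D_u x1 q * chart_im x y q + x1 q * 'D_u (chart_im x y) q
     + ('D_u y1 q * chart_re x y q + y1 q * 'D_u (chart_re x y) q).
Proof.
move=> Vq Cx Cy.
have D f : Ck 1 V f -> has_deriv f q u ('D_u f q) by move=> [df _]; split => //; exact: df.
have r := D _ (chart_re_smooth Cx Cy); have i := D _ (chart_im_smooth Cx Cy).
have d1 := D _ (Cx1 1); have e1 := D _ (Cy1 1).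
split.
  have <- : 'D_u (fun q => x1 q * chart_re x y q - y1 q * chart_im x y q) q = 'D_u x q.
    by apply: near_eq_derive; apply: (@near_open _ _ V) => // p Vp; have [<- _] := chart_lift x y Vp.
  by have [_ ->] := has_deriv_add (has_deriv_mul d1 r) (has_deriv_opp (has_deriv_mul e1 i)).
have <- : 'D_u (fun q => x1 q * chart_im x y q + y1 q * chart_re x y q) q = 'D_u y q.
  by apply: near_eq_derive; apply: (@near_open _ _ V) => // p Vp; have [_ <-] := chart_lift x y Vp.
by have [_ ->] := has_deriv_add (has_deriv_mul d1 i) (has_deriv_mul e1 r).
Qed.

Lemma scaled_gram (k r s z G N f1 f2 j : R) : r ^+ 2 * z = N * G - f1 * f2 - j -> r * s = N ->
  N = 1 -> f1 = 0 -> k / s ^+ 2 * z = k * (G - j).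
Proof.
move=> E rs N1 f10; move: E rs; rewrite N1 f10 mul0r subr0 mul1r => <- rs.
have s0 : s != 0 by apply: contra_eq_neq rs => ->; rewrite mulr0 eq_sym oner_neq0.
have -> : r = s^-1 by rewrite -[LHS](mulfK s0) rs mul1r.
by field.
Qed.

(** For a lift Z of unit length, Re <Z, dZ> vanishes, and the metric becomes the one induced by the
    Hopf fibration: |dZ|^2 minus the square of Im <Z, dZ>, scaled by 4 / c. *)
Lemma chart_metric c q u v : V q ->
  x0 q ^+ 2 + y0 q ^+ 2 + (x1 q ^+ 2 + y1 q ^+ 2) + (x2 q ^+ 2 + y2 q ^+ 2) = 1 ->
  x0 q * 'D_u x0 q + y0 q * 'D_u y0 q + (x1 q * 'D_u x1 q + y1 q * 'D_u y1 q)
    + (x2 q * 'D_u x2 q + y2 q * 'D_u y2 q) = 0 ->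
  bil (fubini_study c (chart q)) ('D_u chart q) ('D_v chart q) = 4 / c *
   ('D_u x0 q * 'D_v x0 q + 'D_u y0 q * 'D_v y0 q + ('D_u x1 q * 'D_v x1 q + 'D_u y1 q * 'D_v y1 q)
     + ('D_u x2 q * 'D_v x2 q + 'D_u y2 q * 'D_v y2 q) -
   (x0 q * 'D_u y0 q - y0 q * 'D_u x0 q + (x1 q * 'D_u y1 q - y1 q * 'D_u x1 q)
     + (x2 q * 'D_u y2 q - y2 q * 'D_u x2 q)) *
   (x0 q * 'D_v y0 q - y0 q * 'D_v x0 q + (x1 q * 'D_v y1 q - y1 q * 'D_v x1 q)
     + (x2 q * 'D_v y2 q - y2 q * 'D_v x2 q))).
Proof.
move=> Vq N1 f1; have [l0 m0] := chart_lift x0 y0 Vq; have [l2 m2] := chart_lift x2 y2 Vq.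
have [du0 eu0] := chart_lift_derive u Vq (Cx0 1) (Cy0 1).
have [du2 eu2] := chart_lift_derive u Vq (Cx2 1) (Cy2 1).
have [dv0 ev0] := chart_lift_derive v Vq (Cx0 1) (Cy0 1).
have [dv2 ev2] := chart_lift_derive v Vq (Cx2 1) (Cy2 1).
have [G rs] := projective_gram l0 m0 l2 m2 du0 eu0 du2 eu2 dv0 ev0 dv2 ev2.
rewrite fubini_studyE; apply: etrans (scaled_gram (4 / c) G rs N1 f1).
have P (s t : vec) : pair1 s t = s 0 o1 * t 0 o1 + s 0 o2 * t 0 o2 + s 0 o3 * t 0 o3 + s 0 o4 * t 0 o4.
  by rewrite /pair1 mxE sum4 ![t^T _ _]mxE.
have E (w Du Dv : vec) (p0 q0 p2 q2 P0 Q0 P2 Q2 P0' Q0' P2' Q2' : R) :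
    [/\ w 0 o1 = p0, w 0 o2 = q0, w 0 o3 = p2 & w 0 o4 = q2] ->
    [/\ Du 0 o1 = P0, Du 0 o2 = Q0, Du 0 o3 = P2 & Du 0 o4 = Q2] ->
    [/\ Dv 0 o1 = P0', Dv 0 o2 = Q0', Dv 0 o3 = P2' & Dv 0 o4 = Q2'] ->
    4 / c / (1 + pair1 w w) ^+ 2 * ((1 + pair1 w w) * dot Du Dv - pair1 w Du * pair1 w Dv -
      pair1 (mul_i w) Du * pair1 (mul_i w) Dv) =
    4 / c / (1 + (p0 * p0 + q0 * q0 + p2 * p2 + q2 * q2)) ^+ 2 *
    ((1 + (p0 * p0 + q0 * q0 + p2 * p2 + q2 * q2)) * (P0 * P0' + Q0 * Q0' + P2 * P2' + Q2 * Q2')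
    - (p0 * P0 + q0 * Q0 + p2 * P2 + q2 * Q2) * (p0 * P0' + q0 * Q0' + p2 * P2' + q2 * Q2')
    - (- q0 * P0 + p0 * Q0 - q2 * P2 + p2 * Q2) * (- q0 * P0' + p0 * Q0' - q2 * P2' + p2 * Q2')).
  case=> w1 w3 w4 w5 [u1 u3 u4 u5] [v1 v3 v4 v5].
  rewrite !P dotE sum4 ![mul_i _ 0 _]mxE /= w1 w3 w4 w5 u1 u3 u4 u5 v1 v3 v4 v5.
  by rewrite !mulNr.
exact: E (chartE q) (chart_derive u Vq) (chart_derive v Vq).
Qed.

End ProjectiveChart.

(** * The flat connection and the local isometry with the projective plane *)

Section ProjectiveCoframe.
Variables (R : realType) (a : R).
Notation vec := 'rV[R]_4.
Variables (M : set vec) (C : vec -> 'M[R]_4) (A : vec -> vec -> 'M[R]_4).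
Hypothesis oM : open M.
Hypothesis Csmooth : forall k, Ck k M C.
Hypothesis Asmooth : forall k u, Ck k M (A ^~ u).
Hypothesis Alin : forall q k u v, A q (k *: u + v) = k *: A q u + A q v.
Hypothesis Aunitary : forall q u, M q -> unitary_form (A q u).
Hypothesis torsion_free : forall q u v, M q ->
  v *m 'D_u C q + v *m C q *m A q u = u *m 'D_v C q + u *m C q *m A q v.
Hypothesis Acurv : forall q u v, M q ->
  cp_curvature a (u *m C q) (v *m C q) (curvature_form A q u v).

Definition om q u := cplx (cp_re a (u *m C q) (A q u)) (cp_im a (u *m C q) (A q u)).

Lemma om_lin q k u v : om q (k *: u + v) = k *: om q u + om q v.
Proof.
rewrite /om mulmxDl -scalemxAl Alin cp_re_lin cp_im_lin /cplx scale_block_mx add_block_mx.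
by rewrite scalerN opprD.
Qed.

Lemma om_smooth k v : Ck k M (om ^~ v).
Proof.
have CC j : Ck k M (fun q => (v *m C q) 0 j).
  by apply: Ck_entry => //; apply: Ck_mulmx => //; exact: Ck_cst.
have CA i j : Ck k M (fun q => A q v i j) by apply: Ck_entry.
have c1 := CC o1; have c2 := CC o2; have c3 := CC o3; have c4 := CC o4.
have a12 := CA o1 o2; have a13 := CA o1 o3; have a14 := CA o1 o4; have a34 := CA o3 o4.
have re : Ck k M (fun q => cp_re a (v *m C q) (A q v)).
  apply: Ck_mx => // i j; move: i; apply: ord3_ind; move: j; apply: ord3_ind;
    under [X in Ck _ _ X]eq_fun => q do rewrite mxE /=; smooth_tac.
have im : Ck k M (fun q => cp_im a (v *m C q) (A q v)).
  apply: Ck_mx => // i j; move: i; apply: ord3_ind; move: j; apply: ord3_ind;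
    under [X in Ck _ _ X]eq_fun => q do rewrite mxE /=; smooth_tac.
by apply: Ck_block => //; exact: Ck_opp.
Qed.

Lemma om_derive q u v : M q -> 'D_u (om ^~ v) q =
  cplx (cp_re a (v *m 'D_u C q) ('D_u (A ^~ v) q)) (cp_im a (v *m 'D_u C q) ('D_u (A ^~ v) q)).
Proof.
move=> Mq; have [/(_ q Mq) dC _] := Csmooth 1; have [/(_ q Mq) dA _] := Asmooth 1 v.
have CC j : has_deriv (fun p => (v *m C p) 0 j) q u ((v *m 'D_u C q) 0 j).
  have dv : differentiable (fun p => v *m C p) q by apply: differentiable_mulmx.
  split; first exact: differentiable_entry.
  by rewrite -(derive_entry u 0 j dv) derive_mulmx// derive_const mul0mx add0r.
have CA i j : has_deriv (fun p => A p v i j) q u ('D_u (A ^~ v) q i j).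
  by split; [exact: (differentiable_entry i j dA)|rewrite -(derive_entry u i j dA)].
have c1 := CC o1; have c2 := CC o2; have c3 := CC o3; have c4 := CC o4.
have a12 := CA o1 o2; have a13 := CA o1 o3; have a14 := CA o1 o4; have a34 := CA o3 o4.
have re i j : has_deriv (fun p => cp_re a (v *m C p) (A p v) i j) q u
    (cp_re a (v *m 'D_u C q) ('D_u (A ^~ v) q) i j).
  move: i; apply: ord3_ind; move: j; apply: ord3_ind;
    under [X in has_deriv X]eq_fun => p do rewrite mxE /=;
    rewrite [X in has_deriv _ _ _ X]mxE /=; (apply: has_deriv_eq; first by deriv);
    rewrite /= ?mul0r ?add0r ?oppr0 //.
have im i j : has_deriv (fun p => cp_im a (v *m C p) (A p v) i j) q u
    (cp_im a (v *m 'D_u C q) ('D_u (A ^~ v) q) i j).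
  move: i; apply: ord3_ind; move: j; apply: ord3_ind;
    under [X in has_deriv X]eq_fun => p do rewrite mxE /=;
    rewrite [X in has_deriv _ _ _ X]mxE /=; (apply: has_deriv_eq; first by deriv);
    rewrite /= ?mul0r ?add0r ?oppr0 //.
have dre : differentiable (fun p => cp_re a (v *m C p) (A p v)) q.
  by apply: differentiable_mx => i j; have [] := re i j.
have dim : differentiable (fun p => cp_im a (v *m C p) (A p v)) q.
  by apply: differentiable_mx => i j; have [] := im i j.
have Dre : 'D_u (fun p => cp_re a (v *m C p) (A p v)) q = cp_re a (v *m 'D_u C q) ('D_u (A ^~ v) q).
  by apply/matrixP => i j; rewrite (derive_entry u i j dre); have [] := re i j.
have Dim : 'D_u (fun p => cp_im a (v *m C p) (A p v)) q = cp_im a (v *m 'D_u C q) ('D_u (A ^~ v) q).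
  by apply/matrixP => i j; rewrite (derive_entry u i j dim); have [] := im i j.
rewrite /om /cplx derive_block//; last exact: differentiableN.
rewrite Dre Dim; congr block_mx; rewrite -Dim.
by rewrite (@deriveN _ _ _ (fun p => cp_im a (v *m C p) (A p v)))//; exact: diff_derivable.
Qed.

Lemma cplxB (P Q P' Q' : 'M[R]_3) : cplx P Q - cplx P' Q' = cplx (P - P') (Q - Q').
Proof. by rewrite /cplx opp_block_mx add_block_mx opprB opprK addrC [in RHS]addrC; congr block_mx; rewrite addrC. Qed.

Lemma om_flat q u v : M q ->
  'D_u (om ^~ v) q - 'D_v (om ^~ u) q + (om q u *m om q v - om q v *m om q u) = 0.
Proof.
move=> Mq; rewrite !om_derive// cplxB.
rewrite -(cp_flat (Aunitary u Mq) (Aunitary v Mq) (Acurv u v Mq)).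
have lre x y (B T : 'M[R]_4) : cp_re a x B - cp_re a y T = cp_re a (x - y) (B - T).
  by rewrite addrC -scaleN1r -cp_re_lin !scaleN1r ![- _ + _]addrC.
have lim x y (B T : 'M[R]_4) : cp_im a x B - cp_im a y T = cp_im a (x - y) (B - T).
  by rewrite addrC -scaleN1r -cp_im_lin !scaleN1r ![- _ + _]addrC.
rewrite lre lim /om.
have -> : v *m 'D_u C q - u *m 'D_v C q = u *m C q *m A q v - v *m C q *m A q u.
  by apply/eqP; rewrite subr_eq addrAC eq_sym subr_eq eq_sym; apply/eqP; rewrite torsion_free// addrC.
have -> : 'D_u (A ^~ v) q - 'D_v (A ^~ u) q =
    curvature_form A q u v - (A q v *m A q u - A q u *m A q v) by rewrite /curvature_form addrK.
by [].
Qed.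

(** Multiplication by i on C^3 = R^6, real parts first; a real matrix is of the form [cplx P Q]
    exactly when it commutes with it. *)
Definition Jmx : 'M[R]_(3 + 3) := block_mx 0 (- 1%:M) 1%:M 0.

Lemma Jmx_comm q u : om q u *m Jmx = Jmx *m om q u.
Proof.
by rewrite /om /cplx /Jmx !mulmx_block !(mulmx0, mul0mx, mulmx1, mul1mx, mulmxN, mulNmx, addr0, add0r, opprK).
Qed.

Lemma om_skew q u : (om q u)^T = - om q u.
Proof.
have reT x B : (cp_re a x B)^T = - cp_re a x B.
  apply/matrixP => i j; rewrite !mxE; move: i; apply: ord3_ind; move: j; apply: ord3_ind => /=;
    by rewrite ?opprK ?oppr0.
have imT x B : (cp_im a x B)^T = cp_im a x B.
  by apply/matrixP => i j; rewrite !mxE; move: i; apply: ord3_ind; move: j; apply: ord3_ind.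
by rewrite /om /cplx tr_block_mx opp_block_mx linearN /= reT imT opprK.
Qed.

(** F F^T and F J F^T have zero derivative, as [om] is skew and commutes with [Jmx]; their values at
    [p] show that F is orthogonal and complex linear, that is, unitary. *)
Lemma unitary_frame p : M p -> exists (r : R) (F : vec -> 'M[R]_(3 + 3)),
  [/\ 0 < r, ball p r `<=` M, F p = 1%:M &
   [/\ forall k, Ck k (ball p r) F,
      forall q v, ball p r q -> 'D_v F q = F q *m om q v &
      forall q, ball p r q -> (F q)^T *m F q = 1%:M /\ Jmx *m F q = F q *m Jmx]].
Proof.
move=> Mp.
have [r [F [r0 rM F1 FE]]] := flat_connection_frame oM Mp om_lin (fun v k => om_smooth k v) om_flat.
exists r, F; split => //.
have ob : open (ball p r) by exact: ball_open.
have dF q : ball p r q -> differentiable F q by move=> /FE[].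
have DF q v : ball p r q -> 'D_v F q = F q *m om q v by move=> /FE[].
have dFT q v (qr : ball p r q) := derive_trmx v (dF q qr).
have FT q : ball p r q -> (F q)^T *m F q = 1%:M /\ Jmx *m F q = F q *m Jmx.
  move=> qr.
  have FFT : F q *m (F q)^T = 1%:M.
    rewrite (@constant_on_ball _ _ _ _ p r (fun q => F q *m (F q)^T) r0)//.
      by rewrite F1 trmx1 mulmx1.
    move=> q' qr'; split=> [|v]; first by apply: differentiable_mulmx; [exact: dF|have [] := dFT q' 0 qr'].
    have [dT DT] := dFT q' v qr'.
    by rewrite (derive_mulmx v (dF q' qr') dT) DT DF// trmx_mul om_skew mulNmx mulmxN mulmxA subrr.
  have FJF : F q *m Jmx *m (F q)^T = Jmx.
    rewrite (@constant_on_ball _ _ _ _ p r (fun q => F q *m Jmx *m (F q)^T) r0)//.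
      by rewrite F1 trmx1 mulmx1 mul1mx.
    move=> q' qr'; have dJ : differentiable (fun q => F q *m Jmx) q'.
      by apply: differentiable_mulmx; [exact: dF|exact: differentiable_cst].
    split=> [|v]; first by apply: differentiable_mulmx => //; have [] := dFT q' 0 qr'.
    have [dT DT] := dFT q' v qr'.
    rewrite (derive_mulmx v dJ dT) DT (derive_mulmx v (dF q' qr') (differentiable_cst _ q')).
    rewrite derive_const mulmx0 addr0 DF// trmx_mul om_skew mulNmx mulmxN.
    by rewrite -!mulmxA [om q' v *m (Jmx *m _)]mulmxA Jmx_comm !mulmxA subrr.
  have FTF : (F q)^T *m F q = 1%:M by exact: mulmx1C.
  by split=> //; rewrite -[in LHS]FJF -!mulmxA FTF mulmx1.
(* Bootstrap: dF = F om with [om] smooth, so regularity of order [k] of F gives order k + 1. *)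
split => // k; elim: k => [|k IH].
  by move=> q qr; apply: differentiable_continuous; exact: dF.
split=> [q qr|v]; first exact: dF.
apply: (Ck_ext ob (f := fun q => F q *m om q v)) => [q qr|]; first by rewrite DF.
by apply: Ck_mulmx => //; apply: Ck_sub (om_smooth k v).
Qed.

Let e1 : 'cV[R]_(3 + 3) := delta_mx (lshift 3 k1) 0.

Lemma dot_split (c d : 'cV[R]_(3 + 3)) : (c^T *m d) 0 0 =
  c (lshift 3 k0) 0 * d (lshift 3 k0) 0 + c (rshift 3 k0) 0 * d (rshift 3 k0) 0 +
  (c (lshift 3 k1) 0 * d (lshift 3 k1) 0 + c (rshift 3 k1) 0 * d (rshift 3 k1) 0) +
  (c (lshift 3 k2) 0 * d (lshift 3 k2) 0 + c (rshift 3 k2) 0 * d (rshift 3 k2) 0).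
Proof.
rewrite mxE big_split_ord /= !sum3 ![c^T _ _]mxE.
have S (p1 p2 p3 q1 q2 q3 : R) : p1 + p2 + p3 + (q1 + q2 + q3) = p1 + q1 + (p2 + q2) + (p3 + q3) by ring.
exact: S.
Qed.

Lemma Jmx_entries (c : 'cV[R]_(3 + 3)) k : (Jmx *m c) (lshift 3 k) 0 = - c (rshift 3 k) 0 /\
  (Jmx *m c) (rshift 3 k) 0 = c (lshift 3 k) 0.
Proof.
rewrite -[c]vsubmxK /Jmx mul_block_col !(mul0mx, mulNmx, mul1mx, add0r, addr0).
by rewrite !(col_mxEu, col_mxEd) [in LHS]mxE.
Qed.

(** Outside the complex line of e_1 the column is a times (theta1 + i theta2, theta4 + i theta3), a
    unitary coframe; along that line its real part vanishes. *)
Lemma om_e1 q u : let c := om q u *m e1 in let x := u *m C q in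
  [/\ c (lshift 3 k0) 0 = a * x 0 o1, c (lshift 3 k1) 0 = 0, c (lshift 3 k2) 0 = a * x 0 o4,
      c (rshift 3 k0) 0 = a * x 0 o2 & c (rshift 3 k2) 0 = a * x 0 o3].
Proof.
have E k : (om q u *m e1) k 0 = om q u k (lshift 3 k1) by rewrite /e1 -colE mxE.
move=> c x; rewrite /c !E /om /cplx !block_mxEul !block_mxEdl.
by rewrite ![cp_re _ _ _ _ _]mxE ![cp_im _ _ _ _ _]mxE.
Qed.

Hypothesis a0 : a != 0.
Variable g : vec -> 'M[R]_4.
Hypothesis gE : forall q, g q = C q *m (C q)^T.
Hypothesis Cunit : forall q, M q -> C q \in unitmx.

(** The lift is Z = F e_1, with dZ = F om e_1. As F is unitary, the Hermitian products of Z and dZ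
    are those of e_1 and om e_1, so the component of om e_1 along i e_1 drops out and the rest
    contributes a^2 g. *)
Lemma projective_isometry : locally_isometric M g (fubini_study (4 * a ^+ 2)).
Proof.
move=> p Mp; have [r [F [r0 rM F1 [FC DF FU]]]] := unitary_frame Mp.
have ob : open (ball p r) by exact: ball_open.
pose psi q := F q *m e1.
pose x k q : R := psi q (lshift 3 k) 0; pose y k q : R := psi q (rshift 3 k) 0.
have psiC k : Ck k (ball p r) psi by apply: Ck_mulmx => //; exact: Ck_cst.
have xC k j : Ck k (ball p r) (fun q => x j q) by exact: Ck_entry.
have yC k j : Ck k (ball p r) (fun q => y j q) by exact: Ck_entry.
have Dpsi q u : ball p r q -> (forall j, 'D_u (x j) q = (F q *m (om q u *m e1)) (lshift 3 j) 0) /\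
    (forall j, 'D_u (y j) q = (F q *m (om q u *m e1)) (rshift 3 j) 0).
  move=> qr; have [/(_ q qr) dpsi _] := psiC 1; have [/(_ q qr) dF _] := FC 1.
  have E : 'D_u psi q = F q *m (om q u *m e1).
    by rewrite (derive_mulmx u dF (differentiable_cst e1 q)) derive_const mulmx0 addr0 DF// mulmxA.
  by split=> j; rewrite -E (derive_entry u _ _ dpsi).
pose n q := x k1 q * x k1 q + y k1 q * y k1 q.
have nC : Ck 0 (ball p r) n.
  have c1 := xC 0 k1; have d1 := yC 0 k1; rewrite /n; smooth_tac.
(* The affine chart divides by the middle coordinate of Z, which is 1 at [p] because F is the
   identity there. *)
pose V0 := ball p r `&` [set q | n q != 0].
have oV0 : open V0.
  rewrite openE => q [qr n0]; apply: filterI; first exact: open_nbhs_nbhs.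
  have cn : n @ q --> n q := nC q qr.
  exact: (cvgr_neq0 _ cn n0).
have V0r : V0 `<=` ball p r by move=> q [].
have Vp : V0 p.
  split; first exact: ballxx.
  rewrite /= /n /x /y /psi F1 mul1mx /e1 !mxE eqxx /=.
  by rewrite mulr0 addr0 mulr1 oner_neq0.
have x_C j k : Ck k V0 (fun q => x j q) := Ck_sub V0r (xC k j).
have y_C j k : Ck k V0 (fun q => y j q) := Ck_sub V0r (yC k j).
have nV q : V0 q -> x k1 q * x k1 q + y k1 q * y k1 q != 0 by case.
pose W := chart (x k0) (y k0) (x k1) (y k1) (x k2) (y k2).
have sW : smooth V0 W.
  exact: (chart_smooth oV0 (x_C k0) (y_C k0) (x_C k1) (y_C k1) (x_C k2) (y_C k2) nV).
have iso q u v : V0 q -> bil (fubini_study (4 * a ^+ 2) (W q)) ('D_u W q) ('D_v W q) = bil (g q) u v.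
  move=> Vq; have qr := V0r _ Vq; have [FTF FJ] := FU q qr.
  have Fdot (c d : 'cV[R]_(3 + 3)) : ((F q *m c)^T *m (F q *m d)) 0 0 = (c^T *m d) 0 0.
    by rewrite trmx_mul -mulmxA [_ *m (F q *m d)]mulmxA FTF mul1mx.
  have e1E j : e1 (lshift 3 j) 0 = (j == k1)%:R /\ e1 (rshift 3 j) 0 = 0.
    by rewrite /e1 !mxE eqxx !andbT eq_rlshift; split=> //; congr (_%:R); rewrite (inj_eq (@lshift_inj _ _)).
  have [Dux Duy] := Dpsi q u qr; have [Dvx Dvy] := Dpsi q v qr.
  have N1 : x k0 q ^+ 2 + y k0 q ^+ 2 + (x k1 q ^+ 2 + y k1 q ^+ 2) + (x k2 q ^+ 2 + y k2 q ^+ 2) = 1.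
    rewrite !expr2 -[LHS](dot_split (psi q) (psi q)) /psi Fdot dot_split.
    by rewrite !(e1E _).1 !(e1E _).2 /= !(mulr0, mul0r, addr0, add0r, mulr1).
  have f1 : x k0 q * 'D_u (x k0) q + y k0 q * 'D_u (y k0) q + (x k1 q * 'D_u (x k1) q + y k1 q * 'D_u (y k1) q)
    + (x k2 q * 'D_u (x k2) q + y k2 q * 'D_u (y k2) q) = 0.
    rewrite !Dux !Duy -[LHS](dot_split (psi q) (F q *m (om q u *m e1))) /psi Fdot dot_split.
    have [_ -> _ _ _] := om_e1 q u.
    by rewrite !(e1E _).1 !(e1E _).2 /= !(mulr0, mul0r, addr0, add0r, mulr1).
  (* Im <Z, dZ> is the real product of i Z with dZ; F commutes with i, so it can be read at e_1
     before F is applied. *)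
  have JD z : (forall j, 'D_z (x j) q = (F q *m (om q z *m e1)) (lshift 3 j) 0) ->
      (forall j, 'D_z (y j) q = (F q *m (om q z *m e1)) (rshift 3 j) 0) ->
      x k0 q * 'D_z (y k0) q - y k0 q * 'D_z (x k0) q + (x k1 q * 'D_z (y k1) q - y k1 q * 'D_z (x k1) q)
     + (x k2 q * 'D_z (y k2) q - y k2 q * 'D_z (x k2) q) = (om q z *m e1) (rshift 3 k1) 0.
    move=> Dx Dy; rewrite !Dx !Dy.
    transitivity (((F q *m (Jmx *m e1))^T *m (F q *m (om q z *m e1))) 0 0).
      rewrite [F q *m (Jmx *m e1)]mulmxA -FJ -[Jmx *m F q *m e1]mulmxA -/(psi q) dot_split.
      rewrite !(Jmx_entries (psi q) _).1 !(Jmx_entries (psi q) _).2 !mulNr.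
      by rewrite -/(x _ _) -/(y _ _); congr (_ + _ + _); rewrite addrC.
    rewrite Fdot dot_split !(Jmx_entries e1 _).1 !(Jmx_entries e1 _).2 !(e1E _).1 !(e1E _).2 /=.
    by rewrite !(oppr0, mul0r, addr0, add0r, mul1r).
  rewrite (chart_metric oV0 (x_C k0) (y_C k0) (x_C k1) (y_C k1) (x_C k2) (y_C k2) nV _ _ Vq N1 f1).
  rewrite (JD u Dux Duy) (JD v Dvx Dvy) !Dux !Duy !Dvx !Dvy.
  have := dot_split (F q *m (om q u *m e1)) (F q *m (om q v *m e1)); rewrite Fdot => <-.
  rewrite dot_split (bilE gE) dotE sum4.
  have [-> -> -> -> ->] := om_e1 q u; have [-> -> -> -> ->] := om_e1 q v.
  move: ((om q u *m e1) _ _) ((om q v *m e1) _ _) => X X'.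
  by move: (u *m C q) (v *m C q) => s t; field.
have dW q : V0 q -> differentiable W q by move=> Vq; have [d _] := sW 1%N; exact: d.
have jW q : V0 q -> jacobian W q \in unitmx.
  (* A map that pulls a metric back to the positive definite [g] has injective differential. *)
  move=> Vq; rewrite -row_free_unit -kermx_eq0; apply/rowV0P => u /sub_kermxP uJ.
  have Du : 'D_u W q = 0 by rewrite deriveEjacobian ?uJ//; exact: dW.
  have Mq : M q by apply: rM; exact: V0r.
  have := iso q u u Vq; rewrite Du [LHS](_ : _ = 0); last by rewrite /bil !mul0mx mxE.
  rewrite (bilE gE) dotE => /esym/eqP; rewrite psumr_eq0 => [|i _]; last by rewrite -expr2 sqr_ge0.
  move=> /allP u0; apply: (can_inj (mulmxK (Cunit Mq))); rewrite mul0mx.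
  by apply/rowP => i; rewrite [RHS]mxE; have := u0 i (mem_index_enum _); rewrite /= mulf_eq0 orbb => /eqP.
have [V [G [[oV Vp' VV0] [oW sG GW]]]] := inverse_function oV0 sW Vp jW.
exists V, W, G; split => //.
- by split => // q /VV0/V0r/rM.
- by move=> k; apply: Ck_sub VV0 (sW k).
- by move=> q u v /VV0; exact: iso.
Qed.

End ProjectiveCoframe.

Lemma conn_lin (R : realType) (a : R) h H q k u v :
  conn a h H q (k *: u + v) = k *: conn a h H q u + conn a h H q v.
Proof.
have S l : (k *: u + v) 0 l = k * u 0 l + v 0 l by rewrite !mxE.
apply/matrixP => i j; rewrite !mxE.
move: i; apply: ord4_ind; move: j; apply: ord4_ind;
  rewrite /= ?/rho ?/sig ?/mu ?/nu /tau /bet ?S; ring.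
Qed.

Lemma conn_unitary (R : realType) (a : R) h H q u : unitary_form (conn a h H q u).
Proof. by split; [exact: conn_skew|rewrite !mxE|rewrite !mxE]. Qed.

Theorem theorem4p6 (R : realType) (a : R) (U : set 'rV[R]_2)
    (h H : 'rV[R]_2 -> R)
    (E : 'I_4 -> 'rV[R]_4 -> 'rV[R]_4) (Jbar J : 'rV[R]_4 -> 'M[R]_4) :
  a != 0 ->
  open U ->
  smooth U h -> smooth U H ->
  (forall q, U q -> 0 < h q) -> (forall q, U q -> 0 < H q) ->
  (forall q, U q ->
     laplacian (@ln R \o H) q = 2 * a ^+ 2 * h q ^+ 2 - 4 * a ^+ 2 * H q ^+ 2) ->
  let M := domM a U in
  let g := gmet a h H in
  dual_frame M (theta a h H) E ->
  (forall p, M p -> kahler_form g Jbar p = Omega_bar a h H p) ->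
  (forall p, M p -> kahler_form g J p = Omega a h H p) ->
  let f := oriented E in
  let B (p : 'rV[R]_4) : R :=
    - 4 * a ^+ 2 * h (xy p) ^+ 2 + 2 * a ^+ 2 * H (xy p) ^+ 2
    - laplacian (@ln R \o h) (xy p) in
  let D (p : 'rV[R]_4) : R := h (xy p) ^+ 2 * cos (a * zc p) ^+ 2 in
  [/\ is_lee_form M (kahler_form g J) (lee_theta a H),
   [/\
      (* (i) *)
      forall q, U q ->
        laplacian (@ln R \o H) q = 2 * a ^+ 2 * h q ^+ 2 - 4 * a ^+ 2 * H q ^+ 2,
      (* (ii) *)
      forall p, M p ->
        Gamma g E o2 o1 o1 p =
          a * sin (a * zc p) * cos (2 * a * tc p) * H (xy p)
            / (cos (a * zc p) ^+ 2 * h (xy p))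
          - 'D_(uy R) h (xy p) / (cos (a * zc p) * h (xy p) ^+ 2) /\
        Gamma g E o1 o2 o2 p =
          a * sin (a * zc p) * sin (2 * a * tc p) * H (xy p)
            / (cos (a * zc p) ^+ 2 * h (xy p))
          - 'D_(ux R) h (xy p) / (cos (a * zc p) * h (xy p) ^+ 2),
      (* (iii) *)
      forall p, M p ->
        let lambda : R := B p / D p + 6 * a ^+ 2 in
        \matrix_(i < 4, j < 4) ricci g E p (E i p) (E j p) =
          diag_mx (\row_(i < 4)
            [:: lambda; lambda; 6 * a ^+ 2; 6 * a ^+ 2]`_i) &
      (* (iv) *)
      forall p, M p -> scalar_curv g E p =
        (- 8 * a ^+ 2 * h (xy p) ^+ 2 + 4 * a ^+ 2 * H (xy p) ^+ 2
         - 2 * laplacian (@ln R \o h) (xy p)) / D p + 24 * a ^+ 2],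
   [/\
      (* (v) *)
      forall p, M p -> conformal_scalar_curv g E (lee_theta a H) p =
        (- 8 * a ^+ 2 * h (xy p) ^+ 2 + 4 * a ^+ 2 * H (xy p) ^+ 2
         - 2 * laplacian (@ln R \o h) (xy p)) / D p,
      (* (vi) *)
      forall p (phi psi : 'M[R]_4), M p ->
        in_LM g f (Omega a h H) p phi -> in_LM g f (Omega a h H) p psi ->
        ip2 f p phi phi = 1 -> ip2 f p psi psi = 1 -> ip2 f p phi psi = 0 ->
        [/\ weyl_minus g f p (Omega a h H p) = (B p / (3 * D p)) *: Omega a h H p,
            weyl_minus g f p phi = (- B p / (6 * D p)) *: phi &
            weyl_minus g f p psi = (- B p / (6 * D p)) *: psi] &
      (* (vii) *)
      forall p, M p ->
        sectional g p (E o1 p) (E o2 p) =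
          (2 * a ^+ 2 * H (xy p) ^+ 2 - laplacian (@ln R \o h) (xy p))
            / (cos (a * zc p) ^+ 2 * h (xy p) ^+ 2)
          - 4 * a ^+ 2 * tan (a * zc p) ^+ 2 /\
        sectional g p (E o3 p) (E o4 p) = 4 * a ^+ 2] &
      (* (viii) *)
      (space_form g M Jbar <->
         forall q, U q ->
           laplacian (@ln R \o h) q =
             - 4 * a ^+ 2 * h q ^+ 2 + 2 * a ^+ 2 * H q ^+ 2) /\
      (space_form g M Jbar ->
         locally_isometric M g (fubini_study (4 * a ^+ 2)))].
Proof.
move=> a0 oU hs Hs hp Hp toda M g Edual kJbar kJ f B D.
have iff := space_form_iff a0 oU hs Hs hp Hp toda Edual kJbar.
have BE q : Bfun a h H q = 0 <-> laplacian (@ln R \o h) q =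
    - 4 * a ^+ 2 * h q ^+ 2 + 2 * a ^+ 2 * H q ^+ 2.
  by rewrite /Bfun; split=> [/eqP|->]; [rewrite subr_eq0 => /eqP <-|rewrite subrr].
have Bp p : B p = Bfun a h H (xy p) by [].
have Dp p : D p = Dfun a h p by [].
split; [|split|split|split].
- move=> p u v w Mp.
  rewrite (kJ p Mp) -(lee_form_Omega a0 oU hs Hs hp Hp toda u v w Mp) /ext_deriv2.
  (* The Kähler form of [J] equals [Omega] on [M] only; since [M] is open, their derivatives at
     points of [M] agree. *)
  have dE x y z : 'D_x (fun q => bil (kahler_form g J q) y z) p =
      'D_x (fun q => bil (Omega a h H q) y z) p.
    apply: near_eq_derive; apply: (@near_open _ _ M) => [|//|q Mq]; first exact: domM_open.
    by rewrite kJ.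
  by rewrite !dE.
- exact: toda.
- exact: (Gamma_horizontal a0 oU hs Hs hp Hp toda Edual).
- exact: (ricci_matrix a0 oU hs Hs hp Hp toda Edual).
- move=> p Mp; rewrite (scalar_frame a0 oU hs Hs hp Hp toda Edual Mp) addrC; congr (_ + _).
  exact: esym (curvature_ratio H a0 hp Mp).
- move=> p Mp; rewrite (conformal_frame a0 oU hs Hs hp Hp toda Edual Mp).
  exact: esym (curvature_ratio H a0 hp Mp).
- move=> p phi psi Mp Lphi Lpsi _ _ _.
  have D0 := Dfun_neq0 a0 hp Mp.
  have E6 : - B p / (6 * D p) = - (Bfun a h H (xy p) / Dfun a h p / 6).
    by rewrite Dp Bp; move: (Bfun a h H (xy p)) (Dfun a h p) D0 => x y y0; field.
  have E3 : B p / (3 * D p) = Bfun a h H (xy p) / Dfun a h p / 3.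
    by rewrite Dp Bp; move: (Bfun a h H (xy p)) (Dfun a h p) D0 => x y y0; field.
  rewrite E6 E3; split.
  + exact: (weyl_minus_Omega a0 oU hs Hs hp Hp toda Edual).
  + exact: (weyl_minus_LM a0 oU hs Hs hp Hp toda Edual).
  + exact: (weyl_minus_LM a0 oU hs Hs hp Hp toda Edual).
- exact: (sectional_frame a0 oU hs Hs hp Hp toda Edual).
- by split=> [/iff B0 q /B0/BE//|lap]; apply/iff => q /lap/BE.
- move=> /iff B0; apply: (projective_isometry (C := cofr a h H) (A := conn a h H)) => //.
  + exact: domM_open.
  + exact: cofr_smooth.
  + exact: conn_smooth.
  + by move=> q k u v; exact: conn_lin.
  + by move=> q u _; exact: conn_unitary.
  + by move=> q u v /domM_U Uq; exact: (cofr_torsion a0 oU hs Hs hp Hp toda).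
  (* With B = 0 the last term of the (1, 2) entry disappears and what is left is the curvature of
     the projective plane. *)
  + move=> q u v /domM_U Uq.
    have [T12 T13 T14 _ [_ T34]] := curvature_entries a0 oU hs Hs hp Hp toda u v Uq.
    by split=> //; rewrite T12 (B0 _ Uq) mul0r subr0.
  + exact: gmetE.
  + by move=> q; exact: cofr_unit.
Qed.
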